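(* Let $\phi : \mathbb{H} \to \mathbb{H}$ be holomorphic and let $\alpha > -1$. If the composition operator $C_\phi$ is bounded on $\mathcal{A}^2_\alpha(\mathbb{H})$, then the spectral radius of $C_\phi$ on $\mathcal{A}^2_\alpha(\mathbb{H})$ is equal to its operator norm.
   Context: $\mathbb{H} = \{z \in \mathbb{C} : \Re z > 0\}$ is the right half-plane. For $\alpha > -1$, the weighted Bergman space $\mathcal{A}^2_\alpha(\mathbb{H})$ is the Hilbert space of analytic functions $F : \mathbb{H} \to \mathbb{C}$ with $\|F\|^2_{\mathcal{A}^2_\alpha(\mathbb{H})} := \frac{1}{\pi}\int_{-\infty}^\infty \int_0^\infty x^\alpha |F(x+iy)|^2\,dx\,dy < \infty$. For holomorphic $\phi : \mathbb{H} \to \mathbb{H}$, the composition operator is $C_\phi F = F \circ \phi$; it is bounded on $\mathcal{A}^2_\alpha(\mathbb{H})$ if it maps this space into itself as a bounded linear operator. *)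

(* Defs.v *)
From HB Require Import structures.
From mathcomp Require Import all_boot all_order all_algebra.
From mathcomp Require Import complex.
From mathcomp Require Import all_classical all_reals all_analysis.
Import Order.TTheory GRing.Theory Num.Theory.
Import numFieldNormedType.Exports.

Set Implicit Arguments.
Unset Strict Implicit.
Unset Printing Implicit Defensive.

Local Open Scope classical_set_scope.
Local Open Scope ring_scope.
Local Open Scope complex_scope.

(* Bounded linear operators on a complex normed space. The space is given as
   the subspace A of a vector space V, with norm N on A; an operator on A is a
   map T : V -> V of which only the values on A matter. *)
Section Operators.
Variables (R : realType) (V : lmodType R[i]) (A : set V) (N : V -> R).

Definition bounded_operator (T : V -> V) : Prop :=
  [/\ forall F, A F -> A (T F),
      forall (a : R[i]) F G, A F -> A G -> T (a *: F + G) = a *: T F + T G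
    & exists M : R, forall F, A F -> N (T F) <= M * N F].

Definition operator_norm (T : V -> V) : \bar R :=
  ereal_sup [set (N (T F))%:E | F in [set F | A F /\ N F <= 1]].

Definition operator_spectrum (T : V -> V) : set R[i] :=
  [set l | ~ exists S : V -> V, bounded_operator S /\
     forall F, A F -> S (l *: F - T F) = F /\ l *: S F - T (S F) = F].

Definition spectral_radius (T : V -> V) : \bar R :=
  ereal_sup [set (ComplexField.Normc.normc l)%:E | l in operator_spectrum T].

End Operators.

Section Bergman.
Variable R : realType.

Definition rhp : Type := {z : R[i] | 0 < complex.Re z}.

(* Extension by 0 of a function on the half-plane, so that the library's
   derivative and integrals apply; as the half-plane is open, the value chosen
   outside it affects neither derivability nor the integral below. *)
Definition rhp_ext (F : rhp -> R[i]) (z : R[i]) : R[i] := oapp F 0 (insub z).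

(* On R[i]^o, the scalar field is R[i] itself: this is complex
   differentiability. *)
Definition holomorphic_rhp (F : rhp -> R[i]) : Prop :=
  forall z : rhp, derivable (rhp_ext F : R[i]^o -> R[i]^o) (val z) 1.

Definition bergman_sqnorm (alpha : R) (F : rhp -> R[i]) : \bar R :=
  ((pi^-1)%:E *
   \int[lebesgue_measure]_(y in [set: R])
     \int[lebesgue_measure]_(x in `]0%R, +oo[)
       (x `^ alpha * ComplexField.Normc.normc (rhp_ext F (x +i* y)) ^+ 2)%:E)%E.

Definition bergman_norm (alpha : R) (F : rhp -> R[i]^o) : R :=
  Num.sqrt (fine (bergman_sqnorm alpha F)).

Definition bergman_space (alpha : R) : set (rhp -> R[i]^o) :=
  [set F | holomorphic_rhp F /\ (bergman_sqnorm alpha F < +oo)%E].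

Definition composition_operator (phi : rhp -> rhp) (F : rhp -> R[i]^o) :
  rhp -> R[i]^o := F \o phi.

End Bergman.

(* Main.v *)
(* Let p = alpha + 2 and lambda = sup Re z / Re (phi z).  Testing boundedness on
   the functions z |-> (z + conj c)^-m against the point evaluation bound
   |F w|^2 (Re w)^p <= C ||F||^2 shows that lambda is finite.  The Poisson
   kernel of Re z > x' composed with phi has integral at most lambda times its
   mass on vertical lines far enough to the right, so ||F o phi||^2 <= lambda^p ||F||^2,
   i.e. the norm is at most L = lambda^(p/2).

   Conversely phi z / z -> 1 / lambda in every cone |z| <= c Re z, by a
   Pick-type inequality applied to phi - z / lambda, whose real part is
   nonnegative.  Hence, for V = C_phi / L, the iterates V^k f of a test function
   f centred far out on the real axis add up at a suitable point instead of
   cancelling, and (sum_(k < n) V^k)^2 f has norm at least n times a constant.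
   If L - C_phi had a bounded inverse these norms would be bounded in n; so L is
   in the spectrum.

   Finally |l| > ||C_phi|| is in the resolvent set: the Neumann series
   sum_n l^(-n-1) F o phi^n converges pointwise to a holomorphic function, and
   a weighted Cauchy-Schwarz inequality bounds its norm.  Therefore
   L <= spectral radius <= norm <= L. *)
From HB Require Import structures.
Require Import Defs.
From mathcomp Require Import all_boot all_order all_algebra.
From mathcomp Require Import complex.
From mathcomp Require Import all_classical all_reals all_analysis.
From mathcomp Require Import measurable_realfun.
From mathcomp Require Import ring lra zify.
Import Order.TTheory GRing.Theory Num.Theory.
Import numFieldNormedType.Exports.
Import ComplexField.Normc.

Set Implicit Arguments.
Unset Strict Implicit.
Unset Printing Implicit Defensive.

Local Open Scope classical_set_scope.
Local Open Scope ring_scope.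
Local Open Scope complex_scope.
Local Notation "z ^*" := (conjc z) : ring_scope.

(** * Complex numbers and differentiability *)

(** The spectrum is defined through two-sided bounded inverses, so the lower bound needs an explicit
    spectral point. L is the natural candidate because far out on the real axis Phi acts like z /
    lam. A single sum of the V^k would not do: at a point adapted to V^N f, only one term is known
    to be comparable with the norm of f. In the square of the sum the index N is hit by N + 1 pairs,
    and every other pair contributes a positive real part, since the orbit of a large real number
    stays close to the positive axis.

    All function theory rests on Cauchy's formula for rectangles: truncated line integrals with
    explicit errors O(1/N) yield the Poisson formula and the Pick inequality. They need bounded
    functions, hence the detours through F^2 on Re z >= x', through 1 / (Phi - c) and through 1 /
    (psi + delta). Norms are handled as squared integrals [sqn], for which (a + b)^2 <= 2 a^2 + 2
    b^2 and a weighted Cauchy-Schwarz inequality replace the triangle inequality of L^2. *)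

Section ComplexNumbers.
Variable R : realType.
Local Notation C := R[i].
Local Notation Re := (@complex.Re R).
Local Notation Im := (@complex.Im R).
Implicit Types (x y : R) (z w : C).

Lemma ReD z w : Re (z + w) = Re z + Re w. Proof. by case: z w => ? ? [? ?]. Qed.
Lemma ImD z w : Im (z + w) = Im z + Im w. Proof. by case: z w => ? ? [? ?]. Qed.
Lemma ReN z : Re (- z) = - Re z. Proof. by case: z. Qed.
Lemma ImN z : Im (- z) = - Im z. Proof. by case: z. Qed.
Lemma ReB z w : Re (z - w) = Re z - Re w. Proof. by rewrite ReD ReN. Qed.
Lemma ImB z w : Im (z - w) = Im z - Im w. Proof. by rewrite ImD ImN. Qed.
Lemma ReM z w : Re (z * w) = Re z * Re w - Im z * Im w.
Proof. by case: z w => ? ? [? ?]. Qed.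
Lemma ImM z w : Im (z * w) = Re z * Im w + Im z * Re w.
Proof. by case: z w => ? ? [? ?]. Qed.
Lemma ReV z : Re z^-1 = Re z / (Re z ^+ 2 + Im z ^+ 2). Proof. by case: z. Qed.
Lemma ImV z : Im z^-1 = - (Im z / (Re z ^+ 2 + Im z ^+ 2)). Proof. by case: z. Qed.
Lemma ReJ z : Re (z^*) = Re z. Proof. by case: z. Qed.
Lemma ImJ z : Im (z^*) = - Im z. Proof. by case: z. Qed.
Definition ReImE :=
  (ReD, ImD, ReN, ImN, ReM, ImM, ReV, ImV, ReJ, ImJ).

Lemma complexP z w : Re z = Re w -> Im z = Im w -> z = w.
Proof. by case: z w => ? ? [? ?] /= -> ->. Qed.

Lemma normc_ge0 z : 0 <= normc z.
Proof. by case: z => a b; rewrite sqrtr_ge0. Qed.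

Lemma normc_sq z : normc z ^+ 2 = Re z ^+ 2 + Im z ^+ 2.
Proof. by case: z => a b; rewrite /= sqr_sqrtr// addr_ge0// sqr_ge0. Qed.

Lemma normc_gt0 z : (0 < normc z) = (z != 0).
Proof.
rewrite lt_def normc_ge0 andbT; congr (~~ _).
apply/eqP/eqP => [/eq0_normc//|->]; exact: normc0.
Qed.

Lemma normcD z w : normc (z + w) <= normc z + normc w.
Proof. exact: (@le_normcD R z w). Qed.

Lemma normc_opp z : normc (- z) = normc z.
Proof. exact: (@normcN R z). Qed.

Lemma normcB z w : normc (z - w) = normc (w - z).
Proof. by rewrite -opprB normc_opp. Qed.

Lemma normcBD z w : normc (z - w) <= normc z + normc w.
Proof. by rewrite (le_trans (normcD _ _))// normc_opp. Qed.

Lemma normcX z n : normc (z ^+ n) = normc z ^+ n.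
Proof.
elim: n => [|n ih]; first by rewrite !expr0 normc1.
by rewrite !exprS normcM ih.
Qed.

Lemma normc_conj z : normc (z^*) = normc z.
Proof. by case: z => a b /=; rewrite sqrrN. Qed.

Lemma normc_real x : normc (x%:C) = `|x|.
Proof. by rewrite /= expr0n /= addr0 sqrtr_sqr. Qed.

Lemma le_normc_sq z y : 0 <= y -> (normc z <= y) = (Re z ^+ 2 + Im z ^+ 2 <= y ^+ 2).
Proof. by move=> y0; rewrite -normc_sq ler_sqr// nnegrE ?normc_ge0. Qed.

Lemma ge_normc_sq z y : 0 <= y -> (y <= normc z) = (y ^+ 2 <= Re z ^+ 2 + Im z ^+ 2).
Proof. by move=> y0; rewrite -normc_sq ler_sqr// nnegrE ?normc_ge0. Qed.

Lemma normc_Re z : `|Re z| <= normc z.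
Proof. by rewrite ge_normc_sq// real_normK ?num_real// lerDl sqr_ge0. Qed.

Lemma normc_Im z : `|Im z| <= normc z.
Proof. by rewrite ge_normc_sq// real_normK ?num_real// lerDr sqr_ge0. Qed.

Lemma Re_le_normc z : Re z <= normc z.
Proof. exact: le_trans (ler_norm _) (normc_Re z). Qed.

Lemma normc_le_ReIm z : normc z <= `|Re z| + `|Im z|.
Proof.
rewrite le_normc_sq ?addr_ge0// sqrrD !real_normK ?num_real//.
by rewrite addrAC lerDl mulrn_wge0// mulr_ge0.
Qed.

Lemma normc_sum I (r : seq I) (P : pred I) (F : I -> C) :
  normc (\sum_(i <- r | P i) F i) <= \sum_(i <- r | P i) normc (F i).
Proof.
elim/big_ind2: _ => // [|z1 a1 z2 a2 h1 h2]; first by rewrite normc0.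
by rewrite (le_trans (normcD _ _))// lerD.
Qed.

Lemma Re_sum I (r : seq I) (P : pred I) (F : I -> C) :
  Re (\sum_(i <- r | P i) F i) = \sum_(i <- r | P i) Re (F i).
Proof. by elim/big_rec2: _ => // i y z _ <-; rewrite ReD. Qed.

Lemma Im_sum I (r : seq I) (P : pred I) (F : I -> C) :
  Im (\sum_(i <- r | P i) F i) = \sum_(i <- r | P i) Im (F i).
Proof. by elim/big_rec2: _ => // i y z _ <-; rewrite ImD. Qed.

Lemma normrC_normc z : `|z| = (normc z)%:C.
Proof. by []. Qed.

(** Epsilon and the radius are real here, whereas balls in [R[i]^o] have complex radii;
    [derivable_cdiff] is the bridge. *)
Definition cdiff_at (f : C -> C) z (d : C) := forall e : R, 0 < e ->
  exists2 r : R, 0 < r & forall w, normc (w - z) < r ->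
    normc (f w - f z - d * (w - z)) <= e * normc (w - z).

Definition ccont_at (f : C -> C) z := forall e : R, 0 < e ->
  exists2 r : R, 0 < r & forall w, normc (w - z) < r -> normc (f w - f z) < e.

Lemma cdiff_cont f z d : cdiff_at f z d -> ccont_at f z.
Proof.
move=> fd e e0; have [r r0 H] := fd 1 ltr01.
have D0 := normc_ge0 d.
exists (Num.min r (e / (2 + normc d))).
  by rewrite lt_min r0 divr_gt0//; lra.
move=> w; rewrite lt_min => /andP[wr we].
have := H _ wr; rewrite mul1r => h1.
have -> : f w - f z = (f w - f z - d * (w - z)) + d * (w - z) by ring.
apply: (le_lt_trans (normcD _ _)); rewrite normcM.
have D2 : 0 < 2 + normc d by lra.
move: we; rewrite ltr_pdivlMr// => we.
have wz0 := normc_ge0 (w - z).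
nra.
Qed.

(** A positive element of [R[i]] has zero imaginary part, so a ball of complex radius is a disc of
    real radius. *)
Lemma nbhs_normc (z : C) (A : set C) :
  nbhs (z : R[i]^o) A <-> exists2 r : R, 0 < r & forall w, normc (w - z) < r -> A w.
Proof.
split.
  move/nbhs_ballP => [e e0 H].
  have e1 : 0 < complex.Re e by move: e0; rewrite /= ltcE => /andP[].
  exists (complex.Re e) => // w wz; apply: H.
  rewrite -ball_normE /=; rewrite normrC_normc ltcE /= -normcB wz andbT.
  by move: e0; rewrite /= ltcE => /andP[/eqP->].
move=> [r r0 H]; apply/nbhs_ballP; exists (r%:C); first by rewrite /= ltcR.
move=> w; rewrite -ball_normE /= normrC_normc ltcR => wz; apply: H.
by rewrite normcB.
Qed.

Lemma derivable_cdiff (f : C -> C) z :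
  derivable (f : R[i]^o -> R[i]^o) z 1 <-> exists d, cdiff_at f z d.
Proof.
split.
  move=> /cvg_ex[/= l Hl]; exists l => e e0.
  move/cvgrPdist_lt : Hl => /(_ (e%:C)).
  rewrite ltcR => /(_ e0); rewrite near_withinE near_simpl => /nbhs_normc[r r0 H].
  exists r => // w wz; have [->|wnz] := eqVneq w z.
    by rewrite !subrr mulr0 subrr normc0 mulr0.
  have /H : normc (w - z - 0) < r by rewrite subr0.
  rewrite subr_eq0 => /(_ wnz); rewrite /= normrC_normc ltcR => h.
  have w0 : w - z != 0 by rewrite subr_eq0.
  have -> : f w - f z - l * (w - z) =
     - ((w - z) * (l - (w - z)^-1 *: (f ((w - z) *: 1 + z) - f z))).
    rewrite /GRing.scale /= mulr1 subrK; field; exact: w0.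
  by rewrite normc_opp normcM mulrC ler_wpM2r ?normc_ge0// ltW.
move=> [d H]; apply/cvg_ex; exists d.
apply/cvgrPdist_lt => e /[dup] e0; rewrite ltcE => /andP[/eqP ie re].
have [r r0 {}H] := H (complex.Re e / 2) (divr_gt0 re (ltr0Sn _ 1)).
rewrite near_withinE near_simpl; apply/nbhs_normc; exists r => // w.
rewrite subr0 => wr w0; rewrite /= normrC_normc ltcE /= ie eqxx /=.
have := H (w *: 1 + z); rewrite addrK.
have w1 : w *: (1 : R[i]^o) = w by rewrite /GRing.scale /= mulr1.
rewrite w1 => /(_ wr) h.
have -> : d - w^-1 *: ((f (w + z) : R[i]^o) - f z) =
   - (w^-1 * (f (w + z) - f z - d * w)).
  by rewrite /GRing.scale /=; field; exact: w0.
rewrite normc_opp normcM normcV.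
have nw : 0 < normc w by rewrite normc_gt0.
rewrite mulrC ltr_pdivrMr//; apply: le_lt_trans h _.
by rewrite ltr_pM2r//; lra.
Qed.

End ComplexNumbers.

(** * Integrals along segments and Cauchy's theorem on rectangles *)

Section PathIntegrals.
Variable R : realType.
Local Notation C := R[i].
Local Notation Re := (@complex.Re R).
Local Notation Im := (@complex.Im R).
Local Notation mu := (@lebesgue_measure R).

Definition rint a b (f : R -> R) : R := \int[mu]_(t in `[a, b]) f t.

(** Two-sided continuity, end points included: the integrands come from functions continuous at the
    points of the path within the whole plane, and subspace topologies are thus avoided. *)
Definition rcont a b (f : R -> R) := forall t, a <= t <= b -> {for t, continuous f}.

Lemma rcont_integrable a b f : rcont a b f -> mu.-integrable `[a, b] (EFin \o f).
Proof.
move=> cf; apply: continuous_compact_integrable; first exact: segment_compact.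
by apply: continuous_in_subspaceT => t /set_mem /=; rewrite in_itv => /cf.
Qed.

Lemma eq_rcont a b f g : (forall t, g t = f t) -> rcont a b f -> rcont a b g.
Proof. by move=> /funext ->. Qed.

Lemma rcontD a b f g : rcont a b f -> rcont a b g -> rcont a b (fun t => f t + g t).
Proof. by move=> cf cg t abt; apply: continuousD; [exact: cf|exact: cg]. Qed.

Lemma rcontM a b f g : rcont a b f -> rcont a b g -> rcont a b (fun t => f t * g t).
Proof. by move=> cf cg t abt; apply: continuousM; [exact: cf|exact: cg]. Qed.

Lemma rcontV a b f : (forall t, a <= t <= b -> f t != 0) -> rcont a b f ->
  rcont a b (fun t => (f t)^-1).
Proof. by move=> f0 cf t abt; apply: continuousV; [exact: f0|exact: cf]. Qed.

Lemma rcont_cst a b k : rcont a b (fun=> k).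
Proof. by move=> t _; exact: cst_continuous. Qed.

Lemma rcont_id a b : rcont a b id.
Proof. by move=> t _; exact: cvg_id. Qed.

Lemma rintD a b f g : rcont a b f -> rcont a b g ->
  rint a b (fun t => f t + g t) = rint a b f + rint a b g.
Proof. by move=> cf cg; apply: RintegralD => //; exact: rcont_integrable. Qed.

Lemma rintZ a b k f : rcont a b f -> rint a b (fun t => k * f t) = k * rint a b f.
Proof. by move=> cf; apply: RintegralZl => //; exact: rcont_integrable. Qed.

Lemma rint_le a b f g : rcont a b f -> rcont a b g ->
  (forall t, a <= t <= b -> f t <= g t) -> rint a b f <= rint a b g.
Proof.
move=> cf cg fg; apply: le_Rintegral => //; try exact: rcont_integrable.
Qed.

Lemma rint_cst a b k : a <= b -> rint a b (fun=> k) = k * (b - a).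
Proof.
move=> ab; rewrite /rint Rintegral_cst//= lebesgue_measure_itv /=.
rewrite lte_fin; case: ltP => //= ba; congr (_ * _).
by apply/esym/eqP; rewrite subr_eq0 eq_le ba ab.
Qed.

Lemma eq_rint a b f g : (forall t, a <= t <= b -> f t = g t) -> rint a b f = rint a b g.
Proof. by move=> fg; apply: eq_Rintegral => t /set_mem /=; rewrite in_itv => /fg. Qed.

Lemma rint_split a c b f : a <= c -> c <= b -> rcont a b f ->
  rint a b f = rint a c f + rint c b f.
Proof.
move=> ac cb cf; have iab := rcont_integrable cf.
have := @Rintegral_itvB R f (BLeft a) (BRight b) c iab.
rewrite !bnd_simp => /(_ ac cb); rewrite Rintegral_itv_obnd_cbnd.
  by rewrite /rint => <-; rewrite addrC subrK.
by apply: (integrableS _ _ _ iab) => //; apply: subset_itv; rewrite bnd_simp.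
Qed.

Lemma rint_id a b : a <= b -> rint a b id = (b ^+ 2 - a ^+ 2) / 2.
Proof.
rewrite le_eqVlt => /orP[/eqP <-|ab].
  by rewrite subrr mul0r /rint set_itv1 Rintegral_set1.
rewrite /rint /Rintegral (@continuous_FTC2 _ id (fun x => x ^+ 2 / 2) a b)//.
- by rewrite /=; ring.
- by apply: continuous_subspaceT => x; exact: cvg_id.
- split=> [x _| | ].
  + by [].
  + apply: cvg_at_right_filter; apply: cvgM; last exact: cvg_cst.
    by apply: exprn_continuous.
  + apply: cvg_at_left_filter; apply: cvgM; last exact: cvg_cst.
    by apply: exprn_continuous.
- move=> x _; rewrite derive1E deriveM// derive_cst scaler0 add0r.
  by rewrite exp_derive /= expr1 /GRing.scale /=; field.
Qed.

Definition pcont a b (u : R -> C) := forall t, a <= t <= b ->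
  forall e, 0 < e -> exists2 r, 0 < r & forall s, `|s - t| < r -> normc (u s - u t) < e.

Lemma rcontP (f : R -> R) t : (forall e, 0 < e ->
  exists2 r, 0 < r & forall s, `|s - t| < r -> `|f s - f t| < e) ->
  {for t, continuous f}.
Proof.
move=> H; apply/cvgrPdist_lt => e e0; have [r r0 {}H] := H e e0.
apply/nbhs_ballP; exists r => // s; rewrite /ball /= => st.
by rewrite distrC H// distrC.
Qed.

Lemma contrP (f : R -> R) t : {for t, continuous f} -> (forall e, 0 < e ->
  exists2 r, 0 < r & forall s, `|s - t| < r -> `|f s - f t| < e).
Proof.
move=> /cvgrPdist_lt H e e0.
have /nbhs_ballP[r /= r0 {}H] := H e e0; exists r => // s st.
by rewrite distrC; apply: H; rewrite /ball /= distrC.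
Qed.

Lemma pcont_Re a b u : pcont a b u -> rcont a b (fun t => Re (u t)).
Proof.
move=> cu t /cu H; apply: rcontP => e /H[r r0 {}H]; exists r => // s /H.
by apply: le_lt_trans; rewrite -ReB normc_Re.
Qed.

Lemma pcont_Im a b u : pcont a b u -> rcont a b (fun t => Im (u t)).
Proof.
move=> cu t /cu H; apply: rcontP => e /H[r r0 {}H]; exists r => // s /H.
by apply: le_lt_trans; rewrite -ImB normc_Im.
Qed.

Lemma pcont_normc a b u : pcont a b u -> rcont a b (fun t => normc (u t)).
Proof.
move=> cu t /cu H; apply: rcontP => e /H[r r0 {}H]; exists r => // s /H.
apply: le_lt_trans; rewrite ler_distl; apply/andP; split.
  rewrite lerBlDr; have {1}-> : u t = u s - (u s - u t) by ring.
  exact: normcBD.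
have {1}-> : u s = u t + (u s - u t) by ring.
exact: normcD.
Qed.

Lemma pcontE a b u : rcont a b (fun t => Re (u t)) -> rcont a b (fun t => Im (u t)) ->
  pcont a b u.
Proof.
move=> cr ci t abt e e0.
have e2 : 0 < e / 2 by rewrite divr_gt0.
have [r r0 Hr] := contrP (cr t abt) e2.
have [q q0 Hq] := contrP (ci t abt) e2.
exists (Num.min r q); first by rewrite lt_min r0.
move=> s; rewrite lt_min => /andP[/Hr hr /Hq hi].
by apply: (le_lt_trans (normc_le_ReIm _)); rewrite ReB ImB; lra.
Qed.

Lemma pcont_cst a b k : pcont a b (fun=> k).
Proof. by move=> t _ e e0; exists 1 => // s _; rewrite subrr normc0. Qed.

Lemma pcont_real a b (f : R -> R) : rcont a b f -> pcont a b (fun t => (f t)%:C).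
Proof. by move=> cf; apply: pcontE => //; exact: rcont_cst. Qed.

Definition cint a b (u : R -> C) : C :=
  rint a b (fun t => Re (u t)) +i* rint a b (fun t => Im (u t)).

Lemma eq_cint a b u v : (forall t, a <= t <= b -> u t = v t) -> cint a b u = cint a b v.
Proof. by move=> uv; congr (_ +i* _); apply: eq_rint => t /uv ->. Qed.

Lemma cint_lin a b k u v : pcont a b u -> pcont a b v ->
  cint a b (fun t => k * u t + v t) = k * cint a b u + cint a b v.
Proof.
move=> cu cv; have [cru ciu] := (pcont_Re cu, pcont_Im cu).
have [crv civ] := (pcont_Re cv, pcont_Im cv).
have cZ x f : rcont a b f -> rcont a b (fun t => x * f t).
  by move=> cf; apply: rcontM => //; exact: rcont_cst.
apply: complexP; rewrite /= !ReImE /=.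
  transitivity (rint a b (fun t => (Re k * Re (u t) + - Im k * Im (u t)) + Re (v t))).
    by apply: eq_rint => t _; rewrite !ReImE; ring.
  rewrite !rintD ?rintZ//; do ?(apply: rcontD || apply: cZ) => //.
  by ring.
transitivity (rint a b (fun t => (Re k * Im (u t) + Im k * Re (u t)) + Im (v t))).
  by apply: eq_rint => t _; rewrite !ReImE; ring.
by rewrite !rintD ?rintZ//; do ?(apply: rcontD || apply: cZ) => //.
Qed.

Lemma cint_cst a b k : a <= b -> cint a b (fun=> k) = (b - a)%:C * k.
Proof.
by move=> ab; apply: complexP; rewrite /= rint_cst// !ReImE /=; ring.
Qed.

Lemma cint0 a b : cint a b (fun=> 0) = 0.
Proof.
by apply: complexP; rewrite /= /rint /Rintegral integral0.
Qed.

Lemma cintZ a b k u : pcont a b u -> cint a b (fun t => k * u t) = k * cint a b u.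
Proof.
move=> cu; rewrite -[RHS]addr0 -[X in _ + X](cint0 a b) -cint_lin//; last exact: pcont_cst.
by apply: eq_cint => t _; rewrite addr0.
Qed.

Lemma cintD a b u v : pcont a b u -> pcont a b v ->
  cint a b (fun t => u t + v t) = cint a b u + cint a b v.
Proof.
move=> cu cv; rewrite -[X in X + _]mul1r -cint_lin//.
by apply: eq_cint => t _; rewrite mul1r.
Qed.

Lemma cint_split a c b u : a <= c -> c <= b -> pcont a b u ->
  cint a b u = cint a c u + cint c b u.
Proof.
move=> ac cb cu; apply: complexP; rewrite !ReImE /= -rint_split//.
  exact: pcont_Re.
exact: pcont_Im.
Qed.

Lemma cint_id a b : a <= b -> cint a b (fun t => t%:C) = ((b ^+ 2 - a ^+ 2) / 2)%:C.
Proof. by move=> ab; apply: complexP; rewrite /= ?rint_id// rint_cst// mul0r. Qed.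

Lemma Re_cint a b u : Re (cint a b u) = rint a b (fun t => Re (u t)).
Proof. by []. Qed.

(* With I the integral, |I|^2 = Re (I^* * I) is the integral of Re (I^* * u). *)
Lemma normc_cint a b u f : pcont a b u -> rcont a b f ->
  (forall t, a <= t <= b -> normc (u t) <= f t) -> normc (cint a b u) <= rint a b f.
Proof.
move=> cu cf uf; set I := cint a b u.
have [->|I0] := eqVneq I 0.
  rewrite normc0; apply: Rintegral_ge0 => t /=; rewrite in_itv => /uf.
  exact: le_trans (normc_ge0 _).
have nI : 0 < normc I by rewrite normc_gt0.
rewrite -(ler_pM2l nI) -expr2.
have -> : normc I ^+ 2 = Re (I^* * I) by rewrite normc_sq !ReImE; ring.
rewrite /I -cintZ// Re_cint -rintZ//.
have cIu : pcont a b (fun t => (cint a b u)^* * u t).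
  move=> t abt e e0; have [r r0 H] := cu t abt (e / normc I) (divr_gt0 e0 nI).
  exists r => // s /H; rewrite ltr_pdivlMr// mulrC -mulrBr normcM normc_conj.
  exact.
apply: rint_le => [||t abt].
- exact: pcont_Re.
- by apply: rcontM => //; exact: rcont_cst.
- by rewrite (le_trans (Re_le_normc _))// normcM normc_conj ler_wpM2l ?normc_ge0 ?uf.
Qed.

Lemma normc_cint_le a b u M : a <= b -> pcont a b u ->
  (forall t, a <= t <= b -> normc (u t) <= M) -> normc (cint a b u) <= M * (b - a).
Proof.
move=> ab cu uM; rewrite -rint_cst//; apply: normc_cint => //; exact: rcont_cst.
Qed.

Lemma rint_ge0 a b f : (forall t, a <= t <= b -> 0 <= f t) -> 0 <= rint a b f.
Proof. by move=> f0; apply: Rintegral_ge0 => t /=; rewrite in_itv => /f0. Qed.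

Lemma ccont_hline (f : C -> C) a b y :
  (forall x, a <= x <= b -> ccont_at f (x +i* y)) -> pcont a b (fun x => f (x +i* y)).
Proof.
move=> cf t /cf H e /H[r r0 {}H]; exists r => // s st; apply: H; apply: (le_lt_trans (normc_le_ReIm _)).
by rewrite ReB ImB //= subrr normr0 addr0.
Qed.

Lemma ccont_vline (f : C -> C) a b x :
  (forall y, a <= y <= b -> ccont_at f (x +i* y)) -> pcont a b (fun y => f (x +i* y)).
Proof.
move=> cf t /cf H e /H[r r0 {}H]; exists r => // s st; apply: H; apply: (le_lt_trans (normc_le_ReIm _)).
by rewrite ReB ImB //= subrr normr0 add0r.
Qed.

End PathIntegrals.

(** * Goursat's theorem on rectangles *)

Section Goursat.
Variable R : realType.
Local Notation C := R[i].
Local Notation Re := (@complex.Re R).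
Local Notation Im := (@complex.Im R).
Implicit Types (a b c d : R) (f g : C -> C).

Definition rect a b c d : set C :=
  [set z | (a <= Re z <= b) && (c <= Im z <= d)].

Definition frame a b c d : set C :=
  [set z | rect a b c d z /\ [|| Re z == a, Re z == b, Im z == c | Im z == d]].

(** The contour integral along the boundary of the rectangle, counterclockwise; dz is i dy on the
    vertical sides. *)
Definition rect_int f a b c d : C :=
  (cint a b (fun x => f (x +i* c)) - cint a b (fun x => f (x +i* d))) +
  'i * (cint c d (fun y => f (b +i* y)) - cint c d (fun y => f (a +i* y))).

Definition ccont_on (A : set C) f := forall z, A z -> ccont_at f z.

Lemma ccont_lin k f g z : ccont_at f z -> ccont_at g z ->
  ccont_at (fun w => k * f w + g w) z.
Proof.
move=> cf cg e e0.
have K0 : 0 < normc k + 1 by rewrite ltr_wpDl ?normc_ge0.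
have [r r0 Hr] := cf (e / 2 / (normc k + 1)) (divr_gt0 (divr_gt0 e0 (ltr0Sn _ 1)) K0).
have [q q0 Hq] := cg (e / 2) (divr_gt0 e0 (ltr0Sn _ 1)).
exists (Num.min r q); first by rewrite lt_min r0.
move=> w; rewrite lt_min => /andP[/Hr + /Hq hg].
rewrite ltr_pdivlMr// => hf.
have -> : k * f w + g w - (k * f z + g z) = k * (f w - f z) + (g w - g z) by ring.
apply: (le_lt_trans (normcD _ _)); rewrite normcM.
have := normc_ge0 (f w - f z); nra.
Qed.

Lemma ccont_cst k z : ccont_at (fun=> k : C) z.
Proof. by move=> e e0; exists 1 => // w _; rewrite subrr normc0. Qed.

Lemma ccont_id z : ccont_at (id : C -> C) z.
Proof. by move=> e e0; exists e. Qed.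

(** Continuity along the four sides only, so that integrands with a pole inside the rectangle
    qualify. *)
Definition scont f a b c d :=
  [/\ pcont a b (fun x => f (x +i* c)), pcont a b (fun x => f (x +i* d)),
      pcont c d (fun y => f (a +i* y)) & pcont c d (fun y => f (b +i* y))].

Lemma ccont_on_scont f a b c d : a <= b -> c <= d ->
  ccont_on (rect a b c d) f -> scont f a b c d.
Proof.
move=> ab cd cf; split; [apply: ccont_hline|apply: ccont_hline|apply: ccont_vline|apply: ccont_vline];
  by move=> t tI; apply: cf; rewrite /rect /= tI ?lexx ?ab ?cd.
Qed.

Lemma rect_int_splitx f a b c d m : scont f a b c d -> a <= m <= b ->
  rect_int f a b c d = rect_int f a m c d + rect_int f m b c d.
Proof.
move=> [hc hd _ _] /andP[am mb]; rewrite /rect_int.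
by rewrite (cint_split am mb hc) (cint_split am mb hd); ring.
Qed.

Lemma rect_int_splity f a b c d m : scont f a b c d -> c <= m <= d ->
  rect_int f a b c d = rect_int f a b c m + rect_int f a b m d.
Proof.
move=> [_ _ va vb] /andP[cm md]; rewrite /rect_int.
by rewrite (cint_split cm md va) (cint_split cm md vb); ring.
Qed.

Lemma rect_int_lin k f g a b c d : scont f a b c d -> scont g a b c d ->
  rect_int (fun z => k * f z + g z) a b c d = k * rect_int f a b c d + rect_int g a b c d.
Proof. by move=> [? ? ? ?] [? ? ? ?]; rewrite /rect_int !cint_lin//; ring. Qed.

Lemma normc_i : normc ('i : C) = 1.
Proof. by rewrite /= expr0n expr1n add0r sqrtr1. Qed.

Lemma rect_int_bound f a b c d M : a <= b -> c <= d -> scont f a b c d ->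
  (forall z, frame a b c d z -> normc (f z) <= M) ->
  normc (rect_int f a b c d) <= 2 * M * ((b - a) + (d - c)).
Proof.
move=> ab cd [hc hd va vb] fM; rewrite /rect_int.
have h y : (y == c) || (y == d) -> pcont a b (fun x => f (x +i* y)) ->
    normc (cint a b (fun x => f (x +i* y))) <= M * (b - a).
  move=> yE cy; apply: normc_cint_le => // x axb.
  apply: fM; split; last by rewrite /= yE !orbT.
  by rewrite /rect /= axb; case/orP: yE => /eqP ->; rewrite lexx cd.
have v x : (x == a) || (x == b) -> pcont c d (fun y => f (x +i* y)) ->
    normc (cint c d (fun y => f (x +i* y))) <= M * (d - c).
  move=> xE cx; apply: normc_cint_le => // y cyd.
  apply: fM; split; last by rewrite /= orbA xE.
  by rewrite /rect /= cyd andbT; case/orP: xE => /eqP ->; rewrite lexx ab.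
apply: (le_trans (normcD _ _)); rewrite normcM normc_i mul1r.
have := normcBD (cint a b (fun x => f (x +i* c))) (cint a b (fun x => f (x +i* d))).
have := normcBD (cint c d (fun x => f (b +i* x))) (cint c d (fun x => f (a +i* x))).
have := h c _ hc; rewrite eqxx => /(_ isT).
have := h d _ hd; rewrite eqxx orbT => /(_ isT).
have := v a _ va; rewrite eqxx => /(_ isT).
have := v b _ vb; rewrite eqxx orbT => /(_ isT).
clear; lra.
Qed.

Lemma eq_rect_int f g a b c d : a <= b -> c <= d ->
  (forall z, frame a b c d z -> f z = g z) -> rect_int f a b c d = rect_int g a b c d.
Proof.
move=> ab cd fg; rewrite /rect_int.
by congr (_ - _ + 'i * (_ - _)); apply: eq_cint => t tI; apply: fg;
  (split; first by rewrite /rect /= tI !lexx ?ab ?cd); rewrite /= !eqxx ?orbT.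
Qed.

(** Evaluated side by side; [goursat] uses it to subtract a first-order Taylor polynomial without
    changing the integral. *)
Lemma rect_int_affine p q a b c d : a <= b -> c <= d ->
  rect_int (fun z => q * z + p) a b c d = 0.
Proof.
move=> ab cd; rewrite /rect_int.
have H y : cint a b (fun x => q * (x +i* y) + p) =
    q * ((b ^+ 2 - a ^+ 2) / 2)%:C + (b - a)%:C * (q * (0 +i* y) + p).
  rewrite -cint_id// -cint_cst// -cint_lin.
  - apply: eq_cint => x _; have -> : x +i* y = x%:C + (0 +i* y); last by ring.
    by apply: complexP; rewrite !ReImE /= ?addr0 ?add0r.
  - by apply: pcont_real; exact: rcont_id.
  - exact: pcont_cst.
have V x : cint c d (fun y => q * (x +i* y) + p) =
    q * 'i * ((d ^+ 2 - c ^+ 2) / 2)%:C + (d - c)%:C * (q * x%:C + p).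
  rewrite -cint_id// -cint_cst// -cint_lin.
  - apply: eq_cint => y _; have -> : x +i* y = x%:C + 'i * y%:C; last by ring.
    by apply: complexP; rewrite !ReImE /= !(mul0r, mul1r, subr0, addr0, add0r, mulr0).
  - by apply: pcont_real; exact: rcont_id.
  - exact: pcont_cst.
rewrite !H !V; apply: complexP; rewrite !ReImE /=; ring.
Qed.

(** Two bisections, in x and then in y; each time one half carries at least half of the modulus,
    whence the factor 4. *)
Lemma rect_quarter f a b c d : a <= b -> c <= d -> ccont_on (rect a b c d) f ->
  exists Q : (R * R) * (R * R),
  [/\ a <= Q.1.1 <= Q.1.2, Q.1.2 <= b, c <= Q.2.1 <= Q.2.2, Q.2.2 <= d &
   [/\ Q.1.2 - Q.1.1 = (b - a) / 2, Q.2.2 - Q.2.1 = (d - c) / 2 &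
    normc (rect_int f a b c d) <= 4 * normc (rect_int f Q.1.1 Q.1.2 Q.2.1 Q.2.2)]].
Proof.
move=> ab cd cf; have sf := ccont_on_scont ab cd cf.
have [x [y [axy yb Hxy Ex]]] : exists x y, [/\ a <= x <= y, y <= b, y - x = (b - a) / 2 &
    normc (rect_int f a b c d) <= 2 * normc (rect_int f x y c d)].
  pose m := (a + b) / 2.
  have /(rect_int_splitx sf) E : a <= m <= b by rewrite /m; lra.
  have := normcD (rect_int f a m c d) (rect_int f m b c d); rewrite -E.
  have [h _|h h2] := leP (normc (rect_int f a b c d)) (2 * normc (rect_int f a m c d)).
    by exists a, m; split => //; rewrite /m; lra.
  by exists m, b; clear -ab h h2; move: h h2; rewrite /m => h h2; split; lra.
have cf' : ccont_on (rect x y c d) f.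
  by move=> z /andP[zx zy]; apply: cf; apply/andP; split => //; lra.
have xy : x <= y by case/andP: axy.
have sf' := ccont_on_scont xy cd cf'.
have [s [t [cst td Hst Ey]]] : exists s t, [/\ c <= s <= t, t <= d, t - s = (d - c) / 2 &
    normc (rect_int f x y c d) <= 2 * normc (rect_int f x y s t)].
  pose m := (c + d) / 2.
  have /(rect_int_splity sf') E : c <= m <= d by rewrite /m; lra.
  have := normcD (rect_int f x y c m) (rect_int f x y m d); rewrite -E.
  have [h _|h h2] := leP (normc (rect_int f x y c d)) (2 * normc (rect_int f x y c m)).
    by exists c, m; split => //; rewrite /m; lra.
  by exists m, d; clear -h h2 cd; move: h h2; rewrite /m => h h2; split; lra.
exists ((x, y), (s, t)); split=> //; split=> //.
rewrite (le_trans Ex)// (_ : (4 : R) = 2 * 2); last by ring.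
by rewrite -mulrA ler_wpM2l.
Qed.

Lemma nested_point (u v : nat -> R) : (forall n, u n <= u n.+1) ->
  (forall n, v n.+1 <= v n) -> (forall n, u n <= v n) -> exists x, forall n, u n <= x <= v n.
Proof.
move=> /nondecreasing_seqP ndu /nonincreasing_seqP niv uv.
have uvm m n : u m <= v n.
  have [mn|/ltW nm] := leP m n; first exact: le_trans (ndu _ _ mn) (uv n).
  exact: le_trans (uv m) (niv _ _ nm).
exists (sup (range u)) => n; apply/andP; split.
  by apply: ub_le_sup; [exists (v 0%N) => _ [m _ <-]|exists n].
by apply: ge_sup; [exists (u 0%N); exists 0%N|move=> _ [m _ <-]].
Qed.

(** Integrals over successive quarters shrink at most by 4 each time. At the common point of the
    quarters, differentiability bounds them by an arbitrarily small multiple of the squared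
    half-perimeter, which itself is of order 4^-n. *)
Lemma goursat f a b c d : a <= b -> c <= d ->
  (forall z, rect a b c d z -> exists l, cdiff_at f z l) ->
  rect_int f a b c d = 0.
Proof.
move=> ab cd df.
have cf : ccont_on (rect a b c d) f by move=> z /df[l /cdiff_cont].
pose good (Q : (R * R) * (R * R)) := [/\ a <= Q.1.1 <= Q.1.2, Q.1.2 <= b,
  c <= Q.2.1 <= Q.2.2 & Q.2.2 <= d].
pose E (Q : (R * R) * (R * R)) := rect_int f Q.1.1 Q.1.2 Q.2.1 Q.2.2.
(* The implication makes [nxt] total, so that it can be iterated; it is meaningful on [good]
   rectangles only. *)
have /choice[nxt Hnxt] : forall Q, exists Q', good Q -> good Q' /\
    [/\ Q.1.1 <= Q'.1.1 /\ Q'.1.2 <= Q.1.2, Q.2.1 <= Q'.2.1 /\ Q'.2.2 <= Q.2.2,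
       Q'.1.2 - Q'.1.1 = (Q.1.2 - Q.1.1) / 2, Q'.2.2 - Q'.2.1 = (Q.2.2 - Q.2.1) / 2 &
       normc (E Q) <= 4 * normc (E Q')].
  move=> Q; have [gQ|] := pselect (good Q); last by exists Q.
  case: (gQ) => /andP[h1 h2] h3 /andP[h4 h5] h6.
  have [|Q' [/andP[q1 q2] q3 /andP[q4 q5] q6 [q7 q8 q9]]] := @rect_quarter f _ _ _ _ h2 h5.
    by move=> z /andP[zx zy]; apply: cf; apply/andP; split; lra.
  by exists Q' => _; do !split => //; lra.
pose Q n := iter n nxt ((a, b), (c, d)).
have gQ n : good (Q n).
  elim: n => [|n ih]; first by rewrite /Q /good /= !lexx ab cd.
  by case: (Hnxt _ ih).
have dQ n : [/\ (Q n).1.2 - (Q n).1.1 = (b - a) / 2 ^+ n,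
    (Q n).2.2 - (Q n).2.1 = (d - c) / 2 ^+ n & normc (E (Q 0%N)) <= 4 ^+ n * normc (E (Q n))].
  elim: n => [|n [h1 h2 h3]]; first by rewrite !expr0 !divr1 mul1r.
  case: (Hnxt _ (gQ n)) => _ [_ _]; rewrite h1 h2 -/(Q n.+1) => -> -> h4.
  rewrite !exprS !invfM; split; [by rewrite mulrAC mulrA|by rewrite mulrAC mulrA|].
  by rewrite (le_trans h3)// -mulrA mulrCA ler_wpM2l ?exprn_ge0.
have [x Hx] : exists x, forall n, (Q n).1.1 <= x <= (Q n).1.2.
  by apply: nested_point => n;
    [case: (Hnxt _ (gQ n)) => _ [[]]|case: (Hnxt _ (gQ n)) => _ [[]]|case: (gQ n) => /andP[]].
have [y Hy] : exists y, forall n, (Q n).2.1 <= y <= (Q n).2.2.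
  by apply: nested_point => n;
    [case: (Hnxt _ (gQ n)) => _ [_ []]|case: (Hnxt _ (gQ n)) => _ [_ []]|case: (gQ n) => _ _ /andP[]].
have [l Hl] : exists l, cdiff_at f (x +i* y) l.
  by apply: df; rewrite /rect /=; have := Hx 0%N; have := Hy 0%N; rewrite /Q /= => -> ->.
apply: eq0_normc; apply/eqP; rewrite eq_le normc_ge0 andbT leNgt; apply/negP => eta0.
rewrite -/(E (Q 0%N)) in eta0 *.
pose D := (b - a) + (d - c).
have D0 : 0 <= D by rewrite /D; lra.
(* The summand 1 makes the final estimate strictly smaller than the modulus it bounds, also when D =
   0. *)
have K0 : 0 < 2 * D ^+ 2 + 1 by rewrite ltr_wpDl// mulr_ge0// sqr_ge0.
have [r r0 Hr] := Hl (normc (E (Q 0%N)) / (2 * D ^+ 2 + 1)) (divr_gt0 eta0 K0).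
set eta := normc (E (Q 0%N)) in eta0 Hr *.
have [n Hn] : exists n, D / 2 ^+ n < r.
  exists (Num.truncn (D / r)).+1; rewrite ltr_pdivrMr ?exprn_gt0//.
  rewrite mulrC -ltr_pdivrMr//; apply: lt_trans (truncnS_gt _) _.
  by rewrite -natrX ltr_nat ltn_expl.
have [h1 h2 h3] := dQ n.
case: (gQ n) => /andP[g1 g2] g3 /andP[g4 g5] g6.
have QD : ((Q n).1.2 - (Q n).1.1) + ((Q n).2.2 - (Q n).2.1) = D / 2 ^+ n.
  by rewrite h1 h2 -mulrDl.
(* Minus the first-order Taylor polynomial of f at the common point. *)
pose A z := - l * z + (l * (x +i* y) - f (x +i* y)).
have cA z : ccont_at A z by apply: ccont_lin; [exact: ccont_id|exact: ccont_cst].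
have cfn : ccont_on (rect (Q n).1.1 (Q n).1.2 (Q n).2.1 (Q n).2.2) f.
  by move=> z /andP[zx zy]; apply: cf; apply/andP; split; lra.
have cAn : ccont_on (rect (Q n).1.1 (Q n).1.2 (Q n).2.1 (Q n).2.2) A by move=> z _.
have EA : E (Q n) = rect_int (fun z => 1 * f z + A z) (Q n).1.1 (Q n).1.2 (Q n).2.1 (Q n).2.2.
  by rewrite rect_int_lin ?rect_int_affine ?mul1r ?addr0//; exact: ccont_on_scont.
have /(rect_int_bound g2 g5) : scont (fun z => 1 * f z + A z) (Q n).1.1 (Q n).1.2 (Q n).2.1 (Q n).2.2.
  by apply: ccont_on_scont => // z zQ; apply: ccont_lin => //; exact: cfn.
move=> /(_ (eta / (2 * D ^+ 2 + 1) * (D / 2 ^+ n))); rewrite -EA QD.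
have -> : 2 * (eta / (2 * D ^+ 2 + 1) * (D / 2 ^+ n)) * (D / 2 ^+ n) =
    eta * (2 * D ^+ 2) / (2 * D ^+ 2 + 1) / 4 ^+ n.
  have -> : (4 : R) ^+ n = 2 ^+ n * 2 ^+ n by rewrite -exprMn; congr (_ ^+ _); ring.
  by field; rewrite expf_neq0 ?pnatr_eq0//= gt_eqF.
move=> H; have : normc (E (Q n)) <= eta * (2 * D ^+ 2) / (2 * D ^+ 2 + 1) / 4 ^+ n.
  apply: H => z [/andP[zx zy] _].
  have -> : 1 * f z + A z = f z - f (x +i* y) - l * (z - (x +i* y)) by rewrite /A; ring.
  have zz : normc (z - (x +i* y)) <= D / 2 ^+ n.
    rewrite (le_trans (normc_le_ReIm _))// ReB ImB /= -QD lerD// ler_norml.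
      by have := Hx n; lra.
    by have := Hy n; lra.
  apply: (le_trans (Hr _ (le_lt_trans zz Hn))).
  by rewrite ler_wpM2l// divr_ge0// ltW.
rewrite ler_pdivlMr ?exprn_gt0// mulrC => h4.
have := le_trans h3 h4; rewrite ler_pdivlMr// -/eta; nra.
Qed.

End Goursat.

(** * Cauchy's integral formula on rectangles *)

Section Cauchy.
Variable R : realType.
Local Notation C := R[i].
Local Notation Re := (@complex.Re R).
Local Notation Im := (@complex.Im R).
Implicit Types (a b c d : R) (f g : C -> C).

Definition cdiff f (z : C) := exists l, cdiff_at f z l.

Lemma cdiffE f z : derivable (f : R[i]^o -> R[i]^o) z 1 <-> cdiff f z.
Proof. exact: derivable_cdiff. Qed.

Lemma cdiff_cst k z : cdiff (fun=> k) z.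
Proof. by apply/cdiffE; exact: derivable_cst. Qed.

Lemma cdiff_id z : cdiff id z.
Proof. by apply/cdiffE; exact: derivable_id. Qed.

Lemma cdiffD f g z : cdiff f z -> cdiff g z -> cdiff (fun w => f w + g w) z.
Proof. by move=> /cdiffE df /cdiffE dg; apply/cdiffE; exact: (derivableD df dg). Qed.

Lemma cdiffB f g z : cdiff f z -> cdiff g z -> cdiff (fun w => f w - g w) z.
Proof. by move=> /cdiffE df /cdiffE dg; apply/cdiffE; exact: (derivableB df dg). Qed.

Lemma cdiffM f g z : cdiff f z -> cdiff g z -> cdiff (fun w => f w * g w) z.
Proof. by move=> /cdiffE df /cdiffE dg; apply/cdiffE; exact: (derivableM df dg). Qed.

Lemma cdiffX f n z : cdiff f z -> cdiff (fun w => f w ^+ n) z.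
Proof.
move=> df; elim: n => [|n ih]; first exact: (cdiff_cst 1).
by under eq_fun do rewrite exprS; exact: cdiffM.
Qed.

Lemma cdiffV f z : f z != 0 -> cdiff f z -> cdiff (fun w => (f w)^-1) z.
Proof. by move=> fz /cdiffE df; apply/cdiffE; exact: (derivableV fz df). Qed.

Lemma cdiff_ccont f z : cdiff f z -> ccont_at f z.
Proof. by move=> [l /cdiff_cont]. Qed.

Lemma cdiff_near f g z r : 0 < r -> (forall w, normc (w - z) < r -> f w = g w) ->
  cdiff f z -> cdiff g z.
Proof.
move=> r0 fg [l H]; exists l => e /H[q q0 {}H]; exists (Num.min r q).
  by rewrite lt_min r0.
move=> w; rewrite lt_min => /andP[wr /H]; rewrite fg// fg//.
by rewrite subrr normc0.
Qed.

Lemma cdiff_div f z0 z : z != z0 -> cdiff f z -> cdiff (fun w => f w / (w - z0)) z.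
Proof.
move=> zz df; apply: cdiffM => //; apply: cdiffV; first by rewrite subr_eq0.
by apply: cdiffB; [exact: cdiff_id|exact: cdiff_cst].
Qed.

(** An antiderivative is 2 atan ((x - x0) / r), whose argument runs from -1 to 1. *)
Lemma rint_kernel (x0 r : R) : 0 < r ->
  rint (x0 - r) (x0 + r) (fun x => 2 * r / (r ^+ 2 + (x - x0) ^+ 2)) = pi.
Proof.
move=> r0; have rN0 : r != 0 by rewrite gt_eqF.
have den x : 0 < r ^+ 2 + (x - x0) ^+ 2 by rewrite ltr_pwDl ?exprn_gt0 ?sqr_ge0.
have ck : rcont (x0 - r) (x0 + r) (fun x => 2 * r / (r ^+ 2 + (x - x0) ^+ 2)).
  apply: rcontM; first exact: rcont_cst.
  apply: rcontV; first by move=> t _; rewrite gt_eqF.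
  apply: rcontD; first exact: rcont_cst.
  by apply: rcontM; apply: rcontD; (exact: rcont_id || exact: rcont_cst).
pose F x : R := 2 * atan ((x - x0) / r).
have dF x : is_derive x (1 : R) F (2 * r / (r ^+ 2 + (x - x0) ^+ 2)).
  have dg : is_derive x (1 : R) (fun y : R => (y - x0) / r) r^-1.
    have -> : (fun y : R => (y - x0) / r) = r^-1 \*: (id - cst x0).
      by apply/funext => y /=; rewrite mulrC.
    by apply: is_derive_eq; rewrite subr0 /GRing.scale /= mulr1.
  have dh := @is_derive1_comp _ atan (fun y : R => (y - x0) / r) x _ _ (is_derive1_atan _) dg.
  have -> : F = 2 \*: (atan \o (fun y : R => (y - x0) / r)) by [].
  apply: is_derive_eq; rewrite /GRing.scale /=; field.
  by rewrite rN0 gt_eqF//= gt_eqF// addrC.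
have cF x : {for x, continuous F}.
  by apply/differentiable_continuous/derivable1_diffP.
rewrite /rint /Rintegral (@continuous_FTC2 _ _ F)//.
- rewrite /= /F.
  have -> : (x0 + r - x0) / r = 1 by field.
  have -> : (x0 - r - x0) / r = - 1 by field.
  by rewrite atanN atan1; field.
- lra.
- by apply: continuous_in_subspaceT => t /set_mem /=; rewrite in_itv => /ck.
- split=> [x _| | ]; first by [].
  + by apply: cvg_at_right_filter; exact: cF.
  + by apply: cvg_at_left_filter; exact: cF.
- by move=> x _; rewrite derive1E derive_val.
Qed.

Lemma cint_real a b (f : R -> R) : cint a b (fun t => (f t)%:C) = (rint a b f)%:C.
Proof. by apply: complexP => //=; rewrite /rint /Rintegral integral0. Qed.

Lemma cintB a b (u v : R -> C) : pcont a b u -> pcont a b v ->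
  cint a b (fun t => u t - v t) = cint a b u - cint a b v.
Proof.
move=> cu cv; rewrite addrC -mulN1r -cint_lin//.
by apply: eq_cint => t _; rewrite mulN1r addrC.
Qed.

(** On a square centred at z0, the integrands of opposite sides combine into the kernel of
    [rint_kernel], and each of the two pairs contributes i pi. *)
Lemma rect_int_inv z0 (r : R) : 0 < r ->
  rect_int (fun z => (z - z0)^-1) (Re z0 - r) (Re z0 + r) (Im z0 - r) (Im z0 + r) =
  'i * (2 * pi)%:C.
Proof.
move=> r0; have rN0 : r != 0 by rewrite gt_eqF.
have df z : z != z0 -> cdiff (fun z => (z - z0)^-1) z.
  move=> zz; apply: cdiffV; first by rewrite subr_eq0.
  by apply: cdiffB; [exact: cdiff_id|exact: cdiff_cst].
have zRe x y : x != Re z0 -> x +i* y != z0 by apply: contra => /eqP <-.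
have zIm x y : y != Im z0 -> x +i* y != z0 by apply: contra => /eqP <-.
have h y a b : y != Im z0 -> pcont a b (fun x => (x +i* y - z0)^-1).
  move=> yz; apply: (@ccont_hline _ (fun z => (z - z0)^-1)) => x _.
  by apply/cdiff_ccont/df/zIm.
have v x a b : x != Re z0 -> pcont a b (fun y => (x +i* y - z0)^-1).
  move=> xz; apply: (@ccont_vline _ (fun z => (z - z0)^-1)) => y _.
  by apply/cdiff_ccont/df/zRe.
have rm x : x - r != x by rewrite -subr_eq0 addrAC subrr add0r oppr_eq0.
have rp x : x + r != x by rewrite -subr_eq0 addrAC subrr add0r.
have den x : r ^+ 2 + x ^+ 2 != 0 by rewrite gt_eqF// ltr_pwDl ?exprn_gt0 ?sqr_ge0.
have den' x : x ^+ 2 + r ^+ 2 != 0 by rewrite addrC.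
rewrite /rect_int -!cintB; do ?[exact: h|exact: v].
have -> : cint (Re z0 - r) (Re z0 + r)
    (fun t => (t +i* (Im z0 - r) - z0)^-1 - (t +i* (Im z0 + r) - z0)^-1) = 'i * pi%:C.
  rewrite -(rint_kernel (Re z0) r0) -cint_real -cintZ; last first.
    apply: pcont_real; apply: rcontM; first exact: rcont_cst.
    apply: rcontV; first by move=> t _; exact: den.
    apply: rcontD; first exact: rcont_cst.
    by apply: rcontM; apply: rcontD; (exact: rcont_id || exact: rcont_cst).
  apply: eq_cint => x _; rewrite /=.
  have e1 : Im z0 - r - Im z0 = - r by ring.
  have e2 : Im z0 + r - Im z0 = r by ring.
  by apply: complexP; rewrite !ReImE /= e1 e2 sqrrN; field.
have -> : cint (Im z0 - r) (Im z0 + r)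
    (fun t => ((Re z0 + r) +i* t - z0)^-1 - ((Re z0 - r) +i* t - z0)^-1) = pi%:C.
  rewrite -(rint_kernel (Im z0) r0) -cint_real.
  apply: eq_cint => x _; rewrite /=.
  have e1 : Re z0 - r - Re z0 = - r by ring.
  have e2 : Re z0 + r - Re z0 = r by ring.
  by apply: complexP; rewrite !ReImE /= e1 e2 sqrrN; field.
by apply: complexP; rewrite !ReImE /=; ring.
Qed.

(** The large rectangle is the small one plus four strips that avoid z0, on which [goursat]
    applies. *)
Lemma rect_int_shrink f z0 a b c d x1 x2 y1 y2 :
  a <= x1 -> x1 < Re z0 -> Re z0 < x2 -> x2 <= b ->
  c <= y1 -> y1 < Im z0 -> Im z0 < y2 -> y2 <= d ->
  (forall z, rect a b c d z -> z != z0 -> cdiff f z) ->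
  rect_int f a b c d = rect_int f x1 x2 y1 y2.
Proof.
move=> ax1 x1z zx2 x2b cy1 y1z zy2 y2d df.
have zRe x y : x != Re z0 -> x +i* y != z0 by apply: contra => /eqP <-.
have zIm x y : y != Im z0 -> x +i* y != z0 by apply: contra => /eqP <-.
have h y a' b' : a <= a' -> b' <= b -> c <= y <= d -> y != Im z0 ->
    pcont a' b' (fun x => f (x +i* y)).
  move=> aa bb cyd yz; apply: ccont_hline => x /andP[ax xb]; apply/cdiff_ccont/df/zIm => //.
  by rewrite /rect /= cyd (le_trans aa)// (le_trans xb).
have v x c' d' : c <= c' -> d' <= d -> a <= x <= b -> x != Re z0 ->
    pcont c' d' (fun y => f (x +i* y)).
  move=> cc dd axb xz; apply: ccont_vline => y /andP[cy yd]; apply/cdiff_ccont/df/zRe => //.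
  by rewrite /rect /= axb (le_trans cc)// (le_trans yd).
have S a' b' c' d' : a <= a' <= b' -> b' <= b -> c <= c' <= d' -> d' <= d ->
    a' != Re z0 -> b' != Re z0 -> c' != Im z0 -> d' != Im z0 -> scont f a' b' c' d'.
  move=> /andP[q1 q2] q3 /andP[q4 q5] q6 na nb nc nd.
  by split; [apply: h|apply: h|apply: v|apply: v] => //; apply/andP; split => //; lra.
have G a' b' c' d' : a <= a' <= b' -> b' <= b -> c <= c' <= d' -> d' <= d ->
    [|| b' < Re z0, Re z0 < a', d' < Im z0 | Im z0 < c'] -> rect_int f a' b' c' d' = 0.
  move=> /andP[q1 q2] q3 /andP[q4 q5] q6 out; apply: goursat => //.
  move=> z /andP[/andP[z1 z2] /andP[z3 z4]]; apply: df.
    by apply/andP; split; apply/andP; split; lra.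
  by apply: contraTneq out => zz; rewrite -zz !ltNge z1 z2 z3 z4.
have N (u w : R) : (u < w) || (w < u) -> u != w by rewrite neq_lt.
have -> : rect_int f a b c d = rect_int f a x1 c d + rect_int f x1 b c d.
  by apply: rect_int_splitx; [apply: S; try apply: N; lra|lra].
have -> : rect_int f x1 b c d = rect_int f x1 x2 c d + rect_int f x2 b c d.
  by apply: rect_int_splitx; [apply: S; try apply: N; lra|lra].
have -> : rect_int f x1 x2 c d = rect_int f x1 x2 c y1 + rect_int f x1 x2 y1 d.
  by apply: rect_int_splity; [apply: S; try apply: N; lra|lra].
have -> : rect_int f x1 x2 y1 d = rect_int f x1 x2 y1 y2 + rect_int f x1 x2 y2 d.
  by apply: rect_int_splity; [apply: S; try apply: N; lra|lra].
have -> : rect_int f a x1 c d = 0 by apply: G; rewrite ?x1z //; lra.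
have -> : rect_int f x2 b c d = 0 by apply: G; rewrite ?zx2 ?orbT //; lra.
have -> : rect_int f x1 x2 c y1 = 0 by apply: G; rewrite ?y1z ?orbT //; lra.
have -> : rect_int f x1 x2 y2 d = 0 by apply: G; rewrite ?zy2 ?orbT //; lra.
by rewrite add0r addr0 add0r addr0.
Qed.

(** After shrinking to a square of half-side s around z0, subtracting H z0 / (z - z0) leaves a
    difference quotient bounded by |l| + 1. The error is thus at most a constant times s, for every
    small s. *)
Lemma cauchy_rect H z0 a b c d : a < Re z0 < b -> c < Im z0 < d ->
  (forall z, rect a b c d z -> cdiff H z) ->
  rect_int (fun z => H z / (z - z0)) a b c d = 'i * (2 * pi)%:C * H z0.
Proof.
move=> /andP[az zb] /andP[cz zd] dH.
have [l Hl] : cdiff H z0 by apply: dH; rewrite /rect /=; apply/andP; split; lra.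
have [r r0 Hr] := Hl 1 ltr01.
set J := rect_int _ _ _ _ _.
have main s : 0 < s -> s < r / 2 -> s <= Re z0 - a -> s <= b - Re z0 ->
    s <= Im z0 - c -> s <= d - Im z0 ->
    normc (J - 'i * (2 * pi)%:C * H z0) <= 8 * (normc l + 1) * s.
  move=> s0 sr sa sb sc sd.
  have -> : J = rect_int (fun z => H z / (z - z0)) (Re z0 - s) (Re z0 + s) (Im z0 - s) (Im z0 + s).
    apply: (@rect_int_shrink _ z0); try lra.
    by move=> z zr zz; apply: cdiff_div => //; exact: dH.
  have sub z : rect (Re z0 - s) (Re z0 + s) (Im z0 - s) (Im z0 + s) z -> rect a b c d z.
    by move=> /andP[/andP[z1 z2] /andP[z3 z4]]; apply/andP; split; apply/andP; split; lra.
  have side (f : C -> C) : (forall z, rect a b c d z -> z != z0 -> cdiff f z) ->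
     scont f (Re z0 - s) (Re z0 + s) (Im z0 - s) (Im z0 + s).
    move=> df; split; [apply: ccont_hline|apply: ccont_hline|apply: ccont_vline|apply: ccont_vline] => t tI;
      apply/cdiff_ccont/df; rewrite ?eq_complex /= ?negb_and; try (apply: sub; rewrite /rect /= tI ; lra).
    - by apply/orP; right; rewrite lt_eqF//; lra.
    - by apply/orP; right; rewrite gt_eqF//; lra.
    - by apply/orP; left; rewrite lt_eqF//; lra.
    - by apply/orP; left; rewrite gt_eqF//; lra.
  rewrite -(rect_int_inv z0 s0).
  have addmul (u v w : C) : u - v * w = - w * v + u by ring.
  rewrite addmul.
  rewrite -rect_int_lin; last 2 first.
  - apply: side => z _ zz; apply: cdiffV; first by rewrite subr_eq0.
    by apply: cdiffB; [exact: cdiff_id|exact: cdiff_cst].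
  - by apply: side => z zr zz; apply: cdiff_div => //; exact: dH.
  have -> : 8 * (normc l + 1) * s = 2 * (normc l + 1) *
      ((Re z0 + s - (Re z0 - s)) + (Im z0 + s - (Im z0 - s))) by ring.
  apply: rect_int_bound; [lra|lra| |].
    apply: side => z zr zz; apply: cdiffD; last by apply: cdiff_div => //; exact: dH.
    apply: cdiffM; first exact: cdiff_cst.
    apply: cdiffV; first by rewrite subr_eq0.
    by apply: cdiffB; [exact: cdiff_id|exact: cdiff_cst].
  move=> z [/andP[/andP[z1 z2] /andP[z3 z4]] _].
  have -> : - H z0 * (z - z0)^-1 + H z / (z - z0) =
    (H z - H z0 - l * (z - z0)) / (z - z0) + l * ((z - z0) / (z - z0)) by ring.
  have zr : normc (z - z0) < r.
    apply: (le_lt_trans (normc_le_ReIm _)); rewrite ReB ImB.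
    have : `|Re z - Re z0| <= s by rewrite ler_norml; lra.
    have : `|Im z - Im z0| <= s by rewrite ler_norml; lra.
    lra.
  have := Hr z zr; rewrite mul1r => h.
  (* The frame avoids z0, but the case z = z0 is settled faster by the default value 0^-1 = 0. *)
  have [->|zz] := eqVneq z z0.
    by rewrite !subrr invr0 !mulr0 addr0 normc0 addr_ge0 ?normc_ge0.
  have zz' : z - z0 != 0 by rewrite subr_eq0.
  apply: (le_trans (normcD _ _)); rewrite divff// mulr1 addrC lerD2l.
  by rewrite normcM normcV ler_pdivrMr ?normc_gt0// mul1r.
apply/eqP; rewrite -subr_eq0; apply/eqP; apply: eq0_normc; apply/eqP.
rewrite eq_le normc_ge0 andbT leNgt; apply/negP => N0.
set N := normc _ in N0 main.
have l0 := normc_ge0 l.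
pose K := 8 * (normc l + 1).
have K0 : 0 < K by rewrite /K; lra.
(* r / 4 keeps the square inside the disc of differentiability, N / (2 K) gives N <= N / 2, and the
   rest keeps it inside the rectangle. *)
pose s := Num.min (Num.min (r / 4) (N / (2 * K)))
   (Num.min (Num.min (Re z0 - a) (b - Re z0)) (Num.min (Im z0 - c) (d - Im z0))).
have s0 : 0 < s.
  rewrite /s !lt_min !subr_gt0 az zb cz zd !divr_gt0//.
  by rewrite mulr_gt0.
have [s1 s2 [s3 s4 [s5 s6]]] : [/\ s <= r / 4, s <= N / (2 * K) &
  [/\ s <= Re z0 - a, s <= b - Re z0 & s <= Im z0 - c /\ s <= d - Im z0]].
  by split; [| |split; [| |split]]; rewrite /s !ge_min lexx ?orbT.
have : N <= K * s by apply: main => //; lra.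
move: s2; rewrite ler_pdivlMr ?mulr_gt0//; nra.
Qed.

End Cauchy.

(** * Taylor remainder, and Cauchy's formula on a vertical line *)

Section CauchyConsequences.
Variable R : realType.
Local Notation C := R[i].
Local Notation Re := (@complex.Re R).
Local Notation Im := (@complex.Im R).
Implicit Types (a b c d : R) (f g : C -> C).

Lemma frame_scont f a b c d : a <= b -> c <= d ->
  (forall z, frame a b c d z -> ccont_at f z) -> scont f a b c d.
Proof.
move=> ab cd cf; split; [apply: ccont_hline|apply: ccont_hline|apply: ccont_vline|apply: ccont_vline];
  move=> t tI; apply: cf; (split; first by rewrite /rect /= tI !lexx ?ab ?cd);
  by rewrite /= !eqxx ?orbT.
Qed.

Lemma frame_neq a b c d z w : a < Re w < b -> c < Im w < d -> frame a b c d z -> z != w.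
Proof.
move=> /andP[aw wb] /andP[cw wd] [_ /or4P[] /eqP h]; apply/eqP => zw; move: h; rewrite zw => h;
  [move: aw|move: wb|move: cw|move: wd]; by rewrite h ltxx.
Qed.

Lemma normc_2pi : normc ('i * (2 * pi)%:C : C) = 2 * pi.
Proof. by rewrite normcM normc_i mul1r normc_real ger0_norm// mulr_ge0// pi_ge0. Qed.

Lemma two_pi_ge1 : 1 <= 2 * pi :> R.
Proof. have := pi_ge2 R; lra. Qed.

(** By Cauchy's formula the remainder is (z - w)^2 times the contour integral of F / ((v - w)^2 (v -
    z)), divided by 2 pi i. On the frame |v - w| >= rho and |v - z| >= rho / 2, and the perimeter is
    8 rho; bounding 1 / (2 pi) by 1 leaves 16. The dependence on F through B alone is what allows
    summing over a series in [hol_neumann]. *)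
Lemma taylor2 F (w : C) (rho B : R) : 0 < rho ->
  (forall z, rect (Re w - rho) (Re w + rho) (Im w - rho) (Im w + rho) z -> cdiff F z) ->
  (forall z, rect (Re w - rho) (Re w + rho) (Im w - rho) (Im w + rho) z -> normc (F z) <= B) ->
  exists l, forall z, normc (z - w) <= rho / 2 ->
    normc (F z - F w - l * (z - w)) <= 16 * B / rho ^+ 2 * normc (z - w) ^+ 2.
Proof.
move=> r0 dF FB; set a := Re w - rho; set b := Re w + rho; set c := Im w - rho; set d := Im w + rho.
have [ab cd] : a <= b /\ c <= d by rewrite /a /b /c /d; lra.
have wR : a < Re w < b by rewrite /a /b; lra.
have wI : c < Im w < d by rewrite /c /d; lra.
have B0 : 0 <= B.
  apply: le_trans (normc_ge0 (F w)) (FB w _).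
  by rewrite /rect /= !gerBl !lerDl ltW.
have PN : 'i * (2 * pi)%:C != 0 :> C.
  by rewrite -normc_gt0 normc_2pi; have := two_pi_ge1; lra.
pose f2 v := F v / (v - w) / (v - w).
exists (rect_int f2 a b c d / ('i * (2 * pi)%:C)) => z zw.
have zRI : `|Re z - Re w| <= rho / 2 /\ `|Im z - Im w| <= rho / 2.
  by rewrite -ReB -ImB; split; apply: le_trans zw; rewrite ?normc_Re ?normc_Im.
have zR : a < Re z < b by have [+ _] := zRI; rewrite ler_norml /a /b; lra.
have zI : c < Im z < d by have [_] := zRI; rewrite ler_norml /c /d; lra.
pose G v := (z - w) ^+ 2 * (f2 v / (v - z)).
have cF v : frame a b c d v -> cdiff F v by case=> vr _; exact: dF.
have E : rect_int G a b c d = 'i * (2 * pi)%:C * (F z - F w) - (z - w) * rect_int f2 a b c d.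
  (* Partial fractions: (z - w)^2 / ((v - w)^2 (v - z)) = 1 / (v - z) - 1 / (v - w) - (z - w) / (v -
     w)^2. *)
  have -> : rect_int G a b c d = rect_int (fun v => - (z - w) * f2 v + (-1 * (F v / (v - w)) + F v / (v - z))) a b c d.
    apply: eq_rect_int => // v vf; rewrite /G /f2.
    have vw : v - w != 0 by rewrite subr_eq0 (frame_neq wR wI vf).
    have vz : v - z != 0 by rewrite subr_eq0 (frame_neq zR zI vf).
    by field; rewrite vw vz.
  have S1 : scont (fun v => F v / (v - w)) a b c d.
    apply: frame_scont => // v vf; apply: cdiff_ccont.
    by apply: cdiff_div; [exact: frame_neq vf|exact: cF].
  have S2 : scont (fun v => F v / (v - z)) a b c d.
    apply: frame_scont => // v vf; apply: cdiff_ccont.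
    by apply: cdiff_div; [exact: frame_neq vf|exact: cF].
  rewrite rect_int_lin; last 2 first.
  - apply: frame_scont => // v vf; apply: cdiff_ccont.
    by do 2 (apply: cdiff_div; first exact: frame_neq vf); exact: cF.
  - apply: frame_scont => // v vf; apply: cdiff_ccont.
    apply: cdiffD; last by apply: cdiff_div; [exact: frame_neq vf|exact: cF].
    apply: cdiffM; first exact: cdiff_cst.
    by apply: cdiff_div; [exact: frame_neq vf|exact: cF].
  rewrite rect_int_lin// (cauchy_rect wR wI dF) (cauchy_rect zR zI dF); ring.
have -> : F z - F w - rect_int f2 a b c d / ('i * (2 * pi)%:C) * (z - w) =
    rect_int G a b c d / ('i * (2 * pi)%:C).
  rewrite E; move: PN; generalize ('i * (2 * pi)%:C : C) (rect_int f2 a b c d) => P Q PN.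
  by field.
rewrite normcM normcV normc_2pi.
have : normc (rect_int G a b c d) <= 2 * (normc (z - w) ^+ 2 * (2 * B / rho ^+ 3)) * ((b - a) + (d - c)).
  apply: rect_int_bound => //.
    apply: frame_scont => // v vf; apply: cdiff_ccont.
    apply: cdiffM; first exact: cdiff_cst.
    by do 3 (apply: cdiff_div; first exact: frame_neq vf); exact: cF.
  move=> v vf; rewrite /G normcM normcX ler_wpM2l ?sqr_ge0// /f2.
  have vw : rho <= normc (v - w).
    have n1 : Re w - rho - Re w = - rho by ring.
    have n2 : Re w + rho - Re w = rho by ring.
    have n3 : Im w - rho - Im w = - rho by ring.
    have n4 : Im w + rho - Im w = rho by ring.
    have := normc_Re (v - w); have := normc_Im (v - w); rewrite ReB ImB.
    by case: vf => _ /or4P[] /eqP ->; rewrite ?(n1, n2, n3, n4) ?normrN (gtr0_norm r0).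
  have vz : rho / 2 <= normc (v - z).
    have : normc (v - w) <= normc (v - z) + normc (z - w).
      rewrite (_ : v - w = (v - z) + (z - w)); [exact: normcD|by ring].
    lra.
  have -> : 2 * B / rho ^+ 3 = B * rho^-1 * rho^-1 * (rho / 2)^-1 by field; rewrite gt_eqF.
  have iw : (normc (v - w))^-1 <= rho^-1 by rewrite lef_pV2 ?posrE// (lt_le_trans r0).
  have iz : (normc (v - z))^-1 <= (rho / 2)^-1.
    by rewrite lef_pV2 ?posrE ?divr_gt0// (lt_le_trans _ vz)// divr_gt0.
  rewrite !normcM !normcV.
  by do 3 (apply: ler_pM => //; rewrite ?mulr_ge0 ?invr_ge0 ?normc_ge0//); apply: FB; case: vf.
have -> : (b - a) + (d - c) = 4 * rho by rewrite /a /b /c /d; ring.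
move=> h; rewrite ler_pdivrMr ?(lt_le_trans _ two_pi_ge1)//.
apply: (le_trans h).
have -> : 2 * (normc (z - w) ^+ 2 * (2 * B / rho ^+ 3)) * (4 * rho) =
    16 * B / rho ^+ 2 * normc (z - w) ^+ 2 by field; rewrite gt_eqF.
apply: ler_peMr; last exact: two_pi_ge1.
by rewrite !mulr_ge0 ?invr_ge0 ?sqr_ge0 ?normc_ge0.
Qed.

(** Cauchy's formula for f v / (v - w) at z on [x, x + N] x [-N, N]. The extra factor v - w makes
    the integrand O(N^-2) for merely bounded f, so the three sides off the line contribute 4 B / N,
    4 B / N and 8 B / N. *)
Lemma line_cauchy f (x B N : R) (z w : C) :
  (forall v, x <= Re v -> cdiff f v) -> (forall v, x <= Re v -> normc (f v) <= B) ->
  x < Re z -> Re w < x -> 0 < x -> 2 * normc z <= N -> 2 * normc w <= N ->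
  normc (cint (- N) N (fun t => f (x +i* t) / ((z - x +i* t) * (x +i* t - w)))
         - (2 * pi)%:C * (f z / (z - w))) <= 16 * B / N.
Proof.
move=> df fB xz wx x0 zN wN.
have Rz := Re_le_normc z.
have N0 : 0 < N by lra.
have Iz := normc_Im z.
have B0 : 0 <= B := le_trans (normc_ge0 _) (fB z (ltW xz)).
have xN : x <= x + N by lra.
have NN : - N <= N by lra.
have dH v : x <= Re v -> cdiff (fun v => f v / (v - w)) v.
  move=> xv; apply: cdiff_div; last exact: df.
  by apply/eqP => vw; move: xv; rewrite vw; lra.
have zR : x < Re z < x + N by lra.
have zI : - N < Im z < N by move: Iz; rewrite ler_norml; lra.
have := @cauchy_rect _ (fun v => f v / (v - w)) z _ _ _ _ zR zI.
move=> /(_ _)/wrap[v /andP[/andP[xv _] _]|]; first exact: dH.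
set g := fun v => _ => E.
have cg v : x <= Re v -> v != z -> ccont_at g v.
  by move=> xv vz; apply/cdiff_ccont/cdiff_div => //; exact: dH.
have big v : x <= Re v -> N <= normc v -> normc (g v) <= 4 * B / N ^+ 2.
  move=> xv vN.
  have bd u : 2 * normc u <= N -> N / 2 <= normc (v - u).
    move=> uN; have : normc v <= normc (v - u) + normc u.
      by rewrite -{1}(subrK u v); exact: normcD.
    lra.
  rewrite /g !normcM !normcV.
  have -> : 4 * B / N ^+ 2 = B * (N / 2)^-1 * (N / 2)^-1 by field; rewrite gt_eqF.
  have iw : (normc (v - w))^-1 <= (N / 2)^-1.
    by rewrite lef_pV2 ?posrE ?divr_gt0 ?bd// (lt_le_trans _ (bd _ wN))// divr_gt0.
  have iz : (normc (v - z))^-1 <= (N / 2)^-1.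
    by rewrite lef_pV2 ?posrE ?divr_gt0 ?bd// (lt_le_trans _ (bd _ zN))// divr_gt0.
  by do 2 (apply: ler_pM => //; rewrite ?mulr_ge0 ?invr_ge0 ?normc_ge0//); exact: fB.
have h y : (y == N) || (y == - N) -> normc (cint x (x + N) (fun x => g (x +i* y))) <= 4 * B / N.
  move=> yN; have yNn : `|y| = N.
    by case/orP: yN => /eqP ->; rewrite ?normrN gtr0_norm.
  have -> : 4 * B / N = 4 * B / N ^+ 2 * ((x + N) - x) by field; rewrite gt_eqF.
  apply: normc_cint_le => // [|s /andP[xs _]].
    apply: ccont_hline => s /andP[xs _]; apply: cg => //.
    apply/eqP => sz; have : `|Im z| = N by rewrite -sz /= yNn.
    by move: zI; have := ler_norm (Im z); have := ler_norm (- Im z); rewrite normrN; lra.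
  by apply: big => //; rewrite -yNn; exact: (normc_Im (s +i* y)).
have r : normc (cint (- N) N (fun t => g ((x + N) +i* t))) <= 8 * B / N.
  have -> : 8 * B / N = 4 * B / N ^+ 2 * (N - - N) by field; rewrite gt_eqF.
  apply: normc_cint_le => // [|s _].
    apply: ccont_vline => s _; apply: cg => //=.
    by apply/eqP => sz; move: zR; rewrite -sz /=; lra.
  apply: big => //; apply: le_trans (Re_le_normc ((x + N) +i* s)).
  by rewrite [complex.Re _]/=; lra.
have cl : pcont (- N) N (fun t => g (x +i* t)).
  apply: ccont_vline => s _; apply: cg => //=.
  by apply/eqP => sz; move: zR; rewrite -sz /=; lra.
have -> : cint (- N) N (fun t => f (x +i* t) / ((z - x +i* t) * (x +i* t - w))) =
    -1 * cint (- N) N (fun t => g (x +i* t)).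
  rewrite -cintZ//; apply: eq_cint => t _; rewrite /g.
  have zv : x +i* t - z != 0.
    by rewrite subr_eq0; apply/eqP => sz; move: zR; rewrite -sz /=; lra.
  have vw : x +i* t - w != 0.
    by rewrite subr_eq0; apply/eqP => sz; move: wx; rewrite -sz /=; lra.
  by field; rewrite zv vw -oppr_eq0 opprB zv.
have -> : -1 * cint (- N) N (fun t => g (x +i* t)) - (2 * pi)%:C * (f z / (z - w)) =
    'i * (cint x (x + N) (fun s => g (s +i* (- N))) - cint x (x + N) (fun s => g (s +i* N)))
    - cint (- N) N (fun t => g ((x + N) +i* t)).
  have ii : 'i * 'i = -1 :> C by rewrite -expr2 sqr_i.
  move: E; rewrite /rect_int.
  set I1 := cint x _ _; set I2 := cint x _ _; set I3 := cint _ _ _; set I4 := cint _ _ _.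
  set Q := f z / _; set P : C := (2 * pi)%:C => E.
  have : 'i * (I1 - I2 + 'i * (I3 - I4)) = 'i * ('i * P * Q) by rewrite E.
  have -> : 'i * (I1 - I2 + 'i * (I3 - I4)) = 'i * (I1 - I2) + 'i * 'i * (I3 - I4) by ring.
  have -> : 'i * ('i * P * Q) = 'i * 'i * P * Q by ring.
  rewrite ii => E'; have -> : -1 * I4 - P * Q = -1 * I4 + (-1 * P * Q) by ring.
  by rewrite -E'; ring.
apply: (le_trans (normcBD _ _)); rewrite normcM normc_i mul1r.
have := normcBD (cint x (x + N) (fun s => g (s +i* (- N)))) (cint x (x + N) (fun s => g (s +i* N))).
have := h N; have := h (- N); rewrite !eqxx orbT => /(_ isT) h1 /(_ isT) h2.
have -> : 16 * B / N = 4 * B / N + 4 * B / N + 8 * B / N by ring.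
move: h1 h2 r; clear; lra.
Qed.

End CauchyConsequences.

(** * Poisson integrals and the Pick inequality on the half-plane *)

Section Poisson.
Variable R : realType.
Local Notation C := R[i].
Local Notation Re := (@complex.Re R).
Local Notation Im := (@complex.Im R).
Local Notation mu := (@lebesgue_measure R).

Lemma le_add_inv (x y K M0 : R) : (forall M, M0 <= M -> 0 < M -> x <= y + K / M) -> x <= y.
Proof.
move=> H; apply/ler_addgt0Pr => e e0.
pose M := Num.max (Num.max M0 1) (`|K| / e).
have M0' : 0 < M by rewrite /M !lt_max ltr01 orbT.
apply: (le_trans (H M _ M0')); first by rewrite /M !le_max lexx.
rewrite lerD2l ler_pdivrMr//; apply: (le_trans (ler_norm K)).
by rewrite mulrC -ler_pdivrMr// /M le_max lexx orbT.
Qed.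

Lemma continuous_rcont (f : R -> R) : (forall a b, rcont a b f) -> continuous f.
Proof. by move=> cf t; apply: (cf t t); rewrite lexx. Qed.

Lemma rint_EFin a b (f : R -> R) : rcont a b f ->
  (rint a b f)%:E = (\int[mu]_(t in `[a, b]) (f t)%:E)%E.
Proof.
move=> cf; rewrite /rint /Rintegral fineK//.
exact: (integrable_fin_num _ (rcont_integrable cf)).
Qed.

Lemma rcont_measurable (f : R -> R) : (forall a b, rcont a b f) -> measurable_fun setT f.
Proof.
move=> /continuous_rcont cf; exact: continuous_measurable_fun.
Qed.

Lemma rint_le_integral a b (f : R -> R) : (forall a b, rcont a b f) ->
  (forall t, 0 <= f t) -> ((rint a b f)%:E <= \int[mu]_t (f t)%:E)%E.
Proof.
move=> cf f0; rewrite rint_EFin//; apply: ge0_subset_integral => //.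
- by apply/measurable_EFinP; exact: rcont_measurable.
- by move=> t _; rewrite lee_fin.
Qed.

Lemma integral_le_rint K (f : R -> R) : (forall a b, rcont a b f) ->
  (forall t, 0 <= f t) -> (forall N, 0 < N -> rint (- N) N f <= K) ->
  (\int[mu]_t (f t)%:E <= K%:E)%E.
Proof.
move=> cf f0 H.
have mf : measurable_fun setT (EFin \o f).
  by apply/measurable_EFinP; exact: rcont_measurable.
pose D (n : nat) : set R := `[- (n.+1%:R), n.+1%:R]%classic.
have TD : [set: R] = \bigcup_n D n.
  apply/esym; rewrite -subTset => t _; exists (Num.truncn `|t|) => //.
  rewrite /D /= in_itv /= -ler_norml ltW//; exact: truncnS_gt.
rewrite TD.
have ndD : nondecreasing_seq D.
  apply/nondecreasing_seqP => n; rewrite subsetEset; apply: subset_itv; rewrite bnd_simp.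
    by rewrite lerN2 ler_nat.
  by rewrite ler_nat.
have cvI : (fun i => \int[mu]_(x in D i) (EFin \o f) x)%E @ \oo --> (\int[mu]_(x in \bigcup_n D n) (EFin \o f) x)%E.
  apply: ge0_nondecreasing_set_cvg_integral => //; [|move=> i|move=> i t _].
  - by move=> i; exact: measurable_itv.
  - exact: measurable_funTS.
  - by rewrite lee_fin.
move/cvg_lim : (cvI) => <- //.
apply: lime_le; first by apply/cvg_ex; eexists; exact: cvI.
near=> n; rewrite /D /= -rint_EFin// lee_fin; exact: H.
Unshelve. all: by end_near. Qed.

Section Kernel.
Variables (f : C -> C) (x B : R).
Hypotheses (x0 : 0 < x) (df : forall v, x <= Re v -> cdiff f v)
  (fB : forall v, x <= Re v -> normc (f v) <= B).

Lemma pcont_line a b : pcont a b (fun t => f (x +i* t)).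
Proof. by apply: ccont_vline => t _; exact/cdiff_ccont/df. Qed.

Lemma line_neq z t : x < Re z -> z - x +i* t != 0.
Proof. by move=> xz; rewrite subr_eq0; apply/eqP => zE; move: xz; rewrite zE /= ltxx. Qed.

Lemma rcont_kernel z a b : x < Re z -> rcont a b (fun t => (normc (z - x +i* t) ^+ 2)^-1).
Proof.
move=> xz; apply: rcontV.
  by move=> t _; rewrite expf_neq0// gt_eqF// normc_gt0 line_neq.
have cn : rcont a b (fun t => normc (z - x +i* t)).
  apply: pcont_normc; apply: (@ccont_vline _ (fun v => z - v)) => t _.
  by apply: cdiff_ccont; apply: cdiffB; [exact: cdiff_cst|exact: cdiff_id].
by under eq_fun do rewrite expr2; exact: rcontM.
Qed.

(** 2 x - conj z is the mirror image of z in the line Re v = x; on that line its difference to v is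
    the conjugate of z - v, which turns the kernel of [line_cauchy] into the Poisson kernel. *)
Lemma kernelE (z : C) t : ((z - x +i* t) * (x +i* t - ((2 * x)%:C - z^*)) : C) =
  (normc (z - x +i* t) ^+ 2)%:C.
Proof.
by apply: complexP; rewrite normc_sq !ReImE /=; ring.
Qed.

Lemma cross_kernelE (w : C) t : x +i* t - ((2 * x)%:C - w^*) = (w - x +i* t)^*.
Proof. by apply: complexP; rewrite !ReImE /=; ring. Qed.

Lemma pole_sum (z w : C) : z - ((2 * x)%:C - w^*) = z + w^* - (2 * x)%:C.
Proof. by ring. Qed.

(** A truncation height from which [line_cauchy] applies to z and to its mirror image. *)
Let M0 (z : C) : R := 2 * normc z + 2 * (2 * x + normc z).

Let M0P (z w : C) M : M0 z <= M -> M0 w <= M ->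
  2 * normc z <= M /\ 2 * normc ((2 * x)%:C - w^*) <= M.
Proof.
move: x0 => x0'; move=> zM wM; have x2 : 0 <= 2 * x by rewrite mulr_ge0 ?ltW.
have := normcBD (2 * x)%:C w^*; rewrite normc_conj normc_real ger0_norm// => h.
move: zM wM; rewrite /M0; have := normc_ge0 z; have := normc_ge0 w => h1 h2 h3 h4.
by split; lra.
Qed.

Let kint z N := cint (- N) N (fun t => f (x +i* t) * ((normc (z - x +i* t) ^+ 2)^-1)%:C).

Lemma kint_approx z N : x < Re z -> M0 z <= N ->
  normc (kint z N - ((pi / (Re z - x))%:C * f z)) <= 16 * B / N.
Proof.
move: x0 => x0'.
move=> xz zN; have [h1 h2] := M0P zN zN.
have wx : Re ((2 * x)%:C - z^*) < x by rewrite ReB ReJ /=; lra.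
have := line_cauchy df fB xz wx x0 h1 h2.
have -> : (2 * pi)%:C * (f z / (z - ((2 * x)%:C - z^*))) = (pi / (Re z - x))%:C * f z.
  have -> : z - ((2 * x)%:C - z^*) = (2 * (Re z - x))%:C.
    by apply: complexP; rewrite !ReImE /=; ring.
  rewrite mulrCA -fmorphV -rmorphM mulrC; congr (_%:C * _).
  by field; rewrite subr_eq0 gt_eqF.
rewrite /kint; congr (normc (_ - _) <= _); apply: eq_cint => t _.
by rewrite kernelE fmorphV.
Qed.

Lemma pcont_kint z a b : x < Re z ->
  pcont a b (fun t => f (x +i* t) * ((normc (z - x +i* t) ^+ 2)^-1)%:C).
Proof.
move=> xz; have ck : rcont a b _ := rcont_kernel xz.
have [cr ci] := (pcont_Re (@pcont_line a b), pcont_Im (@pcont_line a b)).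
apply: pcontE.
  apply: (@eq_rcont _ a b (fun t => Re (f (x +i* t)) * (normc (z - x +i* t) ^+ 2)^-1)).
    by move=> t; rewrite ReM [complex.Im _%:C]/= mulr0 subr0.
  exact: rcontM.
apply: (@eq_rcont _ a b (fun t => Im (f (x +i* t)) * (normc (z - x +i* t) ^+ 2)^-1)).
  by move=> t; rewrite ImM [complex.Im _%:C]/= mulr0 add0r.
exact: rcontM.
Qed.

(** The Poisson formula with the modulus taken inside. The right side may be infinite; otherwise the
    truncation height tends to infinity. *)
Lemma poisson_abs z : x < Re z ->
  ((pi / (Re z - x) * normc (f z))%:E <=
    \int[mu]_t (normc (f (x +i* t)) / normc (z - x +i* t) ^+ 2)%:E)%E.
Proof.
move=> xz.
have cI a b : rcont a b (fun t => normc (f (x +i* t)) / normc (z - x +i* t) ^+ 2).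
  by apply: rcontM; [apply: pcont_normc; exact: pcont_line|exact: rcont_kernel].
have I0 t : 0 <= normc (f (x +i* t)) / normc (z - x +i* t) ^+ 2.
  by rewrite divr_ge0 ?normc_ge0// sqr_ge0.
have : (0 <= \int[mu]_t (normc (f (x +i* t)) / normc (z - x +i* t) ^+ 2)%:E)%E.
  by apply: integral_ge0 => t _; rewrite lee_fin.
case E : (\int[mu]_t _)%E => [r | |] // _; last by rewrite leey.
rewrite lee_fin; apply: (@le_add_inv _ _ (16 * B) (M0 z)) => M zM M_gt0.
have h := kint_approx xz zM.
have h2 : normc (kint z M) <= r.
  rewrite -lee_fin -E; apply: le_trans (rint_le_integral (- M) M cI I0).
  rewrite lee_fin; apply: normc_cint => // [|t _]; first exact: pcont_kint.
  rewrite normcM normc_real ger0_norm// invr_ge0 sqr_ge0//.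
have -> : pi / (Re z - x) * normc (f z) = normc ((pi / (Re z - x))%:C * f z).
  by rewrite normcM normc_real ger0_norm// divr_ge0 ?pi_ge0//; lra.
have := normcD (kint z M) (- (kint z M - (pi / (Re z - x))%:C * f z)).
rewrite normc_opp opprB addrC subrK; lra.
Qed.

(** The Poisson formula for Re f. By positivity, a short window gives at most the integral over a
    longer one, and the error of the longer one tends to 0. *)
Lemma poisson_Re z N : x < Re z -> 0 < N -> (forall t, 0 <= Re (f (x +i* t))) ->
  rint (- N) N (fun t => Re (f (x +i* t)) / normc (z - x +i* t) ^+ 2) <=
  pi / (Re z - x) * Re (f z).
Proof.
move=> xz N0 f0.
have cI a b : rcont a b (fun t => Re (f (x +i* t)) / normc (z - x +i* t) ^+ 2).
  by apply: rcontM; [apply: pcont_Re; exact: pcont_line|exact: rcont_kernel].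
have I0 t : 0 <= Re (f (x +i* t)) / normc (z - x +i* t) ^+ 2.
  by rewrite divr_ge0// sqr_ge0.
apply: (@le_add_inv _ _ (16 * B) (Num.max N (M0 z))) => M; rewrite ge_max => /andP[NM zM] M_gt0.
have h := le_trans (normc_Re _) (kint_approx xz zM).
have E : Re (kint z M) = rint (- M) M (fun t => Re (f (x +i* t)) / normc (z - x +i* t) ^+ 2).
  by apply: eq_rint => t _; rewrite ReM [complex.Im _%:C]/= mulr0 subr0.
have le1 : rint (- N) N (fun t => Re (f (x +i* t)) / normc (z - x +i* t) ^+ 2) <= Re (kint z M).
  rewrite E (@rint_split _ (- M) (- N) M)//; [|lra|lra].
  rewrite (@rint_split _ (- N) N M)//; [|lra].
  by rewrite addrCA lerDl addr_ge0// rint_ge0.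
apply: (le_trans le1); move: h; rewrite ReB ReM [complex.Re _%:C]/= [complex.Im _%:C]/= mul0r subr0.
by rewrite ler_distl => /andP[_].
Qed.

(* AM-GM form of the positivity of the Pick kernel: the integral of
   [2 Re h * a * conj b] over the line, where [a = 1 / (z - v)] and
   [b = 1 / (w - v)], is at most that of [Re h * (s |a|^2 + |b|^2 / s)]. *)
Lemma pick_bound z w s : x < Re z -> x < Re w -> 0 < s ->
  (forall t, 0 <= Re (f (x +i* t))) ->
  2 * normc ((f z + (f w)^*) / (z + w^* - (2 * x)%:C)) <=
  s * (Re (f z) / (Re z - x)) + Re (f w) / (Re w - x) / s.
Proof.
move=> xz xw s0 f0.
(* [X z w N] tends to 2 pi f z / (z + conj w - 2 x); adding the conjugate of [X w z N] replaces f by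
   2 Re f under the integral. *)
pose X z w N := cint (- N) N (fun t => f (x +i* t) / ((z - x +i* t) * (w - x +i* t)^*)).
have XE z1 w1 N : x < Re z1 -> x < Re w1 -> M0 z1 <= N -> M0 w1 <= N ->
    normc (X z1 w1 N - (2 * pi)%:C * (f z1 / (z1 + w1^* - (2 * x)%:C))) <= 16 * B / N.
  move=> xz1 xw1 zN wN; have [h1 h2] := M0P zN wN.
  have wx : Re ((2 * x)%:C - w1^*) < x by rewrite ReB ReJ /=; lra.
  have := line_cauchy df fB xz1 wx x0 h1 h2; rewrite pole_sum.
  by rewrite /X; congr (normc (_ - _) <= _); apply: eq_cint => t _; rewrite cross_kernelE.
have zw0 (t : R) : z - x +i* t != 0 /\ w - x +i* t != 0 by rewrite !line_neq.
have Xc z1 w1 a b : x < Re z1 -> x < Re w1 ->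
    pcont a b (fun t => f (x +i* t) / ((z1 - x +i* t) * (w1 - x +i* t)^*)).
  move=> xz1 xw1.
  have : pcont a b (fun t => f (x +i* t) / ((z1 - x +i* t) * (x +i* t - ((2 * x)%:C - w1^*)))).
    apply: (@ccont_vline _ (fun v => f v / ((z1 - v) * (v - ((2 * x)%:C - w1^*))))) => t _.
    apply/cdiff_ccont/cdiffM; first exact: df.
    apply: cdiffV; first by rewrite mulf_neq0 ?line_neq// cross_kernelE conjc_eq0 line_neq.
    by apply: cdiffM; apply: cdiffB; (exact: cdiff_cst || exact: cdiff_id).
  by under eq_fun do rewrite cross_kernelE.
pose A N := Re (kint z N); pose D N := Re (kint w N).
have key N : 0 < N -> normc (X z w N + (X w z N)^*) <= s * A N + D N / s.
  move=> N0.
  have cI z1 a b : x < Re z1 -> rcont a b (fun t => Re (f (x +i* t)) / normc (z1 - x +i* t) ^+ 2).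
    by move=> xz1; apply: rcontM; [apply: pcont_Re; exact: pcont_line|exact: rcont_kernel].
  have AE z1 : Re (kint z1 N) = rint (- N) N (fun t => Re (f (x +i* t)) / normc (z1 - x +i* t) ^+ 2).
    by apply: eq_rint => t _; rewrite ReM [complex.Im _%:C]/= mulr0 subr0.
  rewrite /A /D !AE [_ / s]mulrC -!rintZ; do ?exact: cI.
  have cZ k z1 : x < Re z1 -> rcont (- N) N (fun t => k * (Re (f (x +i* t)) / normc (z1 - x +i* t) ^+ 2)).
    by move=> xz1; apply: rcontM; [exact: rcont_cst|exact: cI].
  rewrite -rintD; do ?exact: cZ.
  have -> : X z w N + (X w z N)^* = cint (- N) N (fun t => f (x +i* t) / ((z - x +i* t) * (w - x +i* t)^*) +
      (f (x +i* t) / ((w - x +i* t) * (z - x +i* t)^*))^*).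
    rewrite cintD; [|exact: Xc|].
      congr (_ + _); apply: complexP; rewrite !ReImE.
        by apply: eq_rint => t _; rewrite ReJ.
      rewrite -mulN1r -rintZ; last exact: pcont_Im (Xc _ _ _ _ xw xz).
      by apply: eq_rint => t _; rewrite ImJ mulN1r.
    move=> t tI e /(Xc w z _ _ xw xz t tI)[r r0 H]; exists r => // u /H.
    by rewrite -rmorphB normc_conj.
  apply: normc_cint.
  - move=> t tI e e0; have e2 : 0 < e / 2 by rewrite divr_gt0.
    have [r r0 H] := Xc z w _ _ xz xw t tI _ e2.
    have [q q0 G] := Xc w z _ _ xw xz t tI _ e2.
    exists (Num.min r q); first by rewrite lt_min r0.
    move=> u; rewrite lt_min => /andP[/H h /G g].
    rewrite opprD addrACA -rmorphB; apply: (le_lt_trans (normcD _ _)).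
    by rewrite normc_conj (splitr e) ltrD.
  - by apply: rcontD; exact: cZ.
  move=> t _; have [zt wt] := zw0 t.
  have -> : f (x +i* t) / ((z - x +i* t) * (w - x +i* t)^*) +
      (f (x +i* t) / ((w - x +i* t) * (z - x +i* t)^*))^* =
      (2 * Re (f (x +i* t)))%:C / ((z - x +i* t) * (w - x +i* t)^*).
    have -> : ((2 * Re (f (x +i* t)))%:C : C) = f (x +i* t) + (f (x +i* t))^*.
      by apply: complexP; rewrite !ReImE /=; ring.
    have J (u v q : C) : (u / (v * q^*))^* = u^* / (q * v^*).
      by rewrite rmorphM fmorphV rmorphM /= conjcK [q * _]mulrC.
    by rewrite J [in RHS]mulrDl.
  rewrite normcM normcV normcM normc_conj normc_real ger0_norm ?mulr_ge0//.
  have := f0 t; set u := Re _ => u0.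
  have := normc_gt0 (z - x +i* t); rewrite zt; set p := normc _ => p0.
  have := normc_gt0 (w - x +i* t); rewrite wt; set q := normc _ => q0.
  have -> : s * (u / p ^+ 2) + s^-1 * (u / q ^+ 2) = u * (s / p ^+ 2 + (s * q ^+ 2)^-1).
    by field; rewrite !gt_eqF.
  rewrite [2 * u]mulrC -mulrA ler_wpM2l//.
  rewrite -subr_ge0.
  have -> : s / p ^+ 2 + (s * q ^+ 2)^-1 - 2 / (p * q) = s * (p^-1 - (s * q)^-1) ^+ 2.
    by field; rewrite !gt_eqF.
  by rewrite mulr_ge0 ?sqr_ge0 ?ltW.
have p0 : 0 < pi :> R := pi_gt0 R.
have xz' : 0 < Re z - x by rewrite subr_gt0.
have xw' : 0 < Re w - x by rewrite subr_gt0.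
rewrite -(ler_pM2l p0).
(* The four truncation errors 16 B / N enter with weights 1, 1 (cross terms), s and 1 / s (diagonal
   terms). *)
apply: (@le_add_inv _ _ (16 * B * (2 + s + s^-1)) (Num.max (M0 z) (M0 w))) => N.
rewrite ge_max => /andP[zN wN] N0.
have h1 := XE z w N xz xw zN wN.
have h2 := XE w z N xw xz wN zN.
have h3 := le_trans (normc_Re _) (kint_approx xz zN).
have h4 := le_trans (normc_Re _) (kint_approx xw wN).
have h5 := key N N0.
set Q := z + w^* - (2 * x)%:C in h1 *.
have QE : w + z^* - (2 * x)%:C = Q^*.
  by rewrite /Q rmorphB rmorphD /= conjcK oppr0 addrC [in RHS]addrC; congr (_ + _); rewrite addrC.
rewrite QE in h2.
have e1 : (2 * pi)%:C * ((f z + (f w)^*) / Q) =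
   (X z w N + (X w z N)^*) - ((X z w N - (2 * pi)%:C * (f z / Q)) + (X w z N - (2 * pi)%:C * (f w / Q^*))^*).
  have J (u v : C) (p : R) (q : C) : (u - p%:C * (v / q^*))^* = u^* - p%:C * (v^* / q).
    by rewrite rmorphB rmorphM rmorphM fmorphV /= conjcK oppr0.
  have -> := J (X w z N) (f w) (2 * pi) Q; ring.
have -> : pi * (2 * normc ((f z + (f w)^*) / Q)) = normc ((2 * pi)%:C * ((f z + (f w)^*) / Q)).
  by rewrite [RHS]normcM normc_real ger0_norm ?mulr_ge0 ?ltW//; ring.
rewrite e1; apply: (le_trans (normcBD _ _)).
apply: (le_trans (lerD h5 (normcD _ _))); rewrite normc_conj.
move: h3 h4; rewrite !ReB !ReM [complex.Im _%:C]/= [complex.Im _%:C]/= !mul0r !subr0 [complex.Re _%:C]/= [complex.Re _%:C]/= -/(A N) -/(D N).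
rewrite !ler_distl => /andP[_ h3] /andP[_ h4].
have s1 : 0 < s^-1 by rewrite invr_gt0.
have h6 := ler_wpM2l (ltW s0) h3.
have h7 := ler_wpM2l (ltW s1) h4.
have -> : pi * (s * (Re (f z) / (Re z - x)) + Re (f w) / (Re w - x) / s) + 16 * B * (2 + s + s^-1) / N =
  s * (pi / (Re z - x) * Re (f z) + 16 * B / N) + s^-1 * (pi / (Re w - x) * Re (f w) + 16 * B / N) + (16 * B / N + 16 * B / N).
  by field; rewrite !gt_eqF.
rewrite lerD//; last exact: lerD.
by rewrite [D N / s]mulrC lerD.
Qed.

End Kernel.
End Poisson.

(** * Norms and point evaluations on the half-plane *)

Section HalfPlaneIntegrals.
Variable R : realType.
Local Notation C := R[i].
Local Notation Re := (@complex.Re R).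
Local Notation mu := (@lebesgue_measure R).

(* A Caratheodory function is the limit of its discretizations in the first
   variable, at the points [(j + 1) / k]. *)
Lemma measurable_caratheodory (u : R -> R -> R) :
  (forall x, 0 < x -> measurable_fun setT (u x)) ->
  (forall x y, 0 < x -> {for x, continuous (u ^~ y)}) ->
  measurable_fun [set: measurableTypeR R * measurableTypeR R]
    (fun p => if 0 < p.1 then u p.1 p.2 else 0).
Proof.
move=> mu_ cu.
(* The cells with j < (k + 1)^2 cover [0, k + 1); evaluating at the right end keeps the first
   argument of [u] positive even for j = 0. *)
pose I (k j : nat) : set R := [set` `[j%:R / k.+1%:R, j.+1%:R / k.+1%:R[ ].
pose H (k : nat) (p : measurableTypeR R * measurableTypeR R) : R := (if 0 < p.1 then 1 else 0) *
  \sum_(0 <= j < (k.+1 * k.+1)%N) (\1_(I k j) p.1 * u (j.+1%:R / k.+1%:R) p.2).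
apply: (measurable_fun_cvg (h := H)).
  move=> k; apply: measurable_funM.
    apply: measurable_fun_ifT => //.
    by apply: measurable_fun_ltr => //; exact: measurable_fst.
  apply: measurable_sum => j; apply: measurable_funM.
    by apply: measurableT_comp => //; apply: measurable_indic; exact: measurable_itv.
  by apply: measurableT_comp => //; apply: mu_; rewrite divr_gt0.
move=> [x y] _ /=; rewrite /H /=.
have [x0|x0] := ltP 0 x; last first.
  by under eq_fun do rewrite mul0r; exact: cvg_cst.
apply/cvgrPdist_lt => e e0.
have [r r0 Hr] := contrP (cu x y x0) e0.
near=> k.
have k0 : 0 < k.+1%:R :> R by rewrite ltr0n.
have xk : x < k.+1%:R.
  near: k; exists (Num.truncn x) => // m /= xm.
  by rewrite (lt_le_trans (truncnS_gt x))// ler_nat.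
have kr : k.+1%:R^-1 < r by near: k; exact: (near_infty_natSinv_lt (PosNum r0)).
pose j := Num.truncn (x * k.+1%:R).
have xk0 : 0 <= x * k.+1%:R by rewrite mulr_ge0 ?ltW.
have /andP[j1 j2] : j%:R <= x * k.+1%:R < j.+1%:R by exact: truncn_itv.
have jk : (j < k.+1 * k.+1)%N.
  rewrite -(ltr_nat R); apply: (le_lt_trans j1); rewrite natrM ltr_pM2r//.
have IE i : \1_(I k i) x = (i == j)%:R :> R.
  rewrite indicE; congr (nat_of_bool _)%:R; apply/idP/idP.
    move=> /set_mem; rewrite /I /= in_itv /= ler_pdivrMr// ltr_pdivlMr// => /andP[i1 i2].
    have : (i < j.+1)%N by rewrite -(ltr_nat R) (le_lt_trans i1).
    have : (j < i.+1)%N by rewrite -(ltr_nat R) (le_lt_trans j1).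
    by rewrite !ltnS eqn_leq => -> ->.
  move=> /eqP ->; apply/mem_set; rewrite /I /= in_itv /= ler_pdivrMr// ltr_pdivlMr//.
  by rewrite j1 j2.
rewrite mul1r big_mkord (bigD1 (Ordinal jk)) //= big1 ?addr0; last first.
  move=> i ij; rewrite IE; suff -> : (i == j :> nat) = false by rewrite mul0r.
  by apply: contraNF ij => /eqP ij; apply/eqP/val_inj.
rewrite IE eqxx mul1r distrC; apply: Hr.
rewrite ger0_norm; last first.
  by rewrite subr_ge0 ler_pdivlMr// ltW.
rewrite (le_lt_trans _ kr)// lerBlDr ler_pdivrMr// mulrDl mulVf ?gt_eqF//.
by rewrite -natr1 addrC lerD2l.
Unshelve. all: by end_near. Qed.

Definition hol (G : C -> C) := forall z, 0 < Re z -> cdiff G z.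

(* [pi] times the squared Bergman norm. *)
Definition sqn (al : R) (G : C -> C) : \bar R :=
  (\int[mu]_y \int[mu]_(x in `]0%R, +oo[) (x `^ al * normc (G (x +i* y)) ^+ 2)%:E)%E.

(** The integrand extended by 0 to the plane, so that Tonelli applies to the full product
    measure. *)
Definition dens (al : R) (G : C -> C) (p : measurableTypeR R * measurableTypeR R) : R :=
  p.1 `^ al * (if 0 < p.1 then normc (G (p.1 +i* p.2)) ^+ 2 else 0).

Lemma dens_ge0 al G p : 0 <= dens al G p.
Proof. by rewrite /dens mulr_ge0 ?powR_ge0//; case: ifP => // _; rewrite sqr_ge0. Qed.

Lemma hol_pcont G x a b : hol G -> 0 < x -> pcont a b (fun y => G (x +i* y)).
Proof. by move=> hG x0; apply: ccont_vline => y _; exact/cdiff_ccont/hG. Qed.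

Lemma rcontX2 a b (f : R -> R) : rcont a b f -> rcont a b (fun t => f t ^+ 2).
Proof. by move=> cf; under eq_fun do rewrite expr2; exact: rcontM. Qed.

Lemma hol_sq_measurable G x : hol G -> 0 < x ->
  measurable_fun [set: measurableTypeR R] (fun y => normc (G (x +i* y)) ^+ 2).
Proof.
move=> hG x0; apply: rcont_measurable => a b.
by apply: rcontX2; apply: pcont_normc; exact: hol_pcont.
Qed.

Lemma hol_hsq_measurable G : hol G ->
  measurable_fun [set: measurableTypeR R * measurableTypeR R]
    (fun p => if 0 < p.1 then normc (G (p.1 +i* p.2)) ^+ 2 else 0).
Proof.
move=> hG; apply: (@measurable_caratheodory (fun x y => normc (G (x +i* y)) ^+ 2)) => [x x0|x y x0].
  exact: hol_sq_measurable.
have c : rcont x x (fun x => normc (G (x +i* y)) ^+ 2).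
  apply: rcontX2; apply: pcont_normc; apply: ccont_hline => t /andP[xt _].
  by apply/cdiff_ccont/hG => /=; exact: lt_le_trans xt.
by apply: c; rewrite lexx.
Qed.

Lemma measurable_dens al G : hol G ->
  measurable_fun [set: measurableTypeR R * measurableTypeR R] (EFin \o dens al G).
Proof.
move=> hG; apply/measurable_EFinP; apply: measurable_funM; last exact: hol_hsq_measurable.
apply: (@measurableT_comp _ _ _ _ _ _ (fun x : measurableTypeR R => x `^ al : measurableTypeR R)).
  exact: measurable_powR.
exact: measurable_fst.
Qed.

Lemma integral_pos_mkcond (f : R -> \bar R) :
  (\int[mu]_(x in `]0%R, +oo[) f x = \int[mu]_x (if (0 < x)%R then f x else 0))%E.
Proof.
rewrite integral_mkcond; apply: eq_integral => x _; rewrite patchE.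
by rewrite mem_setE in_itv /= andbT.
Qed.

Lemma sqnE al G : sqn al G = (\int[mu]_y \int[mu]_x (dens al G (x, y))%:E)%E.
Proof.
apply: eq_integral => y _; rewrite integral_pos_mkcond; apply: eq_integral => x _.
by rewrite /dens /=; case: ifP => //; rewrite mulr0.
Qed.

Lemma sqn_prod al G : hol G -> sqn al G = (\int[mu \x mu]_p (dens al G p)%:E)%E.
Proof.
move=> hG; rewrite sqnE (fubini_tonelli2 (EFin \o dens al G))//; first exact: measurable_dens.
by move=> p; rewrite lee_fin dens_ge0.
Qed.

Definition lineint (G : C -> C) x : \bar R := (\int[mu]_y (normc (G (x +i* y)) ^+ 2)%:E)%E.

Lemma lineint_ge0 G x : (0 <= lineint G x)%E.
Proof. by apply: integral_ge0 => y _; rewrite lee_fin sqr_ge0. Qed.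

Lemma sqn_lineint al G : hol G ->
  sqn al G = (\int[mu]_(x in `]0%R, +oo[) ((x `^ al)%:E * lineint G x))%E.
Proof.
move=> hG; rewrite sqn_prod// (fubini_tonelli1 (EFin \o dens al G))//; last 2 first.
- exact: measurable_dens.
- by move=> p; rewrite lee_fin dens_ge0.
rewrite integral_pos_mkcond; apply: eq_integral => x _; rewrite /fubini_F /dens /=.
case: ifP => x0; last first.
  by rewrite integral0_eq// => y _; rewrite mulr0.
under eq_integral do rewrite EFinM.
rewrite ge0_integralZl//; last by rewrite lee_fin powR_ge0.
- by apply/measurable_EFinP; exact: hol_sq_measurable.
- by move=> y _; rewrite lee_fin sqr_ge0.
Qed.

Lemma measurable_lineint G : hol G ->
  measurable_fun [set: measurableTypeR R] (fun x : measurableTypeR R => if 0 < x then lineint G x else 0%E).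
Proof.
move=> hG.
have := @measurable_fun_fubini_tonelli_F _ _ (measurableTypeR R) (measurableTypeR R) R mu
  (fun p => (if 0 < p.1 then normc (G (p.1 +i* p.2)) ^+ 2 else 0)%:E).
have m1 : measurable_fun [set: measurableTypeR R * measurableTypeR R]
   (fun p => (if 0 < p.1 then normc (G (p.1 +i* p.2)) ^+ 2 else 0)%:E).
  by apply/measurable_EFinP; exact: hol_hsq_measurable.
move=> /(_ m1) H.
apply: eq_measurable_fun (H _) => [x _|p].
  rewrite /fubini_F /=; case: ifP => // _.
  by rewrite integral0_eq.
by rewrite lee_fin; case: ifP => // _; rewrite sqr_ge0.
Qed.

Lemma sqn_ge0 al G : (0 <= sqn al G)%E.
Proof.
apply: integral_ge0 => y _; apply: integral_ge0 => x _.
by rewrite lee_fin mulr_ge0 ?powR_ge0 ?sqr_ge0.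
Qed.

Lemma eq_sqn al F G : (forall z, 0 < Re z -> F z = G z) -> sqn al F = sqn al G.
Proof.
move=> FG; apply: eq_integral => y _; apply: eq_integral => x.
by rewrite inE /= in_itv /= andbT => x0; rewrite FG.
Qed.

Lemma hol_lin k F G : hol F -> hol G -> hol (fun z => k * F z + G z).
Proof.
move=> hF hG z z0; apply: cdiffD; last exact: hG.
by apply: cdiffM; [exact: cdiff_cst|exact: hF].
Qed.

Lemma holZ k F : hol F -> hol (fun z => k * F z).
Proof. by move=> hF z z0; apply: cdiffM; [exact: cdiff_cst|exact: hF]. Qed.

Lemma sqnZ al k F : hol F -> sqn al (fun z => k * F z) = ((normc k ^+ 2)%:E * sqn al F)%E.
Proof.
move=> hF; rewrite !sqn_prod//; last exact: holZ.
rewrite -ge0_integralZl//; last by rewrite lee_fin sqr_ge0.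
- apply: eq_integral => p _; rewrite -EFinM /dens; congr (_%:E).
  by case: ifP => _; rewrite ?normcM ?exprMn; ring.
- exact: measurable_dens.
- by move=> p _; rewrite lee_fin dens_ge0.
Qed.

(** Pointwise (a + b)^2 <= 2 a^2 + 2 b^2; the lost factor 2 is harmless for finiteness and for the
    bound on [psum]. *)
Lemma sqn_lin al k F G : hol F -> hol G ->
  (sqn al (fun z => k * F z + G z)%R <=
    (2 * normc k ^+ 2)%R%:E * sqn al F + 2%:E * sqn al G)%E.
Proof.
move=> hF hG; have mF := measurable_dens al hF; have mG := measurable_dens al hG.
have F0 p : (0 <= (dens al F p)%:E)%E by rewrite lee_fin dens_ge0.
have G0 p : (0 <= (dens al G p)%:E)%E by rewrite lee_fin dens_ge0.
have k0 : 0 <= 2 * normc k ^+ 2 by rewrite mulr_ge0 ?sqr_ge0.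
rewrite !sqn_prod//; last exact: hol_lin.
rewrite -!ge0_integralZl ?lee_fin//.
rewrite -ge0_integralD//.
- apply: ge0_le_integral => //.
  + by move=> p _; rewrite lee_fin dens_ge0.
  + by apply: measurable_dens; exact: hol_lin.
  + by apply: emeasurable_funD; apply: measurable_funeM.
  move=> p _; rewrite -!EFinM -EFinD lee_fin /dens.
  have w0 := powR_ge0 p.1 al; set w := _ `^ _ in w0 *.
  case: ifP => _; last by rewrite !mulr0 addr0.
  set x := F _; set y := G _.
  have := normcD (k * x) y; rewrite normcM.
  have := normc_ge0 (k * x + y); have := normc_ge0 k; have := normc_ge0 x; have := normc_ge0 y.
  set a := normc (_ + _); set b := normc k; set c := normc x; set d := normc y => d0 c0 b0 a0 le.
  have : a ^+ 2 <= 2 * b ^+ 2 * c ^+ 2 + 2 * d ^+ 2.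
    have : a ^+ 2 <= (b * c + d) ^+ 2 by rewrite ler_sqr ?nnegrE// addr_ge0// mulr_ge0.
    have := sqr_ge0 (b * c - d); nra.
  move=> h; have := ler_wpM2l w0 h; lra.
- by move=> p _; rewrite mule_ge0// lee_fin.
- exact: measurable_funeM.
- by move=> p _; rewrite mule_ge0// lee_fin.
- exact: measurable_funeM.
Qed.

(** Termwise integration of a pointwise bound by squares; in [sqn_neumann] that bound comes from
    [weighted_cauchy_schwarz]. *)
Lemma sqn_series al (c : nat -> R) (G : nat -> C -> C) S : (forall n, 0 <= c n) ->
  (forall n, hol (G n)) -> hol S ->
  (forall z, 0 < Re z ->
    ((normc (S z) ^+ 2)%R%:E <= \sum_(n <oo) (c n * normc (G n z) ^+ 2)%R%:E)%E) ->
  (sqn al S <= \sum_(n <oo) ((c n)%:E * sqn al (G n)))%E.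
Proof.
move=> c0 hG hS H; rewrite sqn_prod//.
have D0 n p : (0 <= (c n)%:E * (dens al (G n) p)%:E)%E.
  by rewrite mule_ge0// lee_fin// dens_ge0.
have mD n : measurable_fun setT (fun p => (c n)%:E * (dens al (G n) p)%:E)%E.
  by apply: measurable_funeM; exact: measurable_dens.
have -> : (\sum_(n <oo) ((c n)%:E * sqn al (G n)) =
    \int[mu \x mu]_p \sum_(n <oo) ((c n)%:E * (dens al (G n) p)%:E))%E.
  rewrite integral_nneseries//; apply: eq_eseriesr => n _.
  rewrite sqn_prod// ge0_integralZl ?lee_fin//; first exact: measurable_dens.
  by move=> p _; rewrite lee_fin dens_ge0.
apply: ge0_le_integral => //.
- by move=> p _; rewrite lee_fin dens_ge0.
- exact: measurable_dens.
- by apply: ge0_emeasurable_sum => // n p _ _; exact: D0.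
move=> p _; rewrite /dens.
case: ifP => x0; last first.
  by rewrite mulr0 nneseries_ge0// => n _ _; rewrite mule0.
rewrite EFinM (_ : (\sum_(n <oo) _)%E = ((p.1 `^ al)%:E * \sum_(n <oo) (c n * normc (G n (p.1 +i* p.2)) ^+ 2)%:E)%E).
  by rewrite lee_wpmul2l ?lee_fin ?powR_ge0 ?H.
rewrite -nneseriesZl.
  by apply: eq_eseriesr => n _; rewrite -!EFinM; congr (_%:E); ring.
by move=> n _; rewrite lee_fin mulr_ge0// sqr_ge0.
Qed.

(** k times the pushforward gives half-open intervals their length, which determines Lebesgue
    measure. *)
Lemma lebesgue_measure_scale (k : R) (A : set (measurableTypeR R)) : 0 < k -> measurable A ->
  pushforward mu (fun x : measurableTypeR R => x * k : measurableTypeR R) A = ((k^-1)%:E * mu A)%E.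
Proof.
move=> k0 mA; have kN : k != 0 by rewrite gt_eqF.
have mk : measurable_fun [set: measurableTypeR R] (fun x : measurableTypeR R => x * k : measurableTypeR R).
  by apply: measurable_funM => //; exact: measurable_cst.
pose phi := fun x : measurableTypeR R => x * k : measurableTypeR R.
pose nu_ : {measure set (measurableTypeR R) -> \bar R} :=
  mscale (NngNum (ltW k0)) (pushforward mu phi).
pose nu := nu_ mk.
have nuE : forall B, measurable B -> mu B = nu B.
  apply: lebesgue_measure_unique => _ [[a b]] _ <-.
  pose J : set R := `]a / k, b / k]%classic.
  have -> : nu `]a, b]%classic = (k%:E * mu J)%E.
    rewrite -[LHS]/(k%:E * mu (phi @^-1` `]a, b]))%E; congr (_ * mu _)%E.
    rewrite /J; apply/seteqP; split => x; rewrite /= !in_itv /= ltr_pdivrMr// ler_pdivlMr//.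
  rewrite !lebesgue_measure_itv /= !lte_fin ltr_pM2r ?invr_gt0//.
  case: ifP => _; last by rewrite mule0.
  by rewrite -!EFinB -EFinM; congr (_%:E); field.
rewrite (nuE _ mA) /nu /= /mscale /= muleA -EFinM mulVf// mul1e.
by [].
Qed.

Lemma integral_scale (k : R) (f : R -> \bar R) : 0 < k ->
  measurable_fun [set: measurableTypeR R] (f : measurableTypeR R -> \bar R) ->
  (forall x, 0 <= f x)%E ->
  (\int[mu]_x f (x * k)%R = (k^-1)%:E * \int[mu]_x f x)%E.
Proof.
move=> k0 mf f0.
have mk : measurable_fun [set: measurableTypeR R] (fun x : measurableTypeR R => x * k : measurableTypeR R).
  by apply: measurable_funM => //; exact: measurable_cst.
have ki : 0 <= k^-1 by rewrite invr_ge0 ltW.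
rewrite -(@ge0_integral_mscale _ _ _ mu setT measurableT (NngNum ki) f)//.
rewrite -[LHS](@ge0_integral_pushforward _ _ (measurableTypeR R) (measurableTypeR R) R
  (fun x : measurableTypeR R => x * k) mk mu setT f)//.
by apply: eq_measure_integral => B mB _; exact: lebesgue_measure_scale.
Qed.

End HalfPlaneIntegrals.

(** * The point evaluation bound *)

Section PointEvaluation.
Variable R : realType.
Local Notation C := R[i].
Local Notation Re := (@complex.Re R).
Local Notation Im := (@complex.Im R).
Local Notation mu := (@lebesgue_measure R).

(** This is 2^-|al|, the loss in replacing x^al by rho^al when x and rho differ by a factor at most
    2. *)
Definition pw (al : R) : R := expR (- (`|al| * ln 2)).

Lemma powR_comparable (al rho x : R) : 0 < rho -> rho / 2 <= x <= 2 * rho ->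
  pw al * rho `^ al <= x `^ al.
Proof.
move=> r0 /andP[x1 x2]; have x0 : 0 < x by lra.
have u0 : 0 < x / rho by rewrite divr_gt0.
have -> : x = (x / rho) * rho by field; rewrite gt_eqF.
rewrite (powRM _ (ltW u0) (ltW r0)) ler_wpM2r ?powR_ge0//.
rewrite /powR gt_eqF// /pw ler_expR lerNl -mulrN.
apply: (le_trans (ler_norm _)); rewrite normrM normrN ler_wpM2l//.
rewrite ler_norml; apply/andP; split.
  rewrite -lnV ?posrE// ler_ln ?posrE// ?invr_gt0//.
  by rewrite ler_pdivlMr// mulrC.
by rewrite ler_ln ?posrE// ler_pdivrMr.
Qed.

(** Averaging: if f exceeded J / (q - p) on all of [p, q], its integral would be at least J. *)
Lemma integral_exists_le (f : R -> \bar R) (p q J : R) : p < q ->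
  measurable_fun [set: measurableTypeR R] (f : measurableTypeR R -> \bar R) ->
  (forall x, 0 <= f x)%E -> (\int[mu]_x f x < J%:E)%E ->
  exists2 x, p <= x <= q & (f x <= (J / (q - p))%:E)%E.
Proof.
move=> pq mf f0 IJ; apply: contrapT => H.
have : (J%:E <= \int[mu]_x f x)%E; last by rewrite leNgt IJ.
have J0 : 0 <= J.
  by rewrite -lee_fin; apply: le_trans (ltW IJ); apply: integral_ge0.
have -> : J%:E = (\int[mu]_(x in `[p, q]) (J / (q - p))%:E)%E.
  rewrite integral_cst//= lebesgue_measure_itv /= lte_fin pq -EFinB -EFinM; congr (_%:E).
  by field; rewrite subr_eq0 gt_eqF.
apply: (@le_trans _ _ (\int[mu]_(x in `[p, q]) f x)%E).
  apply: ge0_le_integral => //.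
  - by move=> x _; rewrite lee_fin divr_ge0// subr_ge0 ltW.
  - exact: measurable_funTS.
  - move=> x /=; rewrite in_itv /= => xI; apply/ltW; rewrite ltNge; apply/negP => h.
    by apply: H; exists x.
by apply: ge0_subset_integral.
Qed.

(** Averaging selects four lines around w, at distance between rho / 4 and rho / 2 from it, on which
    the integral of |G|^2 is controlled; Cauchy's formula for G^2 on the rectangle they bound does
    the rest. Each side contributes (4 / rho) W, where W has a further factor 4 / rho from the
    window length; this gives 4 * 4 * 4 = 64. *)
Lemma point_eval (al : R) (G : C -> C) (w : C) : hol G -> 0 < Re w ->
  ((normc (G w) ^+ 2 * Re w `^ (al + 2))%:E <= (64 / pw al)%:E * sqn al G)%E.
Proof.
move=> hG; set rho := Re w; set eta := Im w => r0.
have pw0 : 0 < pw al by exact: expR_gt0.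
have ra0 : 0 < rho `^ al by rewrite powR_gt0.
have K0 : 0 < 64 / pw al by rewrite divr_gt0.
have [E|E] := eqVneq (sqn al G) +oo%E.
  by rewrite E mulry gtr0_sg// mul1e leey.
have Ifin : sqn al G \is a fin_num by rewrite ge0_fin_numE ?sqn_ge0// ltey.
rewrite -(fineK Ifin) -EFinM lee_fin.
apply/ler_addgt0Pr => e e0.
set I := fine _.
(* A margin above the integral, since [integral_exists_le] asks for a strict inequality. *)
pose J := I + e / (64 / pw al).
have IJ : (sqn al G < J%:E)%E.
  by rewrite -(fineK Ifin) lte_fin /J ltrDl divr_gt0.
have -> : 64 / pw al * I + e = 64 / pw al * J by rewrite /J; field; rewrite gt_eqF.
pose W := (J / (rho / 4)) / (pw al * rho `^ al).
have den0 : 0 < pw al * rho `^ al by rewrite mulr_gt0.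
pose f x y := normc (G (x +i* y)) ^+ 2.
(* Selection of the vertical sides; [Hh] below selects the horizontal ones, where the weight is
   compared with rho^al before integrating in x. *)
have V p q : rho / 2 <= p -> q <= 2 * rho -> q - p = rho / 4 ->
    exists2 x, p <= x <= q & forall c d, rint c d (f x) <= W.
  move=> hp hq qp.
  have pq : p < q by rewrite -subr_gt0 qp divr_gt0.
  have mf : measurable_fun [set: measurableTypeR R] (fun x : measurableTypeR R =>
      (x `^ al)%:E * (if (0 < x)%R then lineint G x else 0))%E.
    apply: emeasurable_funM; last exact: measurable_lineint.
    by apply/measurable_EFinP; exact: measurable_powR.
  have f0 x : (0 <= (x `^ al)%:E * (if (0 < x)%R then lineint G x else 0))%E.
    by rewrite mule_ge0 ?lee_fin ?powR_ge0//; case: ifP => // _; exact: lineint_ge0.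
  have IE : (\int[mu]_x ((x `^ al)%:E * (if (0 < x)%R then lineint G x else 0)) = sqn al G)%E.
    rewrite sqn_lineint// integral_pos_mkcond; apply: eq_integral => x _.
    by case: ifP => //; rewrite mule0.
  have := IJ; rewrite -IE => /(integral_exists_le pq mf f0)[x xpq]; rewrite qp.
  have x0 : 0 < x by move: xpq; lra.
  rewrite x0 => H; exists x => // c d.
  have cf a b : rcont a b (f x) by apply: rcontX2; apply: pcont_normc; exact: hol_pcont.
  have xa : pw al * rho `^ al <= x `^ al by apply: powR_comparable => //; move: xpq; lra.
  have xa0 : 0 < x `^ al by exact: lt_le_trans xa.
  have J0 : 0 <= J / (rho / 4) by rewrite -lee_fin; apply: le_trans H; have := f0 x; rewrite x0.
  apply: (@le_trans _ _ ((J / (rho / 4)) / x `^ al)); last first.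
    by rewrite /W ler_wpM2l// lef_pV2.
  rewrite -lee_fin; apply: (le_trans (rint_le_integral c d cf _)).
    by move=> t; exact: sqr_ge0.
  by rewrite EFinM -lee_pdivrMr//= ?invr_gt0// invrK muleC.
have Hh p q : p < q -> q - p = rho / 4 ->
    exists2 y, p <= y <= q & forall a b, rho / 2 <= a -> b <= 2 * rho -> rint a b (f ^~ y) <= W.
  move=> pq qp.
  have mf : measurable_fun [set: measurableTypeR R] (fun y : measurableTypeR R =>
      (\int[mu]_(x in `]0%R, +oo[) (x `^ al * normc (G (x +i* y)) ^+ 2)%:E)%E).
    have := @measurable_fun_fubini_tonelli_G _ _ (measurableTypeR R) (measurableTypeR R) R mu
      (EFin \o dens al G) (measurable_dens al hG) _.
    move=> /(_ _)/wrap[p'|]; first by rewrite lee_fin dens_ge0.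
    apply: eq_measurable_fun => y _; rewrite /fubini_G integral_pos_mkcond.
    by apply: eq_integral => x _; rewrite /dens /=; case: ifP => //; rewrite mulr0.
  have f0 y : (0 <= \int[mu]_(x in `]0%R, +oo[) (x `^ al * normc (G (x +i* y)) ^+ 2)%:E)%E.
    by apply: integral_ge0 => x _; rewrite lee_fin mulr_ge0 ?powR_ge0 ?sqr_ge0.
  have [y ypq] := integral_exists_le pq mf f0 IJ.
  rewrite qp => H; exists y => // a b ha hb.
  have cf : rcont a b (f ^~ y).
    apply: rcontX2; apply: pcont_normc; apply: ccont_hline => x /andP[ax _].
    by apply/cdiff_ccont/hG => /=; lra.
  have J0 : 0 <= J / (rho / 4) by rewrite -lee_fin; apply: le_trans H; exact: f0.
  rewrite /W ler_pdivlMr// mulrC -rintZ//.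
  rewrite -lee_fin; apply: le_trans H.
  rewrite rint_EFin; last by apply: rcontM => //; exact: rcont_cst.
  have mx : measurable_fun [set: measurableTypeR R]
     (fun x : measurableTypeR R => (x `^ al * (if 0 < x then f x y else 0))%:E).
    exact: (measurableT_comp (measurable_dens al hG) (pair2_measurable (y : measurableTypeR R))).
  apply: (@le_trans _ _ (\int[mu]_(x in `[a, b]) (x `^ al * (if (0 < x)%R then f x y else 0)%R)%:E)%E).
    apply: ge0_le_integral => //.
    - by move=> x _; rewrite lee_fin mulr_ge0 ?sqr_ge0// (ltW den0).
    - apply/measurable_EFinP; apply: measurable_funM; first exact: measurable_cst.
      have := rcont_integrable cf => /integrableP[/measurable_EFinP //].
    - exact: measurable_funTS.
    move=> x /=; rewrite in_itv /= => /andP[ax xb]; rewrite lee_fin.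
    have -> : 0 < x by lra.
    by rewrite ler_wpM2r ?sqr_ge0//; apply: powR_comparable => //; apply/andP; split; lra.
  rewrite integral_pos_mkcond.
  apply: (@le_trans _ _ (\int[mu]_x (x `^ al * (if (0 < x)%R then f x y else 0)%R)%:E)%E).
    apply: ge0_subset_integral => // x _; rewrite lee_fin mulr_ge0 ?powR_ge0//.
    by case: ifP => // _; exact: sqr_ge0.
  rewrite le_eqVlt; apply/orP; left; apply/eqP; apply: eq_integral => x _.
  by case: ifP => //; rewrite mulr0.
have [a aI Ha] : exists2 x, rho / 2 <= x <= 3 / 4 * rho & forall c d, rint c d (f x) <= W.
  by apply: V; lra.
have [b bI Hb] : exists2 x, 5 / 4 * rho <= x <= 3 / 2 * rho & forall c d, rint c d (f x) <= W.
  by apply: V; lra.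
have [c cI Hc] : exists2 y, eta - rho / 2 <= y <= eta - rho / 4 &
    forall a b, rho / 2 <= a -> b <= 2 * rho -> rint a b (f ^~ y) <= W by apply: Hh; lra.
have [d dI Hd] : exists2 y, eta + rho / 4 <= y <= eta + rho / 2 &
    forall a b, rho / 2 <= a -> b <= 2 * rho -> rint a b (f ^~ y) <= W by apply: Hh; lra.
have {}Hc := Hc a b; have {}Hd := Hd a b; have {}Ha := Ha c d; have {}Hb := Hb c d.
have a2 : rho / 2 <= a by lra.
have b2 : b <= 2 * rho by lra.
have {}Hc := Hc a2 b2; have {}Hd := Hd a2 b2.
have wR : a < Re w < b by rewrite -/rho; lra.
have wI : c < Im w < d by rewrite -/eta; lra.
have hG2 z : rect a b c d z -> cdiff (fun v => G v ^+ 2) z.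
  by move=> /andP[/andP[az _] _]; apply: cdiffX; apply: hG; lra.
have CE := @cauchy_rect _ (fun v => G v ^+ 2) w a b c d wR wI hG2.
have far z : frame a b c d z -> rho / 4 <= normc (z - w).
  move=> zf; have := normc_Re (z - w); have := normc_Im (z - w).
  rewrite ReB ImB -/rho -/eta.
  by case: zf => _ /or4P[] /eqP -> n2 n1;
    [apply: le_trans n1|apply: le_trans n1|apply: le_trans n2|apply: le_trans n2];
    rewrite ler_normr; apply/orP; [right|left|right|left]; lra.
have bnd z : frame a b c d z -> normc (G z ^+ 2 / (z - w)) <= (4 / rho) * normc (G z) ^+ 2.
  move=> zf; rewrite normcM normcX normcV mulrC ler_wpM2r ?sqr_ge0//.
  have -> : 4 / rho = (rho / 4)^-1 by field; rewrite gt_eqF.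
  by rewrite lef_pV2 ?posrE ?divr_gt0// ?far// (lt_le_trans _ (far _ zf))// divr_gt0.
have S : scont (fun z => G z ^+ 2 / (z - w)) a b c d.
  apply: frame_scont; [lra|lra|] => z zf; apply/cdiff_ccont/cdiff_div.
    exact: frame_neq zf.
  by apply: hG2; case: zf.
have ab : a <= b by lra.
have cd : c <= d by lra.
have side_h y : (y == c) || (y == d) -> pcont a b (fun x => G (x +i* y) ^+ 2 / (x +i* y - w)) ->
    rint a b (f ^~ y) <= W ->
    normc (cint a b (fun x => G (x +i* y) ^+ 2 / (x +i* y - w))) <= 4 / rho * W.
  move=> yE py hy.
  have cf : rcont a b (f ^~ y).
    apply: rcontX2; apply: pcont_normc; apply: ccont_hline => x /andP[ax _].
    by apply/cdiff_ccont/hG => /=; lra.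
  apply: (@le_trans _ _ (4 / rho * rint a b (f ^~ y))); last first.
    by rewrite ler_wpM2l// divr_ge0// ltW.
  rewrite -rintZ//; apply: normc_cint => //; first by apply: rcontM => //; exact: rcont_cst.
  move=> x xI; apply: (bnd (x +i* y)); split.
    by rewrite /rect /= xI; case/orP: yE => /eqP ->; rewrite lexx cd.
  by rewrite /= yE !orbT.
have side_v x : (x == a) || (x == b) -> pcont c d (fun y => G (x +i* y) ^+ 2 / (x +i* y - w)) ->
    rint c d (f x) <= W ->
    normc (cint c d (fun y => G (x +i* y) ^+ 2 / (x +i* y - w))) <= 4 / rho * W.
  move=> xE py hy.
  have x0 : 0 < x by case/orP: xE => /eqP ->; lra.
  have cf : rcont c d (f x) by apply: rcontX2; apply: pcont_normc; exact: hol_pcont.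
  apply: (@le_trans _ _ (4 / rho * rint c d (f x))); last first.
    by rewrite ler_wpM2l// divr_ge0// ltW.
  rewrite -rintZ//; apply: normc_cint => //; first by apply: rcontM => //; exact: rcont_cst.
  move=> y yI; apply: (bnd (x +i* y)); split.
    by rewrite /rect /= yI andbT; case/orP: xE => /eqP ->; rewrite lexx ab.
  by rewrite /= orbA xE.
case: S => S1 S2 S3 S4.
have T1 := side_h c _ S1 Hc; have T2 := side_h d _ S2 Hd.
have T3 := side_v a _ S3 Ha; have T4 := side_v b _ S4 Hb.
rewrite !eqxx ?orbT in T1 T2 T3 T4.
have {}T1 := T1 isT; have {}T2 := T2 isT; have {}T3 := T3 isT; have {}T4 := T4 isT.
have W4 : 4 * (4 / rho * W) = 64 / pw al * J / rho `^ (al + 2).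
  rewrite /W powRD; last by rewrite (gt_eqF r0) implybT.
  have -> : rho `^ 2 = rho ^+ 2 by rewrite -(powR_mulrn 2 (ltW r0)).
  by field; rewrite !gt_eqF.
rewrite -ler_pdivlMr ?powR_gt0// -W4.
apply: (@le_trans _ _ (2 * pi * normc (G w) ^+ 2)).
  by rewrite ler_peMl ?sqr_ge0// two_pi_ge1.
rewrite -normcX -normc_2pi -normcM -CE /rect_int.
apply: (le_trans (normcD _ _)); rewrite normcM normc_i mul1r.
have -> : 4 * (4 / rho * W) = (4 / rho * W + 4 / rho * W) + (4 / rho * W + 4 / rho * W) by ring.
by apply: lerD; apply: (le_trans (normcBD _ _)); exact: lerD.
Qed.

End PointEvaluation.

(** * Test functions and their norms *)

Section TestFunctions.
Variable R : realType.
Local Notation C := R[i].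
Local Notation Re := (@complex.Re R).
Local Notation Im := (@complex.Im R).
Local Notation mu := (@lebesgue_measure R).

Lemma rcont_cauchy_kernel (d b p q : R) : 0 < d ->
  rcont p q (fun y => (d ^+ 2 + (b - y) ^+ 2)^-1).
Proof.
move=> d0; apply: rcontV.
  by move=> t _; rewrite gt_eqF// ltr_pwDl ?exprn_gt0 ?sqr_ge0.
apply: rcontD; first exact: rcont_cst.
apply: rcontX2; apply: rcontD; first exact: rcont_cst.
apply: (@eq_rcont _ p q (fun t => -1 * t)); first by move=> t; rewrite mulN1r.
by apply: rcontM; [exact: rcont_cst|exact: rcont_id].
Qed.

(** [poisson_Re] for the constant function 1, on the line Re v = 1. *)
Lemma integral_kernel (d b : R) : 0 < d ->
  (\int[mu]_y ((d ^+ 2 + (b - y) ^+ 2)^-1)%:E <= (pi / d)%:E)%E.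
Proof.
move=> d0; apply: integral_le_rint.
- by move=> p q; exact: rcont_cauchy_kernel.
- by move=> t; rewrite invr_ge0 addr_ge0 ?sqr_ge0.
move=> N N0.
have B1 (v : C) : 1 <= Re v -> normc (1 : C) <= 1 by rewrite normc1.
have z1 : 1 < Re ((1 + d) +i* b) by rewrite /= ltrDl.
have := poisson_Re ltr01 (fun v _ => cdiff_cst 1 v) B1 z1 N0 (fun=> ler01).
rewrite [complex.Re 1]/= [complex.Re (_ +i* _)]/=.
rewrite addrAC subrr add0r mulr1; apply: le_trans.
rewrite le_eqVlt; apply/orP; left; apply/eqP; apply: eq_rint => t _.
by rewrite sqr_sqrtr ?addr_ge0 ?sqr_ge0// div1r addrAC subrr add0r.
Qed.

(** With m = al + 2 this would be the reproducing kernel at c up to a constant; a larger integer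
    exponent serves as well and avoids complex powers. *)
Definition testf (m : nat) (c z : C) : C := ((z + c^*)^-1) ^+ m.

Lemma testf_hol m c : 0 < Re c -> hol (testf m c).
Proof.
move=> c0 z z0; apply: cdiffX; apply: cdiffV.
  by apply/eqP => /(congr1 Re); rewrite ReD ReJ /=; lra.
by apply: cdiffD; [exact: cdiff_id|exact: cdiff_cst].
Qed.

(** One factor |z + conj c|^-2 is kept as a Poisson kernel, with integral pi / (x + Re c); the
    others are bounded by their value at the nearest point of the line. *)
Lemma testf_lineint m c x : 0 < Re c -> 0 < x ->
  (lineint (testf m.+1 c) x <= (pi / (x + Re c) ^+ (2 * m).+1)%:E)%E.
Proof.
move=> c0 x0; set a := Re c in c0 *; set b := Im c.
have xa : 0 < x + a by exact: addr_gt0.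
have nE (y : R) : normc (x +i* y + c^*) ^+ 2 = (x + a) ^+ 2 + (b - y) ^+ 2.
  by rewrite normc_sq ReD ImD ReJ ImJ /= -/a -/b; ring.
apply: (@le_trans _ _ (\int[mu]_y ((((x + a) ^+ (2 * m))^-1)%:E * ((x + a) ^+ 2 + (b - y) ^+ 2)^-1%:E))%E).
  apply: ge0_le_integral => //.
  - by move=> y _; rewrite lee_fin sqr_ge0.
  - by apply/measurable_EFinP; apply: hol_sq_measurable => //; exact: testf_hol.
  - apply/measurable_EFinP; apply: measurable_funM; first exact: measurable_cst.
    by apply: rcont_measurable => p q; exact: rcont_cauchy_kernel.
  move=> y _; rewrite -EFinM lee_fin /testf normcX normcV -exprM mulnC exprM exprVn nE.
  have q0 : 0 < (x + a) ^+ 2 + (b - y) ^+ 2 by rewrite ltr_pwDl ?exprn_gt0 ?sqr_ge0.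
  rewrite exprS mulrC ler_wpM2r// ?invr_ge0 ?(ltW q0)//.
  rewrite exprVn exprM lef_pV2 ?posrE ?exprn_gt0//.
  by rewrite lerXn2r ?nnegrE ?sqr_ge0 ?(ltW q0)// lerDl sqr_ge0.
rewrite ge0_integralZl//; last 3 first.
- by apply/measurable_EFinP; apply: rcont_measurable => p q; exact: rcont_cauchy_kernel.
- by move=> y _; rewrite lee_fin invr_ge0 addr_ge0 ?sqr_ge0.
- by rewrite lee_fin invr_ge0 exprn_ge0// ltW.
apply: (@le_trans _ _ ((((x + a) ^+ (2 * m))^-1)%:E * (pi / (x + a))%:E)%E).
  by rewrite lee_wpmul2l ?integral_kernel// lee_fin invr_ge0 exprn_ge0// ltW.
rewrite -EFinM lee_fin exprS invfM le_eqVlt; apply/orP; left; apply/eqP; ring.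
Qed.

Lemma integral_powR01 (al : R) : -1 < al ->
  (\int[mu]_(x in `]0%R, 1%R]) (x `^ al)%:E <= ((al + 1)^-1)%:E)%E.
Proof.
move=> al1; have al0 : 0 < al + 1 by lra.
pose D (n : nat) : set R := `[n.+1%:R^-1, 1]%classic.
have UD : `]0, 1]%classic = \bigcup_n D n.
  apply/seteqP; split => [x|x [n _]]; rewrite /D /= !in_itv /=; last first.
    by move=> /andP[h ->]; rewrite (lt_le_trans _ h).
  move=> /andP[x0 x1]; have [n _ /(_ n (leqnn n)) /= h] := near_infty_natSinv_lt (PosNum x0).
  by exists n => //; rewrite /D /= in_itv /= x1 andbT ltW.
have cp (x : R) : 0 < x -> {for x, continuous (fun x => x `^ al)}.
  move=> x0; apply/differentiable_continuous/derivable1_diffP.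
  by apply: derivable_powR; rewrite in_itv /= andbT.
rewrite UD.
have cvI : (fun i => \int[mu]_(x in D i) (x `^ al)%:E)%E @ \oo --> (\int[mu]_(x in \bigcup_n D n) (x `^ al)%:E)%E.
  apply: ge0_nondecreasing_set_cvg_integral => //.
  - apply/nondecreasing_seqP => n; rewrite subsetEset; apply: subset_itv; rewrite bnd_simp//.
    by rewrite lef_pV2 ?posrE// ler_nat.
  - by move=> i; exact: measurable_itv.
  - move=> i; apply/measurable_EFinP; apply: measurable_funTS; exact: measurable_powR.
  - by move=> i x _; rewrite lee_fin powR_ge0.
move/cvg_lim : (cvI) => <- //.
apply: lime_le; first by apply/cvg_ex; eexists; exact: cvI.
near=> n; rewrite /D /=.
have n1 : n.+1%:R^-1 < 1 :> R.
  rewrite invf_lt1 ?ltr1n//; near: n; by exists 1%N.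
have n0 : 0 < n.+1%:R^-1 :> R by rewrite invr_gt0.
rewrite (@continuous_FTC2 _ _ (fun x => x `^ (al + 1) / (al + 1)))//.
- rewrite powR1 -EFinB lee_fin div1r gerBl divr_ge0 ?powR_ge0// ltW//.
- apply: continuous_in_subspaceT => x /set_mem /=; rewrite in_itv /= => /andP[nx _].
  by apply: cp; exact: lt_le_trans nx.
- have dF x : 0 < x -> derivable (fun x : R => x `^ (al + 1) / (al + 1)) x 1.
    move=> x0; apply: derivableM; last exact: derivable_cst.
    by apply: derivable_powR; rewrite in_itv /= andbT.
  have cF x : 0 < x -> {for x, continuous (fun x : R => x `^ (al + 1) / (al + 1))}.
    by move=> x0; apply/differentiable_continuous/derivable1_diffP; exact: dF.
  split=> [x| | ].
  + by rewrite in_itv /= => /andP[nx _]; apply: dF; exact: lt_trans nx.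
  + by apply: cvg_at_right_filter; exact: cF.
  + by apply: cvg_at_left_filter; exact: cF.
move=> x; rewrite in_itv /= => /andP[nx _]; have x0 : 0 < x := lt_trans n0 nx.
have xI : x \in `]0, +oo[ by rewrite in_itv /= andbT.
have dp := @derivable_powR R 1 (al + 1) x xI.
have dc : derivable (fun=> (al + 1)^-1 : R) x 1 by exact: derivable_cst.
rewrite derive1E (deriveM dp dc).
rewrite derive_cst scaler0 add0r -derive1E powR_derive1// addrK /GRing.scale /=.
by field; rewrite gt_eqF.
Unshelve. all: by end_near. Qed.

Section TestFunctionNorm.
Variables (al : R) (k : nat).
Hypotheses (al1 : -1 < al) (alk : al <= k%:R).

(** Up to pi, the weight times the bound of [testf_lineint] for the exponent k.+2. *)
Definition wdens (a x : R) : R :=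
  if 0 < x then x `^ al / (x + a) ^+ (2 * k.+1).+1 else 0.

Lemma wdens_ge0 a x : 0 < a -> 0 <= wdens a x.
Proof.
move=> a0; rewrite /wdens; case: ifP => // x0.
by rewrite divr_ge0 ?powR_ge0// exprn_ge0// addr_ge0// ltW.
Qed.

Lemma measurable_wdens a : 0 < a ->
  measurable_fun [set: measurableTypeR R] (wdens a : measurableTypeR R -> measurableTypeR R).
Proof.
move=> a0.
(* With |x| in place of x the denominator is continuous and nonzero on the whole line. *)
rewrite (_ : wdens a = fun x => (if 0 < x then x `^ al else 0) * (`|x| + a) ^- (2 * k.+1).+1); last first.
  apply/funext => x; rewrite /wdens; case: ifP => [x0|_]; last by rewrite mul0r.
  by rewrite gtr0_norm.
apply: measurable_funM.
  apply: measurable_fun_ifT => //.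
  exact: measurable_fun_ltr.
apply: rcont_measurable => p q; apply: rcontV.
  by move=> t _; rewrite expf_neq0// gt_eqF// ltr_wpDl.
elim: (2 * k.+1).+1 => [|n ih]; first exact: rcont_cst.
under eq_fun do rewrite exprS; apply: rcontM => //.
apply: rcontD; last exact: rcont_cst.
by move=> t _; exact: norm_continuous.
Qed.

(** On (0, 1] the density is at most x^al. Beyond 1 it is at most 1 / (1 + x^2), because x^al <= (x
    + 1)^k and k + 2 <= 2 k + 3. *)
Lemma integral_wdens1 : (\int[mu]_x (wdens 1 x)%:E <= ((al + 1)^-1 + pi)%:E)%E.
Proof.
pose g (x : R) : R := if (0 < x) && (x <= 1) then x `^ al else 0.
have mg : measurable_fun [set: measurableTypeR R] (g : measurableTypeR R -> measurableTypeR R).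
  apply: measurable_fun_ifT => //.
  by apply: measurable_and; [exact: measurable_fun_ltr|exact: measurable_fun_ler].
have g0 x : 0 <= g x by rewrite /g; case: ifP => // _; exact: powR_ge0.
have k0 (x : R) : 0 <= (1 ^+ 2 + (0 - x) ^+ 2)^-1 by rewrite invr_ge0 addr_ge0 ?sqr_ge0.
have mk : measurable_fun [set: measurableTypeR R] (fun x : measurableTypeR R => ((1 ^+ 2 + (0 - x) ^+ 2)^-1)%:E).
  by apply/measurable_EFinP; apply: rcont_measurable => p q; apply: rcont_cauchy_kernel.
apply: (@le_trans _ _ (\int[mu]_x ((g x)%:E + ((1 ^+ 2 + (0 - x) ^+ 2)^-1)%R%:E))%E).
  apply: ge0_le_integral => //.
  - by move=> x _; rewrite lee_fin wdens_ge0.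
  - by apply/measurable_EFinP; exact: measurable_wdens.
  - by apply: emeasurable_funD => //; exact/measurable_EFinP.
  move=> x _; rewrite -EFinD lee_fin /wdens /g.
  case: (ltP 0 x) => [x0|_] /=; last by rewrite add0r.
  have x1 : 1 <= x + 1 by rewrite lerDr ltW.
  have p0 : 0 < (x + 1) ^+ (2 * k.+1).+1 by rewrite exprn_gt0//; lra.
  case: ifP => [xl1|/negbT]; last rewrite -ltNge => xg1.
    rewrite -[leLHS]addr0 lerD//.
    by rewrite ler_pdivrMr// ler_peMr ?powR_ge0// exprn_ege1.
  rewrite add0r.
  have xk : x `^ al <= (x + 1) ^+ k.
    apply: (@le_trans _ _ (x `^ k%:R)); first by apply: ler_powR => //; exact: ltW.
    rewrite (powR_mulrn _ (ltW x0)).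
    by rewrite lerXn2r ?nnegrE// ?(ltW x0)// ?lerDl//; lra.
  have e1 : 1 ^+ 2 + (0 - x) ^+ 2 = 1 + x ^+ 2 by rewrite expr1n sub0r sqrrN.
  have q0 : 0 < 1 + x ^+ 2 by rewrite ltr_pwDl// sqr_ge0.
  rewrite e1 ler_pdivrMr// mulrC ler_pdivlMr//.
  apply: (@le_trans _ _ ((x + 1) ^+ k * (x + 1) ^+ 2)).
    apply: ler_pM => //; [exact: powR_ge0|exact: ltW|].
    by rewrite sqrrD expr1n mulr1 addrAC [x ^+ 2 + 1]addrC lerDl mulrn_wge0// ltW.
  by rewrite -exprD ler_weXn2l//; lia.
rewrite ge0_integralD//; last 3 first.
- by move=> x _; rewrite lee_fin.
- exact/measurable_EFinP.
- by move=> x _; rewrite lee_fin.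
rewrite EFinD leeD//; last first.
  by have := @integral_kernel 1 0 ltr01; rewrite divr1.
apply: le_trans (integral_powR01 al1).
rewrite [leRHS]integral_mkcond le_eqVlt; apply/orP; left; apply/eqP; apply: eq_integral => x _.
by rewrite patchE mem_setE in_itv /= /g; case: ifP.
Qed.

(** The substitution x = a u reduces to a = 1. *)
Lemma integral_wdens a : 0 < a ->
  (\int[mu]_x (wdens a x)%:E <= (a `^ (al + 2) / a ^+ (2 * k.+2) * ((al + 1)^-1 + pi))%:E)%E.
Proof.
move=> a0.
have mw := measurable_wdens a0.
have := @integral_scale R a (EFin \o wdens a) a0 _ _.
have mw' : measurable_fun [set: measurableTypeR R] (EFin \o wdens a : measurableTypeR R -> \bar R).
  by apply/measurable_EFinP.
have w0 x : (0 <= (EFin \o wdens a) x)%E by rewrite lee_fin wdens_ge0.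
move=> /(_ mw' w0) E.
have {}E : (\int[mu]_x (wdens a x)%:E = a%:E * \int[mu]_x (wdens a (x * a))%:E)%E.
  by rewrite [X in (_ * X)%E]E muleA -EFinM mulfV ?gt_eqF// mul1e.
rewrite E.
have -> : (\int[mu]_x (wdens a (x * a))%:E =
    \int[mu]_x ((a `^ al / a ^+ (2 * k.+1).+1)%:E * (wdens 1 x)%:E))%E.
  apply: eq_integral => x _; rewrite -EFinM /wdens pmulr_lgt0//; congr (_%:E).
  case: ifP => x0; last by rewrite mulr0.
  rewrite (powRM _ (ltW x0) (ltW a0)) -[X in _ + X]mul1r -mulrDl exprMn invfM; ring.
have c0 : 0 <= a `^ al / a ^+ (2 * k.+1).+1 by rewrite divr_ge0 ?powR_ge0// exprn_ge0// ltW.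
rewrite ge0_integralZl//; last 2 first.
- by apply/measurable_EFinP; exact: measurable_wdens.
- by move=> x _; rewrite lee_fin wdens_ge0.
apply: (@le_trans _ _ (a%:E * ((a `^ al / a ^+ (2 * k.+1).+1)%:E * ((al + 1)^-1 + pi)%:E))%E).
  rewrite lee_wpmul2l ?lee_fin ?(ltW a0)//.
  by rewrite lee_wpmul2l ?lee_fin// integral_wdens1.
rewrite -!EFinM lee_fin le_eqVlt; apply/orP; left; apply/eqP.
rewrite powRD; last by rewrite (gt_eqF a0) implybT.
have -> : a `^ 2 = a ^+ 2 by rewrite -(powR_mulrn 2 (ltW a0)).
have -> : (2 * k.+2 = (2 * k.+1).+1.+1)%N by lia.
have X0 : a ^+ (2 * k.+1).+1 != 0 by rewrite expf_neq0// gt_eqF.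
rewrite [a ^+ (2 * k.+1).+2]exprS.
move: X0; generalize (a ^+ (2 * k.+1).+1) (a `^ al) => X Y X0.
have al10 : al + 1 != 0 by rewrite gt_eqF// -ltrBlDr sub0r.
by field; rewrite X0 al10 gt_eqF.
Qed.

Lemma testf_sqn c : 0 < Re c ->
  (sqn al (testf k.+2 c) <=
    (pi * ((al + 1)^-1 + pi) * (Re c `^ (al + 2) / Re c ^+ (2 * k.+2)))%:E)%E.
Proof.
move=> c0; rewrite (sqn_lineint _ (testf_hol _ c0)) integral_pos_mkcond.
have w0 x : (0 <= (wdens (Re c) x)%:E)%E by rewrite lee_fin wdens_ge0.
have mw : measurable_fun [set: measurableTypeR R] (fun x : measurableTypeR R => (wdens (Re c) x)%:E).
  by apply/measurable_EFinP; exact: measurable_wdens.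
apply: (@le_trans _ _ (\int[mu]_x (pi%:E * (wdens (Re c) x)%:E))%E).
  apply: ge0_le_integral => //.
  - move=> x _; case: ifP => // x0; rewrite mule_ge0 ?lineint_ge0// lee_fin powR_ge0//.
  - rewrite (_ : (fun x => _) = (fun x => (x `^ al)%:E * (if (0 < x)%R then lineint (testf k.+2 c) x else 0)))%E.
      apply: emeasurable_funM; last by apply: measurable_lineint; exact: testf_hol.
      by apply/measurable_EFinP; exact: measurable_powR.
    by apply/funext => x; case: ifP => //; rewrite mule0.
  - exact: measurable_funeM.
  move=> x _; rewrite /wdens; case: ifP => x0; last by rewrite mule0.
  rewrite -EFinM mulrCA EFinM lee_wpmul2l ?lee_fin ?powR_ge0//.
  exact: testf_lineint.
rewrite ge0_integralZl//; last by rewrite lee_fin pi_ge0.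
apply: (@le_trans _ _ (pi%:E * (Re c `^ (al + 2) / Re c ^+ (2 * k.+2) * ((al + 1)^-1 + pi))%:E)%E).
  by rewrite lee_wpmul2l ?lee_fin ?pi_ge0// integral_wdens.
by rewrite -EFinM lee_fin le_eqVlt; apply/orP; left; apply/eqP; ring.
Qed.

End TestFunctionNorm.

End TestFunctions.

(** * Self-maps of the half-plane *)

Section SelfMap.
Variable R : realType.
Local Notation C := R[i].
Local Notation Re := (@complex.Re R).
Local Notation Im := (@complex.Im R).
Local Notation mu := (@lebesgue_measure R).

Lemma powR_add (x r s : R) : 0 < x -> x `^ (r + s) = x `^ r * x `^ s.
Proof. by move=> x0; rewrite powRD// (gt_eqF x0) implybT. Qed.

(** A Julia-Caratheodory argument. psi = Phi - z / lam has nonnegative real part, and [inf_lam]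
    provides one point w where Re psi is tiny against Re w. The Pick inequality between w and z
    propagates this smallness to all large z of the cone. *)
Lemma angular_limit (Phi : C -> C) (lam : R) : 0 < lam -> hol Phi ->
  (forall z, 0 < Re z -> Re z <= lam * Re (Phi z)) ->
  (forall e, 0 < e -> exists2 w, 0 < Re w & Re (Phi w) <= (lam^-1 + e) * Re w) ->
  forall e, 0 < e -> exists B : R, forall z, normc z <= 2 * Re z -> B <= normc z ->
    normc (Phi z - (lam^-1)%:C * z) <= e * normc z.
Proof.
move=> l0 hP le_lam inf_lam e e0.
pose psi z := Phi z - (lam^-1)%:C * z.
have RepsiE z : Re (psi z) = Re (Phi z) - lam^-1 * Re z.
  by rewrite /psi ReB ReM /= mul0r subr0.
have psi_ge0 z : 0 < Re z -> 0 <= Re (psi z).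
  by move=> z0; rewrite RepsiE subr_ge0 mulrC ler_pdivrMr// mulrC le_lam.
(* 64 e1 comes out of the Pick inequality and one more e1 absorbs 2 |g w| + dl. *)
pose e1 := e / 65; have e10 : 0 < e1 by rewrite divr_gt0.
have [w w0 wE] := inf_lam e1 e10.
have psiw : Re (psi w) <= e1 * Re w by rewrite RepsiE lerBlDl -mulrDl.
(* The shift by dl makes 1 / g bounded with nonnegative real part, so that [pick_bound] applies to 1
   / g; psi itself need not be bounded. *)
pose dl := e1 * Re w; have dl0 : 0 < dl by rewrite mulr_gt0.
pose g z := psi z + dl%:C.
have Reg z : 0 < Re z -> dl <= Re (g z).
  by move=> /psi_ge0 h; rewrite /g ReD /= lerDr.
have gN0 z : 0 < Re z -> g z != 0.
  by move=> /Reg h; apply/eqP => g0; move: h; rewrite g0 /= leNgt dl0.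
pose x := Re w / 2; have x0 : 0 < x by rewrite divr_gt0.
have hh v : x <= Re v -> cdiff (fun v => (g v)^-1) v.
  move=> xv; have v0 : 0 < Re v := lt_le_trans x0 xv.
  apply: cdiffV; first exact: gN0.
  apply: cdiffD; last exact: cdiff_cst.
  apply: cdiffB; first exact: hP.
  by apply: cdiffM; [exact: cdiff_cst|exact: cdiff_id].
have hB v : x <= Re v -> normc (g v)^-1 <= dl^-1.
  move=> xv; have v0 : 0 < Re v := lt_le_trans x0 xv.
  rewrite normcV lef_pV2 ?posrE ?normc_gt0 ?gN0//.
  exact: le_trans (Reg _ v0) (Re_le_normc _).
have Rehv z : Re (g z)^-1 = Re (g z) / normc (g z) ^+ 2 by rewrite ReV normc_sq.
have h0 t : 0 <= Re ((g (x +i* t))^-1).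
  by rewrite Rehv divr_ge0 ?sqr_ge0// (le_trans (ltW dl0))// Reg.
(* The three thresholds give Q <= 2 Z, Re z - x >= Z / 4 and 2 |g w| + dl <= e1 Z. *)
exists (Num.max (normc w + 2 * x) (Num.max (4 * x) ((2 * normc (g w) + dl) / e1)) + 1) => z zcone.
set Z := normc z => Zbig.
have [Z1 Z2 Z3] : [/\ normc w + 2 * x < Z, 4 * x < Z & (2 * normc (g w) + dl) / e1 < Z].
  by split; apply: lt_le_trans Zbig; rewrite ltr_pwDr// !le_max lexx ?orbT.
have Z0 : 0 < Z by lra.
have zx : x < Re z by rewrite -/Z in zcone; lra.
have z0 : 0 < Re z by lra.
have xw : x < Re w by rewrite /x; lra.
have nu : 0 < normc (g z) by rewrite normc_gt0 gN0.
have nv : 0 < normc (g w) by rewrite normc_gt0 gN0.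
(* The weight s = |g z| / (8 |g w|) leads to 2 S <= u + 64 e1 Z; together with u <= S + v the term u
   is absorbed on the left. *)
have s0 : 0 < 8^-1 * (normc (g z) / normc (g w)) by rewrite mulr_gt0// divr_gt0.
have := pick_bound x0 hh hB zx xw s0 h0.
rewrite !Rehv.
have -> : Re w - x = Re w / 2 by rewrite /x; field.
have Q0 : 0 < normc (z + w^* - (2 * x)%:C).
  rewrite normc_gt0; apply/eqP => /(congr1 Re); rewrite ReB ReD ReJ /=; lra.
have -> : (g z)^-1 + ((g w)^-1)^* = (g z + (g w)^*) / (g z * (g w)^*).
  have gw' : (g w)^* != 0 by rewrite conjc_eq0 gN0.
  by rewrite conjc_inv; field; rewrite gw' gN0.
rewrite !normcM !normcV !normcM normc_conj.
set u := normc (g z) in nu s0 *; set v := normc (g w) in nv s0 Z3 *.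
set Q := normc (z + _ - _) in Q0 *; set S := normc (g z + _).
have Ru : Re (g z) <= u := Re_le_normc _.
have Rv : Re (g w) <= 2 * e1 * Re w by rewrite /g ReD /= /dl; lra.
have Rz : Z / 4 <= Re z - x by rewrite -/Z in zcone; lra.
have Rz0 : 0 < Re z - x by lra.
have QZ : Q <= 2 * Z.
  have := normcBD (z + w^*) (2 * x)%:C; have := normcD z w^*.
  rewrite normc_conj normc_real (ger0_norm (_ : 0 <= 2 * x)); last by rewrite mulr_ge0// ltW.
  rewrite -/Q -/Z; lra.
have Su : u <= S + v.
  rewrite /u /v -(normc_conj (g w)) -{1}(addrK ((g w)^*) (g z)); exact: normcBD.
move=> H.
have H1 : 2 * S <= Q * (8^-1 * (Re (g z) / (Re z - x)) + 2 * Re (g w) / Re w * 8).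
  have uv : 0 < Q * (u * v) by rewrite !mulr_gt0.
  have e2 : 2 * S = (2 * (S / (u * v) / Q)) * (Q * (u * v)).
    by field; rewrite !gt_eqF.
  have e3 : Q * (8^-1 * (Re (g z) / (Re z - x)) + 2 * Re (g w) / Re w * 8) =
    (8^-1 * (u / v) * (Re (g z) / u ^+ 2 / (Re z - x)) +
      Re (g w) / v ^+ 2 / (Re w / 2) / (8^-1 * (u / v))) * (Q * (u * v)).
    by field; rewrite !gt_eqF.
  by rewrite e2 e3 ler_wpM2r// ltW.
have H2 : Re (g z) / (Re z - x) <= 4 * u / Z.
  rewrite ler_pdivrMr//; apply: (le_trans Ru).
  have {1}-> : u = 4 * u / Z * (Z / 4) by field; rewrite gt_eqF.
  by rewrite ler_wpM2l// divr_ge0// ?mulr_ge0// ltW.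
have H3 : 2 * Re (g w) / Re w * 8 <= 32 * e1.
  by rewrite mulrAC ler_pdivrMr//; lra.
have H4 : 2 * S <= 2 * Z * (8^-1 * (4 * u / Z) + 32 * e1).
  apply: (le_trans H1); apply: ler_pM; [exact: ltW| |exact: QZ|lra].
  rewrite addr_ge0// ?mulr_ge0// ?divr_ge0// ?invr_ge0//; try exact: ltW;
    by rewrite ?mulr_ge0// (le_trans (ltW dl0))// Reg.
have H5 : 2 * S <= u + 64 * e1 * Z.
  apply: (le_trans H4); rewrite le_eqVlt; apply/orP; left; apply/eqP; field.
  by rewrite gt_eqF.
have H6 : 2 * v + dl <= Z * e1 by move: Z3; rewrite ltr_pdivrMr// => /ltW.
have -> : Phi z - (lam^-1)%:C * z = g z - dl%:C by rewrite /g addrK.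
apply: (le_trans (normcBD _ _)); rewrite normc_real gtr0_norm//.
have -> : e = 65 * e1 by rewrite /e1; field.
rewrite -/u; lra.
Qed.

(** * The upper bound for the norm *)

Section NormBound.
Variables (Phi : C -> C) (lam : R).
Hypotheses (l0 : 0 < lam) (hP : hol Phi) (P0 : forall z, 0 < Re z -> 0 < Re (Phi z))
  (le_lam : forall z, 0 < Re z -> Re z <= lam * Re (Phi z)).

Lemma hol_comp F : hol F -> hol (fun z => F (Phi z)).
Proof.
move=> hF z z0; have [l Hl] := hF _ (P0 z0); have [m Hm] := hP z0.
exists (l * m) => e e0.
have m0 := normc_ge0 m; have ln0 := normc_ge0 l.
have [r r0 {}Hl] := Hl (e / 2 / (normc m + 1)) (divr_gt0 (divr_gt0 e0 (ltr0Sn _ 1)) (ltr_wpDl m0 ltr01)).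
have [q q0 Hq] := cdiff_ccont (hP z0) r0.
pose e' := Num.min 1 (e / 2 / (normc l + 1)).
have e'0 : 0 < e' by rewrite lt_min ltr01 !divr_gt0// ltr_wpDl.
have [q' q'0 {}Hm] := Hm e' e'0.
exists (Num.min q q'); first by rewrite lt_min q0.
move=> w; rewrite lt_min => /andP[/Hq /Hl h1 /Hm h2].
have -> : F (Phi w) - F (Phi z) - l * m * (w - z) =
  (F (Phi w) - F (Phi z) - l * (Phi w - Phi z)) + l * (Phi w - Phi z - m * (w - z)) by ring.
apply: (le_trans (normcD _ _)); rewrite normcM.
have h3 : normc (Phi w - Phi z) <= (normc m + 1) * normc (w - z).
  rewrite -(subrK (m * (w - z)) (Phi w - Phi z)); apply: (le_trans (normcD _ _)).
  rewrite normcM addrC mulrDl lerD// (le_trans h2)// ler_wpM2r ?normc_ge0//.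
  by rewrite ge_min lexx.
have M0 : 0 < normc m + 1 by rewrite ltr_wpDl.
have h4 : normc (F (Phi w) - F (Phi z) - l * (Phi w - Phi z)) <= e / 2 * normc (w - z).
  apply: (le_trans h1); have -> : e / 2 * normc (w - z) =
    e / 2 / (normc m + 1) * ((normc m + 1) * normc (w - z)) by field; rewrite gt_eqF.
  by rewrite ler_wpM2l// !divr_ge0// ltW.
have h5 : normc l * normc (Phi w - Phi z - m * (w - z)) <= e / 2 * normc (w - z).
  apply: (@le_trans _ _ ((normc l + 1) * (e / 2 / (normc l + 1) * normc (w - z)))).
    apply: ler_pM; rewrite ?normc_ge0 ?lerDl//.
    by apply: (le_trans h2); rewrite ler_wpM2r ?normc_ge0// ge_min lexx orbT.
  rewrite le_eqVlt; apply/orP; left; apply/eqP; field.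
  by rewrite gt_eqF// ltr_wpDl.
have := lerD h4 h5; rewrite -mulrDl -splitr; exact.
Qed.

(** pi times the Poisson kernel of Re z > x' for the boundary point x' + i t, evaluated at Phi (x +
    i y) when that point lies in this half-plane. *)
Let k (x x' y t : R) : R := Re ((Phi (x +i* y) - x' +i* t)^-1).

Let kE x x' y t : k x x' y t = (Re (Phi (x +i* y)) - x') /
  ((Re (Phi (x +i* y)) - x') ^+ 2 + (Im (Phi (x +i* y)) - t) ^+ 2).
Proof. by rewrite /k ReV ReB ImB. Qed.

Lemma measurable_lineker x x' : 0 < x ->
  measurable_fun [set: measurableTypeR R * measurableTypeR R]
    (fun p => k x x' p.1 p.2 : measurableTypeR R).
Proof.
move=> x0.
have cP a b : pcont a b (fun y => Phi (x +i* y)) by exact: hol_pcont.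
have mA : measurable_fun [set: measurableTypeR R] (fun y : measurableTypeR R => Re (Phi (x +i* y)) - x').
  by apply: rcont_measurable => a b; apply: rcontD; [exact: pcont_Re|exact: rcont_cst].
have mB : measurable_fun [set: measurableTypeR R] (fun y : measurableTypeR R => Im (Phi (x +i* y))).
  by apply: rcont_measurable => a b; exact: pcont_Im.
have mA1 := measurableT_comp mA (@measurable_fst _ _ (measurableTypeR R) (measurableTypeR R)).
have mB1 := measurableT_comp mB (@measurable_fst _ _ (measurableTypeR R) (measurableTypeR R)).
have m2 := @measurable_snd _ _ (measurableTypeR R) (measurableTypeR R).
(* The inverse is written as the power -1, so that [measurable_powR] applies. *)
rewrite (_ : (fun p => _) = (fun p : measurableTypeR R * measurableTypeR R => (Re (Phi (x +i* p.1)) - x') *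
   ((Re (Phi (x +i* p.1)) - x') ^+ 2 + (Im (Phi (x +i* p.1)) - p.2) ^+ 2) `^ (-1))); last first.
  by apply/funext => p; rewrite kE powR_inv1// addr_ge0 ?sqr_ge0.
apply: measurable_funM => //.
have mD : measurable_fun [set: measurableTypeR R * measurableTypeR R]
   (fun p : measurableTypeR R * measurableTypeR R =>
     (Re (Phi (x +i* p.1)) - x') ^+ 2 + (Im (Phi (x +i* p.1)) - p.2) ^+ 2 : measurableTypeR R).
  apply: measurable_funD; apply: measurable_funX => //.
  exact: measurable_funB.
exact: (@measurableT_comp _ _ _ _ _ _ (fun x : measurableTypeR R => x `^ (-1) : measurableTypeR R) _ _ (@measurable_powR R (-1)) mD).
Qed.

(** In y the kernel is the boundary value of the positive function Re h, with h = 1 / (Phi - x' - i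
    t). At the real point x + s one has Re h <= lam / s, since Re Phi >= Re z / lam. Multiplying the
    Poisson formula at x + s by s^2 + N^2 and letting s tend to infinity gives pi lam. *)
Lemma integral_lineker x x' t : 0 < x -> 0 < x' -> lam * x' < x ->
  (\int[mu]_y (k x x' y t)%:E <= (pi * lam)%:E)%E.
Proof.
move=> x0 x'0 xx'.
have gap v : x <= Re v -> (Re v - lam * x') <= lam * (Re (Phi v) - x').
  by move=> xv; rewrite mulrBr lerB// le_lam// (lt_le_trans x0).
have pos v : x <= Re v -> 0 < Re (Phi v) - x'.
  move=> xv; rewrite -(pmulr_rgt0 _ l0); apply: lt_le_trans (gap _ xv).
  by rewrite subr_gt0 (lt_le_trans xx').
pose h v := (Phi v - x' +i* t)^-1.
have nz v : x <= Re v -> Phi v - x' +i* t != 0.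
  move=> /pos h0; apply/eqP => /(congr1 Re); rewrite ReB /= => e0.
  by move: h0; rewrite e0 ltxx.
have hh v : x <= Re v -> cdiff h v.
  move=> xv; apply: cdiffV; first exact: nz.
  by apply: cdiffB; [apply: hP; exact: lt_le_trans xv|exact: cdiff_cst].
have hn v : x <= Re v -> normc (h v) <= (Re (Phi v) - x')^-1.
  move=> xv; rewrite normcV lef_pV2 ?posrE ?normc_gt0 ?nz ?pos//.
  by have := Re_le_normc (Phi v - x' +i* t); rewrite ReB.
have hB v : x <= Re v -> normc (h v) <= lam / (x - lam * x').
  move=> xv; apply: (le_trans (hn _ xv)).
  rewrite -[leLHS]mul1r ler_pdivrMr ?pos// mulrAC ler_pdivlMr ?subr_gt0// mul1r.
  by apply: le_trans (gap _ xv); rewrite lerB.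
have h0 s : 0 <= Re (h (x +i* s)).
  rewrite /h ReV divr_ge0 ?addr_ge0 ?sqr_ge0// ReB /= ltW//.
  exact: pos.
have ck a b : rcont a b (fun y => k x x' y t).
  by apply: pcont_Re; apply: (@ccont_vline _ h) => y _; exact/cdiff_ccont/hh.
apply: integral_le_rint => // N N0.
apply: (@le_add_inv _ _ _ (pi * lam * N ^+ 2) 1) => s s1 s0.
have z1 : x < Re ((x + s) +i* 0) by rewrite /= ltrDl.
have := poisson_Re x0 hh hB z1 N0 h0.
set z := (x + s) +i* 0; have Rz : Re z = x + s by [].
have hz : Re (h z) <= lam / s.
  apply: (le_trans (Re_le_normc _)); apply: (le_trans (hn _ _)); first by rewrite Rz lerDl ltW.
  have xz : x <= Re z by rewrite Rz lerDl ltW.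
  rewrite -[leLHS]mul1r ler_pdivrMr ?pos// mulrAC ler_pdivlMr// mul1r.
  by apply: le_trans (gap _ xz); rewrite Rz; lra.
rewrite Rz addrAC subrr add0r => H.
have H1 : rint (- N) N (fun y => k x x' y t / (s ^+ 2 + N ^+ 2)) <= pi / s * (lam / s).
  apply: (le_trans _ (le_trans H _)); last by rewrite ler_wpM2l// divr_ge0 ?pi_ge0// ltW.
  apply: rint_le.
  - by apply: rcontM => //; exact: rcont_cst.
  - apply: rcontM; first exact: ck.
    exact: rcont_kernel.
  move=> y yN; rewrite ler_wpM2l//; first exact: h0.
  have zy : normc (z - x +i* y) ^+ 2 = s ^+ 2 + y ^+ 2.
    by rewrite normc_sq ReB ImB /=; ring.
  rewrite zy lef_pV2 ?posrE; [|by rewrite ltr_pwDl ?exprn_gt0 ?sqr_ge0|by rewrite ltr_pwDl ?exprn_gt0 ?sqr_ge0].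
  by rewrite lerD2l -[y ^+ 2]real_normK ?num_real// ler_sqr ?nnegrE ?(ltW N0)// ler_norml.
have -> : rint (- N) N (fun y => k x x' y t) =
   (s ^+ 2 + N ^+ 2) * rint (- N) N (fun y => k x x' y t / (s ^+ 2 + N ^+ 2)).
  have D0 : s ^+ 2 + N ^+ 2 != 0 by rewrite gt_eqF// ltr_pwDl ?exprn_gt0 ?sqr_ge0.
  rewrite -rintZ; last by apply: rcontM => //; exact: rcont_cst.
  by apply: eq_rint => y _; field.
apply: (le_trans (ler_wpM2l _ H1)); first by rewrite addr_ge0 ?sqr_ge0.
have -> : (s ^+ 2 + N ^+ 2) * (pi / s * (lam / s)) = pi * lam + pi * lam * N ^+ 2 / s ^+ 2.
  by field; rewrite gt_eqF.
have pl : 0 <= pi * lam * N ^+ 2 by rewrite !mulr_ge0 ?pi_ge0 ?ltW.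
rewrite lerD2l ler_wpM2l// lef_pV2 ?posrE ?exprn_gt0//.
by rewrite expr2 ler_peMl// ltW.
Qed.

(** |F|^2 at Phi (x + i y) is at most its Poisson integral over the line Re = x'; after exchanging
    the integrals, [integral_lineker] bounds the mass received by each boundary point. *)
Lemma lineint_comp al F x x' : -1 < al -> hol F -> (sqn al F < +oo)%E ->
  0 < x -> 0 < x' -> lam * x' < x ->
  (lineint (fun z => F (Phi z)) x <= lam%:E * lineint F x')%E.
Proof.
move=> al1 hF fF x0 x'0 xx'.
have gap y : x' < Re (Phi (x +i* y)).
  have : x <= lam * Re (Phi (x +i* y)) by exact: (le_lam (z := x +i* y)).
  by move=> /(lt_le_trans xx'); rewrite ltr_pM2l.
pose g t := normc (F (x' +i* t)) ^+ 2.
(* [poisson_abs] asks for boundedness: point evaluation bounds F^2 on Re v >= x'. *)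
have [B HB] : exists B, forall v, x' <= Re v -> normc (F v ^+ 2) <= B.
  exists (64 / pw al * fine (sqn al F) / x' `^ (al + 2)) => v xv.
  have v0 : 0 < Re v := lt_le_trans x'0 xv.
  have := point_eval al hF v0.
  rewrite -(@fineK _ (sqn al F)) ?ge0_fin_numE ?sqn_ge0// -EFinM lee_fin => h.
  rewrite normcX ler_pdivlMr ?powR_gt0//; apply: le_trans h.
  rewrite ler_wpM2l ?sqr_ge0//; apply: ge0_ler_powR => //; rewrite ?nnegrE ?ltW//.
  by lra.
have hF2 v : x' <= Re v -> cdiff (fun v => F v ^+ 2) v.
  by move=> xv; apply: cdiffX; apply: hF; exact: lt_le_trans xv.
have mg : measurable_fun [set: measurableTypeR R] (fun t : measurableTypeR R => g t : measurableTypeR R).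
  exact: hol_sq_measurable.
have g0 t : 0 <= g t by exact: sqr_ge0.
have k0 y t : 0 <= k x x' y t.
  by rewrite kE divr_ge0//; [rewrite subr_ge0 ltW|rewrite addr_ge0 ?sqr_ge0].
have mk := measurable_lineker x' x0.
have mgk : measurable_fun [set: measurableTypeR R * measurableTypeR R]
   (fun p : measurableTypeR R * measurableTypeR R => (g p.2 * k x x' p.1 p.2)%:E).
  apply/measurable_EFinP; apply: measurable_funM => //.
  exact: (measurableT_comp mg (@measurable_snd _ _ (measurableTypeR R) (measurableTypeR R))).
have pi0 : 0 < pi :> R := pi_gt0 R.
have step y : ((normc (F (Phi (x +i* y))) ^+ 2)%:E <=
    (pi^-1)%:E * \int[mu]_t (g t * k x x' y t)%R%:E)%E.
  have := poisson_abs x'0 hF2 HB (gap y); set zt := Phi _ => H.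
  have d0 : 0 < Re zt - x' by rewrite subr_gt0; exact: gap.
  have -> : (\int[mu]_t (g t * k x x' y t)%R%:E =
     (Re zt - x')%:E * \int[mu]_t (normc (F (x' +i* t) ^+ 2) / normc (zt - x' +i* t) ^+ 2)%R%:E)%E.
    rewrite -ge0_integralZl ?lee_fin//; last 3 first.
    - apply/measurable_EFinP; apply: rcont_measurable => a b; apply: rcontM.
        by apply: pcont_normc; apply: (@ccont_vline _ (fun v => F v ^+ 2)) => s _; exact/cdiff_ccont/hF2.
      exact: (rcont_kernel (gap y)).
    - by move=> t _; rewrite lee_fin divr_ge0 ?normc_ge0 ?sqr_ge0.
    - by rewrite ?lee_fin (ltW d0).
    apply: eq_integral => t _; rewrite -EFinM; congr (_%:E).
    by rewrite /g kE -/zt normcX (normc_sq (zt - x' +i* t)) ReB ImB /=; ring.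
  rewrite muleA -EFinM.
  have c0 : 0 <= pi^-1 * (Re zt - x') by rewrite mulr_ge0 ?invr_ge0 ?ltW.
  have -> : normc (F zt) ^+ 2 = (pi^-1 * (Re zt - x')) * (pi / (Re zt - x') * normc (F zt ^+ 2)).
    rewrite normcX; move: pi0 d0; generalize (pi : R) (Re zt - x') => P D P0' D0.
    by field; rewrite !gt_eqF.
  by rewrite [leLHS]EFinM lee_wpmul2l ?lee_fin.
apply: (@le_trans _ _ (\int[mu]_y ((pi^-1)%:E * \int[mu]_t (g t * k x x' y t)%R%:E))%E).
  apply: ge0_le_integral => //.
  - by move=> y _; rewrite lee_fin sqr_ge0.
  - apply/measurable_EFinP; exact: (hol_sq_measurable (hol_comp hF) x0).
  - apply: measurable_funeM.
    apply: (measurable_fun_fubini_tonelli_F (fun p : measurableTypeR R * measurableTypeR R => (g p.2 * k x x' p.1 p.2)%:E)) => // p.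
    by rewrite lee_fin mulr_ge0.
rewrite ge0_integralZl//; last 3 first.
- apply: (measurable_fun_fubini_tonelli_F (fun p : measurableTypeR R * measurableTypeR R => (g p.2 * k x x' p.1 p.2)%:E)) => // p.
  by rewrite lee_fin mulr_ge0.
- by move=> y _; apply: integral_ge0 => t _; rewrite lee_fin mulr_ge0.
- by rewrite lee_fin invr_ge0 ltW.
rewrite (fubini_tonelli (fun p : measurableTypeR R * measurableTypeR R => (g p.2 * k x x' p.1 p.2)%:E))//=; last first.
  by move=> p; rewrite lee_fin mulr_ge0.
have mkt t : measurable_fun [set: measurableTypeR R] (fun y : measurableTypeR R => (k x x' y t)%:E).
  apply/measurable_EFinP.
  exact: (measurableT_comp mk (pair2_measurable (t : measurableTypeR R))).
apply: (@le_trans _ _ ((pi^-1)%:E * \int[mu]_t ((pi * lam)%:E * (g t)%:E))%E).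
  rewrite lee_wpmul2l ?lee_fin ?invr_ge0 ?(ltW pi0)//.
  apply: ge0_le_integral => //.
  - by move=> t _; apply: integral_ge0 => y _; rewrite lee_fin mulr_ge0.
  - apply: (measurable_fun_fubini_tonelli_G (fun p : measurableTypeR R * measurableTypeR R => (g p.2 * k x x' p.1 p.2)%:E)) => // p.
    by rewrite lee_fin mulr_ge0.
  - by apply: measurable_funeM; exact/measurable_EFinP.
  move=> t _; under eq_integral do rewrite EFinM.
  rewrite ge0_integralZl//; last 2 first.
  - by move=> y _; rewrite lee_fin.
  - by rewrite lee_fin.
  by rewrite muleC lee_wpmul2r ?lee_fin// integral_lineker.
rewrite ge0_integralZl//; last 3 first.
- exact/measurable_EFinP.
- by move=> t _; rewrite lee_fin.
- by rewrite lee_fin mulr_ge0 ?ltW.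
by rewrite muleA -EFinM mulrA mulVf ?mul1r// gt_eqF.
Qed.

(** The line x is compared with the line th x / lam, where th < 1 secures the strict inequality of
    [lineint_comp]; the change of variable in x produces the power al + 1. *)
Lemma sqn_comp_dilated al F th : -1 < al -> hol F -> (sqn al F < +oo)%E -> 0 < th < 1 ->
  (sqn al (fun z => F (Phi z)) <= (lam * ((th / lam) `^ (al + 1))^-1)%:E * sqn al F)%E.
Proof.
move=> al1 hF fF /andP[th0 th1].
pose k1 := th / lam; have k10 : 0 < k1 by rewrite divr_gt0.
pose f (x : measurableTypeR R) : \bar R := ((x `^ al)%:E * (if (0 < x)%R then lineint F x else 0))%E.
have mf : measurable_fun [set: measurableTypeR R] f.
  apply: emeasurable_funM; last exact: measurable_lineint.
  by apply/measurable_EFinP; exact: measurable_powR.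
have f0 x : (0 <= f x)%E.
  by rewrite mule_ge0 ?lee_fin ?powR_ge0//; case: ifP => // _; exact: lineint_ge0.
have fE : (\int[mu]_x f x = sqn al F)%E.
  rewrite sqn_lineint// integral_pos_mkcond; apply: eq_integral => x _.
  by rewrite /f; case: ifP => //; rewrite mule0.
have fs0 x : (0 <= f (x * k1)%R)%E by exact: f0.
have mfs : measurable_fun [set: measurableTypeR R] (fun x : measurableTypeR R => f (x * k1)%R).
  apply: (measurableT_comp mf).
  by apply: measurable_funM => //; exact: measurable_cst.
have c0 : 0 <= lam * (k1 `^ al)^-1 by rewrite mulr_ge0 ?invr_ge0 ?powR_ge0 ?ltW.
apply: (@le_trans _ _ (\int[mu]_x ((lam * (k1 `^ al)^-1)%:E * f (x * k1)%R))%E).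
  rewrite (sqn_lineint _ (hol_comp hF)) integral_pos_mkcond.
  have hFP := hol_comp hF.
  apply: ge0_le_integral => //.
  - by move=> x _; case: ifP => // x0; rewrite mule_ge0 ?lineint_ge0// lee_fin powR_ge0.
  - rewrite (_ : (fun x => _) = (fun x => (x `^ al)%:E * (if (0 < x)%R then lineint (fun z => F (Phi z)) x else 0)))%E.
      apply: emeasurable_funM; last exact: measurable_lineint.
      by apply/measurable_EFinP; exact: measurable_powR.
    by apply/funext => x; case: ifP => //; rewrite mule0.
  - exact: measurable_funeM.
  move=> x _; case: ifP => x0; last by rewrite mule_ge0 ?lee_fin.
  have xk : 0 < x * k1 by rewrite mulr_gt0.
  rewrite /f xk (powRM _ (ltW x0) (ltW k10)) muleA -EFinM.
  have -> : lam * (k1 `^ al)^-1 * (x `^ al * k1 `^ al) = x `^ al * lam.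
    by field; rewrite gt_eqF// powR_gt0.
  rewrite EFinM -muleA lee_wpmul2l ?lee_fin ?powR_ge0//.
  apply: (lineint_comp al1) => //.
  have -> : lam * (x * k1) = th * x by rewrite /k1; field; rewrite gt_eqF.
  by rewrite gtr_pMl.
rewrite ge0_integralZl ?lee_fin// (integral_scale k10 mf f0) fE muleA -EFinM.
rewrite (powR_add al 1 k10) (powRr1 (ltW k10)).
by rewrite -mulrA -invfM [k1 `^ al * _]mulrC.
Qed.

Lemma sqn_comp al F : -1 < al -> hol F -> (sqn al F < +oo)%E ->
  (sqn al (fun z => F (Phi z)) <= (lam `^ (al + 2))%:E * sqn al F)%E.
Proof.
move=> al1 hF fF.
have al0 : 0 < al + 1 by move: al1; lra.
have H th (hth : 0 < th < 1) := sqn_comp_dilated al1 hF fF hth.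
have fFn : sqn al F \is a fin_num by rewrite ge0_fin_numE ?sqn_ge0.
have fin2 : (sqn al (fun z => F (Phi z)) < +oo)%E.
  apply: le_lt_trans (H (1 / 2) _) _; first by apply/andP; split; lra.
  by rewrite -(fineK fFn) -EFinM ltey.
have fPn : sqn al (fun z => F (Phi z)) \is a fin_num by rewrite ge0_fin_numE ?sqn_ge0.
rewrite -(fineK fFn) -(fineK fPn) -EFinM lee_fin.
set A := fine _; set B := fine (sqn al F).
have B0 : 0 <= B by rewrite fine_ge0 ?sqn_ge0.
have A0 : 0 <= A by rewrite fine_ge0 ?sqn_ge0.
apply/ler_addgt0Pr => e e0.
(* th is chosen so that th^(al + 1) = r. The dilated bound then reads A^2 / (A + e) <= lam^(al + 2)
   B, which implies A <= lam^(al + 2) B + e. *)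
pose r := A / (A + e); have Ae : 0 < A + e by rewrite ltr_wpDl.
have [A00|A1] := eqVneq A 0.
  by rewrite A00 addr_ge0 ?mulr_ge0 ?powR_ge0 ?(ltW e0).
have A2 : 0 < A by rewrite lt_def A1.
have r0 : 0 < r by rewrite divr_gt0.
have r1 : r < 1 by rewrite ltr_pdivrMr// mul1r ltrDl.
pose th := r `^ (al + 1)^-1.
have th0 : 0 < th by rewrite powR_gt0.
have th1 : th < 1.
  have <- : 1 `^ (al + 1)^-1 = 1 :> R by rewrite powR1.
  by apply: gt0_ltr_powR; rewrite ?nnegrE ?invr_gt0 ?(ltW r0).
have := H th; rewrite th0 th1 => /(_ isT).
rewrite -(fineK fFn) -(fineK fPn) -EFinM lee_fin -/A -/B.
have lE : lam * ((th / lam) `^ (al + 1))^-1 = lam `^ (al + 2) / r.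
  have e1 : (th / lam) `^ (al + 1) = r / lam `^ (al + 1).
    rewrite (powRM _ (ltW th0)) ?invr_ge0 ?(ltW l0)//.
    rewrite /th -powRrM mulVf ?gt_eqF// (powRr1 (ltW r0)); congr (_ * _).
    by rewrite -powR_inv1 ?(ltW l0)// -powRrM mulN1r powRN.
  have e2 : lam `^ (al + 2) = lam `^ (al + 1) * lam.
    rewrite -[X in _ * X](powRr1 (ltW l0)) -powR_add//.
    by congr (_ `^ _); ring.
  rewrite e1 e2; field.
  by rewrite !gt_eqF// powR_gt0.
rewrite lE => h.
have : A * r <= lam `^ (al + 2) * B.
  by move: h; rewrite mulrAC ler_pdivlMr.
rewrite /r mulrA ler_pdivrMr// => h2.
have [h3|h3] := leP A (lam `^ (al + 2) * B); first by rewrite (le_trans h3)// lerDl ltW.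
by rewrite -(ler_pM2l A2); nra.
Qed.

End NormBound.

End SelfMap.

(** * Finiteness of lambda *)

Section AngularDerivative.
Variable R : realType.
Local Notation C := R[i].
Local Notation Re := (@complex.Re R).

Lemma testf_at m (c : C) : 0 < Re c -> normc (testf m c c) ^+ 2 = (2 * Re c) ^- (2 * m).
Proof.
move=> c0; rewrite /testf normcX normcV.
have -> : c + c^* = (2 * Re c)%:C by apply: complexP; rewrite !ReImE /=; ring.
rewrite normc_real gtr0_norm ?mulr_gt0// exprVn exprVn; congr (_^-1).
by rewrite -exprM mulnC.
Qed.

Section Bounded.
Variables (Phi : C -> C) (al M : R).
Hypotheses (al1 : -1 < al) (hP : hol Phi) (P0 : forall z, 0 < Re z -> 0 < Re (Phi z))
  (bM : forall F, hol F -> (sqn al F < +oo)%E ->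
    (sqn al (fun z => F (Phi z)) <= M%:E * sqn al F)%E).

(** The test function is centred at Phi w and its composite is evaluated at w. With a = Re (Phi w),
    the factor a^(-2 m) occurs in both the value and the norm; it cancels, leaving a bound on (Re w
    / a)^(al + 2). *)
Lemma Re_le_Phi : exists2 K, 0 < K & forall w, 0 < Re w -> Re w <= K * Re (Phi w).
Proof.
have al2 : 0 < al + 2 by move: al1; lra.
pose k := Num.truncn `|al|.
have alk : al <= k.+1%:R by rewrite (le_trans (ler_norm _))// ltW// truncnS_gt.
have pw0 : 0 < pw al := expR_gt0 _.
pose m := k.+3.
pose C1 := pi * ((al + 1)^-1 + pi).
(* The sign of M is unknown, hence [|M|]; the summand 1 makes K1 positive. *)
pose K1 := 64 / pw al * (`|M| * C1) * 2 ^+ (2 * m) + 1.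
have al0 : 0 < al + 1 by move: al1; lra.
have C10 : 0 <= C1 by rewrite mulr_ge0 ?pi_ge0// addr_ge0 ?pi_ge0// invr_ge0 ltW.
have K10 : 0 < K1.
  rewrite ltr_wpDl// mulr_ge0 ?exprn_ge0// mulr_ge0 ?(mulr_ge0 _ C10)//.
  by rewrite divr_ge0 ?(ltW pw0).
exists (K1 `^ (al + 2)^-1); first by rewrite powR_gt0.
move=> w w0; have a0 := P0 w0; set a := Re (Phi w) in a0 *.
have hf : hol (testf m (Phi w)) by exact: testf_hol.
have nf := testf_sqn al1 alk a0.
have fin : (sqn al (testf m (Phi w)) < +oo)%E by apply: le_lt_trans nf _; rewrite ltey.
have hfP := hol_comp hP P0 hf.
have := point_eval al hfP w0.
rewrite testf_at// => h.
have : (2 * a) ^- (2 * m) * Re w `^ (al + 2) <= 64 / pw al * (`|M| * (C1 * (a `^ (al + 2) / a ^+ (2 * m)))).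
  rewrite -lee_fin; apply: (le_trans h); rewrite [leRHS]EFinM lee_wpmul2l ?lee_fin ?divr_ge0 ?(ltW pw0)//.
  apply: (le_trans (bM hf fin)); rewrite [leRHS]EFinM.
  apply: (@le_trans _ _ (`|M|%:E * sqn al (testf m (Phi w)))%E).
    by rewrite lee_wpmul2r ?sqn_ge0// lee_fin ler_norm.
  by rewrite lee_wpmul2l ?lee_fin.
rewrite exprMn invfM => H.
have am0 : 0 < a ^+ (2 * m) by rewrite exprn_gt0.
have H2 : Re w `^ (al + 2) <= K1 * a `^ (al + 2).
  have t0 : 0 < 2 ^+ (2 * m) * a ^+ (2 * m) by rewrite mulr_gt0// exprn_gt0.
  have := ler_wpM2l (ltW t0) H.
  have -> : 2 ^+ (2 * m) * a ^+ (2 * m) * (2 ^- (2 * m) / a ^+ (2 * m) * Re w `^ (al + 2)) = Re w `^ (al + 2).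
    by field; rewrite !expf_neq0 ?gt_eqF.
  have -> : 2 ^+ (2 * m) * a ^+ (2 * m) * (64 / pw al * (`|M| * (C1 * (a `^ (al + 2) / a ^+ (2 * m))))) = (K1 - 1) * a `^ (al + 2).
    by rewrite /K1 addrK; field; rewrite !gt_eqF.
  by move=> /le_trans; apply; rewrite ler_wpM2r ?powR_ge0// gerBl.
rewrite leNgt; apply/negP => h3.
have Ka0 : 0 < K1 `^ (al + 2)^-1 * a by rewrite mulr_gt0 ?powR_gt0.
have := gt0_ltr_powR al2 _ _ h3; rewrite !nnegrE => /(_ (ltW Ka0) (ltW w0)).
rewrite powRM ?powR_ge0 ?(ltW a0)// -powRrM mulVf ?gt_eqF// (powRr1 (ltW K10)).
by rewrite ltNge H2.
Qed.

(** lam is the supremum of Re z / Re (Phi z); its approximation from below is stated for 1 / lam,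
    the form that [angular_limit] takes. *)
Lemma lam_exists : exists lam, [/\ 0 < lam, forall z, 0 < Re z -> Re z <= lam * Re (Phi z) &
  forall e, 0 < e -> exists2 w, 0 < Re w & Re (Phi w) <= (lam^-1 + e) * Re w].
Proof.
have [K K0 HK] := Re_le_Phi.
pose A : set R := [set Re z / Re (Phi z) | z in [set z | 0 < Re z]].
have A1 : A (Re 1 / Re (Phi 1)) by exists 1 => //=; exact: ltr01.
have ubA : ubound A K by move=> _ [z /= z0 <-]; rewrite ler_pdivrMr ?HK ?P0.
have hA : has_sup A by split; [exists (Re 1 / Re (Phi 1))|exists K].
have one : 0 < Re 1 by exact: ltr01.
pose lam := sup A.
have lam0 : 0 < lam.
  by apply: lt_le_trans (ub_le_sup hA.2 A1); rewrite divr_gt0 ?P0.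
exists lam; split => // [z z0|e e0].
  by rewrite -ler_pdivrMr ?P0//; apply: ub_le_sup; [exact: hA.2|exists z].
have le0 : 0 < lam^-1 + e by rewrite addr_gt0 ?invr_gt0.
have : (lam^-1 + e)^-1 < lam by rewrite -[ltRHS]invrK ltf_pV2 ?posrE ?invr_gt0// ltrDl.
move=> /(sup_gt hA.1)[_ [w w0 <-] h].
exists w => //; have := ltW h; rewrite ler_pdivlMr ?P0//.
by rewrite mulrC ler_pdivrMr// mulrC.
Qed.

End Bounded.

End AngularDerivative.

(** * The norm is in the spectrum *)

Section ApproximateEigenvalue.
Variable R : realType.
Local Notation C := R[i].
Local Notation Re := (@complex.Re R).

Lemma eventually_forall (P : nat -> R -> Prop) n :
  (forall i, exists S, forall s, S <= s -> P i s) ->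
  exists S, forall s, S <= s -> forall i, (i < n)%N -> P i s.
Proof.
move=> H; elim: n => [|n [S HS]]; first by exists 0.
have [S' HS'] := H n; exists (Num.max S S') => s; rewrite ge_max => /andP[s1 s2] i.
by rewrite ltnS leq_eqVlt => /orP[/eqP ->|/(HS s s1 i)//]; exact: HS'.
Qed.

Section Iterates.
Variables (Phi : C -> C) (al lam : R).
Hypotheses (al1 : -1 < al) (l0 : 0 < lam) (hP : hol Phi)
  (P0 : forall z, 0 < Re z -> 0 < Re (Phi z))
  (le_lam : forall z, 0 < Re z -> Re z <= lam * Re (Phi z))
  (inf_lam : forall e, 0 < e -> exists2 w, 0 < Re w & Re (Phi w) <= (lam^-1 + e) * Re w).

Lemma iter_Re_gt0 k z : 0 < Re z -> 0 < Re (iter k Phi z).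
Proof. by move=> z0; elim: k => //= k; exact: P0. Qed.

Lemma hol_iter k F : hol F -> hol (fun z => F (iter k Phi z)).
Proof.
elim: k F => [//|k ih] F hF; exact: (ih _ (hol_comp hP P0 hF)).
Qed.

(** The induction keeps the iterates of a large real s inside the cone of [angular_limit], so each
    further step divides by lam up to a small relative error. *)
Lemma iter_asymptotic i e : 0 < e -> exists S, forall s, S <= s ->
  normc (iter i Phi s%:C - (lam ^- i * s)%:C) <= e * s.
Proof.
elim: i e => [|i ih] e e0.
  exists 0 => s s0; rewrite expr0 invr1 mul1r subrr normc0 mulr_ge0// ltW//.
pose l := lam ^- i; have ll0 : 0 < l by rewrite invr_gt0 exprn_gt0.
(* l / 4 places z in the cone |z| <= 2 Re z and keeps |z| comparable with l s; lam e / 2 makes the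
   inherited error, divided by lam, at most e s / 2. *)
pose e1 := Num.min (l / 4) (lam * e / 2).
have e10 : 0 < e1 by rewrite lt_min !divr_gt0 ?mulr_gt0.
have [S HS] := ih e1 e10.
have e20 : 0 < e / (4 * l) by rewrite divr_gt0 ?mulr_gt0.
have [B HB] := angular_limit l0 hP le_lam inf_lam e20.
exists (Num.max 1 (Num.max S (2 * B / l))) => s; rewrite !ge_max => /and3P[s1 sS sB].
have s0 : 0 < s by lra.
have := HS s sS; rewrite -/l; set z := iter i Phi s%:C => h.
have h1 : e1 <= l / 4 by rewrite ge_min lexx.
have h2 : e1 <= lam * e / 2 by rewrite ge_min lexx orbT.
have ls0 : 0 < l * s by rewrite mulr_gt0.
have hz : normc (z - (l * s)%:C) <= l * s / 4.
  by apply: (le_trans h); rewrite mulrAC ler_wpM2r// ltW.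
have hR : `|Re z - l * s| <= l * s / 4.
  by apply: le_trans hz; have := normc_Re (z - (l * s)%:C); rewrite ReB.
have zR : 3 / 4 * (l * s) <= Re z by move: hR; rewrite ler_norml; lra.
have zN : normc z <= 5 / 4 * (l * s).
  rewrite -(subrK ((l * s)%:C) z); apply: (le_trans (normcD _ _)).
  rewrite normc_real (gtr0_norm ls0); lra.
have zN2 : 3 / 4 * (l * s) <= normc z by apply: le_trans zR (Re_le_normc _).
have Bz : B <= normc z.
  by move: sB; rewrite ler_pdivrMr//; lra.
have zc : normc z <= 2 * Re z by lra.
have hPz := HB z zc Bz.
rewrite iterS -/z.
have -> : Phi z - (lam ^- i.+1 * s)%:C =
   (Phi z - (lam^-1)%:C * z) + (lam^-1)%:C * (z - (l * s)%:C).
  rewrite mulrBr -rmorphM mulrA /l -invfM -exprS; ring.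
apply: (le_trans (normcD _ _)); rewrite normcM normc_real gtr0_norm ?invr_gt0//.
have h3 : e / (4 * l) * normc z <= 5 / 16 * e * s.
  apply: (@le_trans _ _ (e / (4 * l) * (5 / 4 * (l * s)))).
    by rewrite ler_wpM2l// ltW.
  by rewrite le_eqVlt; apply/orP; left; apply/eqP; field; rewrite gt_eqF.
have h4 : lam^-1 * normc (z - (l * s)%:C) <= e / 2 * s.
  rewrite mulrC ler_pdivrMr//; apply: (le_trans h).
  have -> : e / 2 * s * lam = lam * e / 2 * s by ring.
  by rewrite ler_wpM2r// ltW.
have es : 0 < e * s by rewrite mulr_gt0.
lra.
Qed.

(* The common value of the norm and the spectral radius. *)
Definition cnorm : R := lam `^ ((al + 2) / 2).

Lemma cnorm_gt0 : 0 < cnorm. Proof. exact: powR_gt0. Qed.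

Lemma cnorm_sq : cnorm ^+ 2 = lam `^ (al + 2).
Proof.
by rewrite expr2 /cnorm -(powR_add _ _ l0); congr (_ `^ _); field.
Qed.

(** Moving the centre of a test function from s to lam^-N s scales its squared norm, apart from the
    powers of degree 2 m, exactly as V^N scales squared values. This makes the bound in
    [no_lower_bound] uniform in N. *)
Lemma powR_lamXn N : (lam ^- N) `^ (al + 2) = cnorm ^- (2 * N).
Proof.
rewrite exprM cnorm_sq; elim: N => [|N ih]; first by rewrite !expr0 invr1 powR1.
rewrite !exprSr !invfM powRM ?invr_ge0 ?exprn_ge0 ?(ltW l0)// ih.
congr (_ * _).
by rewrite -(powR_inv1 (ltW l0)) -powRrM mulN1r powRN.
Qed.

Definition Vop (F : C -> C) z := (cnorm^-1)%:C * F (Phi z).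

Lemma hol_V F : hol F -> hol (Vop F).
Proof. by move=> hF; apply: holZ; exact: hol_comp. Qed.

Lemma sqn_V F : hol F -> (sqn al F < +oo)%E -> (sqn al (Vop F) <= sqn al F)%E.
Proof.
move=> hF fF; rewrite /Vop sqnZ; last exact: hol_comp.
rewrite normc_real gtr0_norm ?invr_gt0 ?cnorm_gt0//.
have := sqn_comp l0 hP P0 le_lam al1 hF fF.
rewrite -cnorm_sq => h.
apply: (@le_trans _ _ ((cnorm^-1 ^+ 2)%:E * ((cnorm ^+ 2)%:E * sqn al F))%E).
  by rewrite lee_wpmul2l// lee_fin sqr_ge0.
rewrite muleA -EFinM -exprMn mulVf ?gt_eqF ?cnorm_gt0// expr1n mul1e//.
Qed.

Lemma iterV k F z : iter k Vop F z = (cnorm ^- k)%:C * F (iter k Phi z).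
Proof.
elim: k z => [|k ih] z; first by rewrite expr0 invr1 mul1r.
by rewrite iterS /Vop ih iterSr mulrA -rmorphM -invfM -exprS.
Qed.

Lemma hol_iterV k F : hol F -> hol (iter k Vop F).
Proof. by move=> hF; elim: k => //= k; exact: hol_V. Qed.

Lemma sqn_iterV k F : hol F -> (sqn al F < +oo)%E -> (sqn al (iter k Vop F) <= sqn al F)%E.
Proof.
move=> hF fF; elim: k => [|k ih]; first exact: lexx.
rewrite iterS; apply: le_trans (sqn_V (hol_iterV k hF) _) (ih).
exact: le_lt_trans ih fF.
Qed.

Definition psum n F z : C := \sum_(k < n) iter k Vop F z.

Lemma V_sum n (G : nat -> C -> C) z : Vop (fun z => \sum_(k < n) G k z) z = \sum_(k < n) Vop (G k) z.
Proof. by rewrite /Vop mulr_sumr. Qed.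

Lemma psum_telescope n F z : psum n F z - Vop (psum n F) z = F z - iter n Vop F z.
Proof.
rewrite /psum (V_sum n (fun k => iter k Vop F)).
elim: n => [|n ih]; first by rewrite !big_ord0 /= !subrr.
by rewrite !big_ord_recr /= opprD addrACA ih addrA subrK.
Qed.

Lemma psumS n F : psum n.+1 F = fun z => 1 * psum n F z + iter n Vop F z.
Proof. by apply/funext => z; rewrite /psum big_ord_recr /= mul1r. Qed.

Lemma hol_psum n F : hol F -> hol (psum n F).
Proof.
move=> hF; elim: n => [z _|n ih].
  rewrite (_ : psum 0 F = fun=> 0); first exact: cdiff_cst.
  by apply/funext => v; rewrite /psum big_ord0.
by rewrite psumS; apply: hol_lin => //; exact: hol_iterV.
Qed.

Lemma sqn_psum_fin n F : hol F -> (sqn al F < +oo)%E -> (sqn al (psum n F) < +oo)%E.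
Proof.
move=> hF fF; elim: n => [|n ih].
  rewrite (_ : psum 0 F = fun z => 0 * F z).
    by rewrite sqnZ// normc0 expr0n mul0e ltry.
  by apply/funext => v; rewrite /psum big_ord0 mul0r.
rewrite psumS; apply: (le_lt_trans (sqn_lin _ _ (hol_psum n hF) (hol_iterV n hF))).
have fV : (sqn al (iter n Vop F) < +oo)%E := le_lt_trans (sqn_iterV n hF fF) fF.
rewrite -(@fineK _ (sqn al (psum n F))) ?ge0_fin_numE ?sqn_ge0//.
rewrite -(@fineK _ (sqn al (iter n Vop F))) ?ge0_fin_numE ?sqn_ge0//.
by rewrite -!EFinM -EFinD ltry.
Qed.

(* If [1 - Vop] were bounded below, the Fejer-type sums [(sum_(k < n) Vop^k)^2 f]
   would be bounded independently of [n]. *)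
Lemma sqn_psum2 (K : R) n F : 0 <= K -> hol F -> (sqn al F < +oo)%E ->
  (forall G, hol G -> (sqn al G < +oo)%E ->
     (sqn al G <= K%:E * sqn al (fun z => G z - Vop G z)%R)%E) ->
  (sqn al (psum n (psum n F)) <= ((4 * K) ^+ 2)%R%:E * sqn al F)%E.
Proof.
move=> K0 hF fF H.
have step G : hol G -> (sqn al G < +oo)%E -> (sqn al (psum n G) <= (4 * K)%:E * sqn al G)%E.
  move=> hG fG; apply: (le_trans (H _ (hol_psum n hG) (sqn_psum_fin n hG fG))).
  (* 4 = 2 + 2: (1 - V) applied to [psum n G] is G - V^n G, and both parts are controlled by G
     through [sqn_lin]. *)
  have -> : (4 * K)%:E = (K%:E * 4%:E)%E by rewrite -EFinM mulrC.
  rewrite -muleA lee_wpmul2l ?lee_fin//.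
  rewrite (_ : (fun z => _) = fun z => -1 * iter n Vop G z + G z)%R; last first.
    by apply/funext => z; rewrite psum_telescope mulN1r addrC.
  apply: (le_trans (sqn_lin _ _ (hol_iterV n hG) hG)).
  rewrite normc_opp normc1 expr1n mulr1.
  have -> : 4%:E = (2%:E + 2%:E)%E :> \bar R by rewrite -EFinD; congr (_%:E); ring.
  rewrite ge0_muleDl ?lee_fin//; apply: leeD; last exact: lexx.
  by apply: lee_wpmul2l; [rewrite lee_fin|exact: sqn_iterV].
apply: (le_trans (step _ (hol_psum n hF) (sqn_psum_fin n hF fF))).
have k4 : 0 <= 4 * K by rewrite mulr_ge0.
rewrite [X in (_ <= X * _)%E](_ : _ = (4 * K)%:E * (4 * K)%:E)%E; last by rewrite -EFinM expr2.
rewrite -muleA lee_wpmul2l ?lee_fin//.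
exact: step.
Qed.

Lemma psum2E n F z : psum n (psum n F) z =
  \sum_(j < n) \sum_(k < n) (cnorm ^- (j + k))%:C * F (iter (j + k) Phi z).
Proof.
rewrite {1}/psum; apply: eq_bigr => j _; rewrite iterV /psum mulr_sumr.
apply: eq_bigr => k _; rewrite iterV mulrA -rmorphM -invfM -exprD.
by rewrite -iterD [(k + j)%N]addnC.
Qed.

(** For n = N + 1 the test function f is centred at c s = lam^-N s, near the N-th iterate of s.
    Among the terms V^(j + k) f evaluated at s, those with j + k = N number n and are comparable
    with the norm of f, while the others have positive real part. Point evaluation at s and
    [sqn_psum2] then bound n^2 by a constant free of N. *)
Lemma no_lower_bound (K : R) : 0 <= K ->
  (forall G, hol G -> (sqn al G < +oo)%E ->
     (sqn al G <= K%:E * sqn al (fun z => G z - Vop G z)%R)%E) -> False.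
Proof.
move=> K0 HK.
pose k := Num.truncn `|al|.
have alk : al <= k.+1%:R by rewrite (le_trans (ler_norm _))// ltW// truncnS_gt.
pose m := k.+3.
have pw0 : 0 < pw al := expR_gt0 _.
have al0 : 0 < al + 1 by move: al1; lra.
pose C1 := pi * ((al + 1)^-1 + pi).
have C10 : 0 <= C1 by rewrite mulr_ge0 ?pi_ge0// addr_ge0 ?pi_ge0// invr_ge0 ltW.
pose C2 := 64 / pw al * ((4 * K) ^+ 2 * C1) * (2 ^+ (2 * m) * 4).
(* Taking N as the integer part of C2 gives a contradiction. *)
suff H N : N.+1%:R ^+ 2 <= C2.
  have := H (Num.truncn C2); have := truncnS_gt C2; set x := _.+1%:R.
  have x1 : 1 <= x by rewrite /x ler1n.
  move=> h1 h2; have h3 := le_lt_trans h2 h1.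
  by have := ler_peMl (le_trans ler01 x1) x1; rewrite -expr2 leNgt h3.
pose n := N.+1.
(* The limit, as s grows, of the i-th iterate of s divided by c s; it equals 1 for i = N. *)
pose rho i := lam ^- i / lam ^- N.
have rho0 i : 0 < rho i by rewrite divr_gt0 ?invr_gt0 ?exprn_gt0.
(* The test function in units of its centre: f z = (2 c s)^-m G (z / c s), and G is positive on the
   positive axis. *)
pose G (v : C) : C := (2 * (1 + v)^-1) ^+ m.
have hG : hol G.
  move=> v v0; apply: cdiffX; apply: cdiffM; first exact: cdiff_cst.
  apply: cdiffV; last by apply: cdiffD; [exact: cdiff_cst|exact: cdiff_id].
  by apply/eqP => /(congr1 Re); rewrite ReD /=; lra.
have GE i : G (rho i)%:C = ((2 / (1 + rho i)) ^+ m)%:C.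
  rewrite /G -[1]/(1%:C) -rmorphD -fmorphV rmorphXn; congr (_ ^+ _).
  by rewrite rmorphM /= rmorph_nat.
pose g i := (2 / (1 + rho i)) ^+ m.
have g0 i : 0 < g i by rewrite exprn_gt0// divr_gt0// addr_gt0.
have gN : g N = 1 by rewrite /g /rho divff ?expr1n ?invr_eq0 ?expf_neq0 ?gt_eqF//
   -[1 + 1]/(2 : R) divff ?expr1n.
pose z i s := iter i Phi s%:C.
pose c s : R := lam ^- N * s.
(* By continuity of G at rho i, the real part keeps half of the positive limit value g i. *)
have ev i : exists S, forall s, S <= s -> g i / 2 <= Re (G ((c s)^-1%:C * z i s)).
  have g20 : 0 < g i / 2 by rewrite divr_gt0.
  have [r r0 Hr] := cdiff_ccont (hG _ (rho0 i : 0 < Re (rho i)%:C)) g20.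
  have e0 : 0 < r / 2 * lam ^- N by rewrite !mulr_gt0 ?invr_gt0 ?exprn_gt0.
  have [S HS] := iter_asymptotic i e0.
  exists (Num.max 1 S) => s; rewrite ge_max => /andP[s1 /HS h].
  have s0 : 0 < s by lra.
  have c0 : 0 < c s by rewrite mulr_gt0 ?invr_gt0 ?exprn_gt0.
  have : normc ((c s)^-1%:C * z i s - (rho i)%:C) < r.
    have -> : (c s)^-1%:C * z i s - (rho i)%:C = (c s)^-1%:C * (z i s - (lam ^- i * s)%:C).
      rewrite mulrBr -rmorphM; congr (_ - _%:C).
      rewrite /c /rho; field.
      by rewrite !expf_neq0 ?gt_eqF.
    rewrite normcM normc_real gtr0_norm ?invr_gt0// mulrC ltr_pdivrMr//.
    apply: (le_lt_trans h); rewrite (_ : _ * s = r / 2 * c s); last by rewrite /c; ring.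
    by rewrite ltr_pM2r// ltr_pdivrMr// ltr_pMr// ltr1n.
  move=> /Hr; rewrite GE -/(g i) => /ltW h2.
  have := le_trans (normc_Re _) h2; rewrite ReB /= ler_distl => /andP[h3 _].
  by apply: le_trans h3; lra.
have [S HS] := eventually_forall (2 * n) ev.
pose s := Num.max 1 S.
have s0 : 0 < s by rewrite lt_max ltr01.
have {}HS : forall i, (i < 2 * n)%N -> g i / 2 <= Re (G ((c s)^-1%:C * z i s)).
  by apply: HS; rewrite le_max lexx orbT.
have c0 : 0 < c s by rewrite mulr_gt0 ?invr_gt0 ?exprn_gt0.
have cn0 : 0 < cnorm := cnorm_gt0.
pose f := testf m (c s)%:C.
have hf : hol f by apply: testf_hol.
have nf : (sqn al f <= (C1 * (c s `^ (al + 2) / c s ^+ (2 * m)))%:E)%E by exact: testf_sqn.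
have ff : (sqn al f < +oo)%E by apply: le_lt_trans nf _; rewrite ltry.
have fE i : f (z i s) = ((2 * c s) ^- m)%:C * G ((c s)^-1%:C * z i s).
  have cN : (c s)%:C != 0 :> C by rewrite eq_complex /= eqxx andbT gt_eqF.
  have zc : z i s + (c s)%:C != 0.
    have := iter_Re_gt0 i (s0 : 0 < Re s%:C); rewrite -/(z i s) => zi.
    by apply/eqP => /(congr1 Re); rewrite ReD /=; lra.
  have e2 : (2 * c s)%:C = 2 * (c s)%:C :> C by apply: complexP; rewrite !ReImE /=; ring.
  have e3 : ((c s)^-1)%:C = ((c s)%:C)^-1 :> C by rewrite fmorphV.
  have e4 : ((2 * c s) ^- m)%:C = ((2 * (c s)%:C)^-1) ^+ m :> C.
    by rewrite -e2 -fmorphV -rmorphXn exprVn.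
  rewrite /f /testf conjc_real /G e4 e3 -exprMn; congr (_ ^+ _).
  field; rewrite cN addrC zc.
  by [].
pose X := psum n (psum n f).
have hX : hol X by apply: hol_psum; exact: hol_psum.
have := point_eval al hX (s0 : 0 < Re s%:C).
have up := le_trans (sqn_psum2 n K0 hf ff HK) (lee_wpmul2l _ nf).
move=> pe; have : normc (X s%:C) ^+ 2 * s `^ (al + 2) <=
    64 / pw al * ((4 * K) ^+ 2 * (C1 * (c s `^ (al + 2) / c s ^+ (2 * m)))).
  rewrite -lee_fin; apply: (le_trans pe); rewrite [leRHS]EFinM lee_wpmul2l ?lee_fin ?divr_ge0 ?(ltW pw0)//.
  by rewrite [leRHS]EFinM; apply: up; rewrite lee_fin sqr_ge0.
have low : n%:R * (cnorm ^- N * (2 * c s) ^- m / 2) <= normc (X s%:C).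
  apply: le_trans (Re_le_normc _); rewrite /X psum2E Re_sum.
  rewrite -[n in n%:R]card_ord -sum1_card natr_sum mulr_suml; apply: ler_sum => j _.
  rewrite mul1r Re_sum.
  have term (i : nat) : (i < 2 * n)%N -> Re ((cnorm ^- i)%:C * f (iter i Phi s%:C)) =
      cnorm ^- i * ((2 * c s) ^- m * Re (G ((c s)^-1%:C * z i s))).
    by move=> _; rewrite -/(z i s) fE !ReM /= !mul0r !subr0.
  have Lc i : 0 < cnorm ^- i * (2 * c s) ^- m.
    apply: mulr_gt0; rewrite invr_gt0 exprn_gt0//.
    by rewrite mulr_gt0.
  have Nn : (N < 2 * n)%N by rewrite mul2n -addnn /n addSn ltnS leq_addr.
  have ijn i : (i < n)%N -> (j + i < 2 * n)%N.
    by move=> ilt; rewrite mul2n -addnn -addSn leq_add// ltnW.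
  (* For each j the single index k = N - j is kept; the remaining terms are nonnegative and
     dropped. *)
  have jN : (N - j < n)%N by rewrite /n ltnS leq_subr.
  rewrite (bigD1 (Ordinal jN)) //= -[leLHS]addr0 lerD//.
    have jE : (j + (N - j) = N)%N by rewrite subnKC// -ltnS.
    rewrite jE term//.
    rewrite mulrA ler_wpM2l ?(ltW (Lc _))//.
    have := HS N; rewrite gN => h; apply: le_trans (h _) => //.
    by rewrite div1r.
  apply: sumr_ge0 => i _; rewrite term ?ijn//.
  rewrite mulrA mulr_ge0 ?(ltW (Lc _))//.
  by apply: le_trans (HS _ (ijn _ (ltn_ord i))); rewrite divr_ge0// ltW.
have low0 : 0 <= n%:R * (cnorm ^- N * (2 * c s) ^- m / 2).
  have h1 : 0 < cnorm ^- N by rewrite invr_gt0 exprn_gt0.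
  have h2 : 0 < (2 * c s) ^- m by rewrite invr_gt0 exprn_gt0// mulr_gt0.
  apply: mulr_ge0; first exact: ler0n.
  by rewrite divr_ge0// mulr_ge0 ?(ltW h1) ?(ltW h2).
have {}low : (n%:R * (cnorm ^- N * (2 * c s) ^- m / 2)) ^+ 2 <= normc (X s%:C) ^+ 2.
  by rewrite ler_sqr ?nnegrE ?normc_ge0.
have sp : 0 < s `^ (al + 2) by rewrite powR_gt0.
move=> /(le_trans (ler_wpM2r (ltW sp) low)).
have -> : c s `^ (al + 2) = cnorm ^- (2 * N) * s `^ (al + 2).
  rewrite /c powRM ?invr_ge0 ?exprn_ge0 ?(ltW l0) ?(ltW s0)//; congr (_ * _).
  exact: powR_lamXn.
have cm0 : 0 < c s ^+ m by rewrite exprn_gt0.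
have LN0 : 0 < cnorm ^+ N by rewrite exprn_gt0.
have tm0 : 0 < (2 : R) ^+ m by rewrite exprn_gt0.
rewrite exprMn [(2 * c s) ^+ m]exprMn ![(2 * _)%N]mulnC !exprM.
have -> : n%:R ^+ 2 * (cnorm ^- N * (2 ^+ m * c s ^+ m)^-1 / 2) ^+ 2 * s `^ (al + 2) =
   n%:R ^+ 2 * (s `^ (al + 2) / ((cnorm ^+ N) ^+ 2 * (2 ^+ m) ^+ 2 * (c s ^+ m) ^+ 2 * 4)).
  by field; rewrite !gt_eqF.
have -> : 64 / pw al * ((4 * K) ^+ 2 * (C1 * (((cnorm ^+ N) ^+ 2)^-1 * s `^ (al + 2) / (c s ^+ m) ^+ 2))) =
  C2 * (s `^ (al + 2) / ((cnorm ^+ N) ^+ 2 * (2 ^+ m) ^+ 2 * (c s ^+ m) ^+ 2 * 4)).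
  by rewrite /C2 [(2 * m)%N]mulnC exprM; field; rewrite !gt_eqF.
rewrite ler_pM2r//; apply: divr_gt0 => //.
apply: mulr_gt0; last by rewrite ltr0n.
by apply: mulr_gt0; [apply: mulr_gt0|]; exact: exprn_gt0.
Qed.

End Iterates.

End ApproximateEigenvalue.

(** * The Neumann series *)

Section ComplexSeries.
Variable R : realType.
Local Notation C := R[i].
Local Notation Re := (@complex.Re R).
Local Notation Im := (@complex.Im R).

Lemma geometric_sum_le (r : R) m n : 0 <= r < 1 ->
  \sum_(m <= k < n) r ^+ k <= r ^+ m / (1 - r).
Proof.
move=> /andP[r0 r1]; have r10 : 0 < 1 - r by rewrite subr_gt0.
have [nm|/ltnW mn] := leqP n m.
  by rewrite big_geq// divr_ge0 ?exprn_ge0// ltW.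
rewrite ler_pdivlMr// (_ : _ * _ = r ^+ m - r ^+ n) ?gerBl ?exprn_ge0//.
elim: n mn => [|n ih]; first by rewrite leqn0 => /eqP ->; rewrite big_geq// mul0r subrr.
rewrite leq_eqVlt => /orP[/eqP ->|]; first by rewrite big_geq// mul0r subrr.
rewrite ltnS => mn; rewrite big_nat_recr//= mulrDl ih// exprS; ring.
Qed.

(* Junk value when the series of real or imaginary parts diverges. *)
Definition csum (u : nat -> C) : C :=
  limn (series (fun k => Re (u k))) +i* limn (series (fun k => Im (u k))).

Lemma series_tail (u : R^nat) (A r : R) : 0 <= r < 1 -> 0 <= A ->
  (forall n, `|u n| <= A * r ^+ n) ->
  forall n, `|limn (series u) - \sum_(k < n) u k| <= A / (1 - r) * r ^+ n.
Proof.
move=> r01 A0 H n; have /andP[r0 r1] := r01.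
have cu : cvgn (series u).
  apply: normed_cvg; apply: (series_le_cvg _ _ H) => [k//|k|].
    by rewrite mulr_ge0// exprn_ge0.
  by apply: is_cvg_geometric_series; rewrite ger0_norm.
have Hm m : (n <= m)%N -> `|series u m - \sum_(k < n) u k| <= A / (1 - r) * r ^+ n.
  move=> nm; rewrite /series/= (big_cat_nat _ nm)//= big_mkord addrAC subrr add0r.
  apply: (le_trans (ler_norm_sum _ _ _)).
  apply: (@le_trans _ _ (\sum_(n <= k < m) A * r ^+ k)); first exact: ler_sum.
  rewrite -mulr_sumr -mulrA [_^-1 * _]mulrC ler_wpM2l//; exact: geometric_sum_le.
rewrite ler_distl; apply/andP; split.
  apply: limr_ge => //; near=> m.
  have := Hm m; rewrite ler_distl => /(_ _)/andP[]//; near: m; exact: nbhs_infty_ge.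
apply: limr_le => //; near=> m.
have := Hm m; rewrite ler_distl => /(_ _)/andP[]//; near: m; exact: nbhs_infty_ge.
Unshelve. all: by end_near.
Qed.

Lemma csum_tail (u : nat -> C) (A r : R) : 0 <= r < 1 -> 0 <= A ->
  (forall n, normc (u n) <= A * r ^+ n) ->
  forall n, normc (csum u - \sum_(k < n) u k) <= 2 * A / (1 - r) * r ^+ n.
Proof.
move=> r01 A0 H n; apply: le_trans (normc_le_ReIm _) _.
rewrite ReB ImB Re_sum Im_sum /=.
have hR k : `|Re (u k)| <= A * r ^+ k := le_trans (normc_Re _) (H k).
have hI k : `|Im (u k)| <= A * r ^+ k := le_trans (normc_Im _) (H k).
have := series_tail r01 A0 hR n; have := series_tail r01 A0 hI n; lra.
Qed.

Lemma le_geometric_limit (x y B r : R) : 0 <= r < 1 ->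
  (forall n, x <= y + B * r ^+ n) -> x <= y.
Proof.
move=> /andP[r0 r1] H.
have c : (fun n => y + B * r ^+ n) @ \oo --> y + B * 0.
  by apply: cvgD; [exact: cvg_cst|apply: cvgMr; apply: cvg_expr; rewrite ger0_norm].
rewrite -[y]addr0 -(mulr0 B) -(cvg_lim _ c)//.
by apply: limr_ge; [apply/cvg_ex; eexists; exact: c|exact: nearW].
Qed.

Lemma csum_unique (u : nat -> C) (A r B : R) s : 0 <= r < 1 -> 0 <= A ->
  (forall n, normc (u n) <= A * r ^+ n) ->
  (forall n, normc (s - \sum_(k < n) u k) <= B * r ^+ n) -> s = csum u.
Proof.
move=> r01 A0 H Hs; apply/eqP; rewrite -subr_eq0; apply/eqP; apply: eq0_normc; apply/eqP.
rewrite eq_le normc_ge0 andbT.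
apply: (@le_geometric_limit _ _ (B + 2 * A / (1 - r)) r) => // n.
rewrite add0r mulrDl (_ : s - _ = (s - \sum_(k < n) u k) - (csum u - \sum_(k < n) u k)); last by ring.
apply: (le_trans (normcBD _ _)); apply: lerD; [exact: Hs|exact: csum_tail].
Qed.

(** Proved by induction: the new cross term 2 s b is at most P b^2 / w + w Q, by s^2 <= P Q and the
    arithmetic-geometric mean inequality. *)
Lemma weighted_cauchy_schwarz (a : nat -> R) (r : R) n : 0 < r ->
  (\sum_(k < n) a k) ^+ 2 <= (\sum_(k < n) r ^+ k) * (\sum_(k < n) a k ^+ 2 / r ^+ k).
Proof.
move=> r0; elim: n => [|n ih]; first by rewrite !big_ord0 expr0n mulr0.
rewrite !big_ord_recr/=.
set s := \sum_(i < n) a i in ih *; set P := \sum_(i < n) r ^+ i in ih *.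
set Q := \sum_(i < n) _ in ih *; set w := r ^+ n; set b := a n.
have P0 : 0 <= P by apply: sumr_ge0 => i _; rewrite exprn_ge0// ltW.
have Q0 : 0 <= Q by apply: sumr_ge0 => i _; rewrite divr_ge0 ?sqr_ge0 ?exprn_ge0 ?ltW.
have w0 : 0 < w by exact: exprn_gt0.
pose v := P * (b ^+ 2 / w); pose t := w * Q.
have v0 : 0 <= v by rewrite mulr_ge0// divr_ge0 ?sqr_ge0// ltW.
have t0 : 0 <= t by rewrite mulr_ge0// ltW.
have vt : v * t = P * Q * b ^+ 2 by rewrite /v /t; field; rewrite gt_eqF.
have h : (2 * (s * b)) ^+ 2 <= (v + t) ^+ 2.
  have h1 : 4 * (v * t) <= (v + t) ^+ 2.
    by rewrite -subr_ge0 (_ : _ - _ = (v - t) ^+ 2) ?sqr_ge0//; ring.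
  apply: le_trans h1; rewrite vt (_ : _ ^+ 2 = 4 * (s ^+ 2 * b ^+ 2)); last by ring.
  by rewrite ler_wpM2l// ler_wpM2r// sqr_ge0.
have h2 : 2 * (s * b) <= v + t.
  apply: (le_trans (ler_norm _)); rewrite -(ger0_norm (addr_ge0 v0 t0)).
  by rewrite -ler_sqr ?nnegrE// !real_normK ?num_real.
have -> : (P + w) * (Q + b ^+ 2 / w) = P * Q + v + t + b ^+ 2.
  by rewrite /v /t; field; rewrite gt_eqF.
rewrite (_ : (s + b) ^+ 2 = s ^+ 2 + 2 * (s * b) + b ^+ 2); last by ring.
lra.
Qed.

End ComplexSeries.

Section Neumann.
Variable R : realType.
Local Notation C := R[i].
Local Notation Re := (@complex.Re R).
Local Notation Im := (@complex.Im R).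

Lemma cdiff_of_quadratic (f : C -> C) w d (K rho : R) : 0 < rho ->
  (forall z, normc (z - w) <= rho -> normc (f z - f w - d * (z - w)) <= K * normc (z - w) ^+ 2) ->
  cdiff_at f w d.
Proof.
move=> r0 H e e0; pose K' := `|K| + 1.
have K0 : 0 < K' by rewrite ltr_wpDl.
exists (Num.min rho (e / K')); first by rewrite lt_min r0 divr_gt0.
move=> z; rewrite lt_min => /andP[/ltW z1 /ltW z2].
apply: (le_trans (H z z1)); rewrite expr2 mulrA ler_wpM2r ?normc_ge0//.
apply: (@le_trans _ _ (K' * normc (z - w))).
  by rewrite ler_wpM2r ?normc_ge0// (le_trans (ler_norm _))// lerDl.
by rewrite mulrC -ler_pdivlMr.
Qed.

Variables (Phi : C -> C) (al M0 r : R) (l : C).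
Hypotheses (al1 : -1 < al) (hP : hol Phi) (P0 : forall z, 0 < Re z -> 0 < Re (Phi z))
  (M00 : 0 <= M0) (r0 : 0 < r) (r1 : r < 1)
  (l0 : l != 0) (Mrl : M0 <= r * normc l)
  (bM : forall F, hol F -> (sqn al F < +oo)%E ->
     (sqn al (fun z => F (Phi z)) <= (M0 ^+ 2)%:E * sqn al F)%E).

Let nl0 : 0 < normc l. Proof. by rewrite normc_gt0. Qed.
Let r01 : 0 <= r < 1. Proof. by rewrite (ltW r0) r1. Qed.
Let r10 : 0 < 1 - r. Proof. by rewrite subr_gt0. Qed.

Lemma sqn_comp_iter n F : hol F -> (sqn al F < +oo)%E ->
  (sqn al (fun z => F (iter n Phi z)) <= ((M0 ^+ n) ^+ 2)%:E * sqn al F)%E.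
Proof.
elim: n F => [|n ih] F hF fF; first by rewrite !expr1n mul1e.
have hFP := hol_comp hP P0 hF.
have fFP : (sqn al (fun z => F (Phi z)) < +oo)%E.
  apply: le_lt_trans (bM hF fF) _.
  by rewrite -(@fineK _ (sqn al F)) ?ge0_fin_numE ?sqn_ge0// -EFinM ltry.
apply: (le_trans (ih _ hFP fFP)).
rewrite [M0 ^+ n.+1]exprSr exprMn [leRHS](_ : _ = ((M0 ^+ n) ^+ 2)%:E * ((M0 ^+ 2)%:E * sqn al F))%E; last first.
  by rewrite muleA -EFinM.
by rewrite lee_wpmul2l ?lee_fin ?sqr_ge0//; exact: bM.
Qed.

Definition neumann_term (F : C -> C) z n : C := l ^- n.+1 * F (iter n Phi z).
Definition neumann F z := csum (neumann_term F z).

Lemma hol_neumann_term F n : hol F -> hol (fun z => neumann_term F z n).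
Proof. by move=> hF; apply: holZ; exact: hol_iter. Qed.

(** Point evaluation is uniform on Re z >= x0, n compositions cost M0^n, and M0 / |l| <= r. *)
Lemma neumann_term_le F (x0 : R) : hol F -> (sqn al F < +oo)%E -> 0 < x0 ->
  exists2 A : R, 0 <= A & forall z n, x0 <= Re z -> normc (neumann_term F z n) <= A * r ^+ n.
Proof.
move=> hF fF x00; have pw0 : 0 < pw al := expR_gt0 _.
pose a := fine (sqn al F); have aE : sqn al F = a%:E by rewrite fineK ?ge0_fin_numE ?sqn_ge0.
have a0 : 0 <= a by rewrite fine_ge0 ?sqn_ge0.
have xp0 : 0 < x0 `^ (al + 2) := powR_gt0 _ x00.
pose C1 := 64 / pw al * a / x0 `^ (al + 2).
have C10 : 0 <= C1 by rewrite divr_ge0 ?(ltW xp0)// mulr_ge0// divr_ge0// ltW.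
exists (Num.sqrt C1 / normc l); first by rewrite divr_ge0 ?sqrtr_ge0 ?ltW.
move=> z n xz; have z0 : 0 < Re z := lt_le_trans x00 xz.
have le1 : normc (F (iter n Phi z)) <= Num.sqrt C1 * M0 ^+ n.
  rewrite -ler_sqr ?nnegrE ?normc_ge0 ?mulr_ge0 ?sqrtr_ge0 ?exprn_ge0//.
  rewrite exprMn sqr_sqrtr// /C1 mulrAC ler_pdivlMr//.
  apply: (@le_trans _ _ (normc (F (iter n Phi z)) ^+ 2 * Re z `^ (al + 2))).
    rewrite ler_wpM2l ?sqr_ge0// ge0_ler_powR ?nnegrE ?(ltW x00) ?(ltW z0)//.
    by move: al1; lra.
  rewrite -lee_fin; apply: (le_trans (point_eval al (hol_iter hP P0 n hF) z0)).
  rewrite (_ : _ * _ ^+ 2 = 64 / pw al * ((M0 ^+ n) ^+ 2 * a)); last by ring.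
  rewrite [leRHS]EFinM lee_wpmul2l ?lee_fin ?divr_ge0 ?(ltW pw0)//.
  by rewrite [leRHS]EFinM -aE; exact: sqn_comp_iter.
rewrite normcM normcV normcX.
have ln0 : 0 < normc l ^+ n.+1 by rewrite exprn_gt0.
rewrite mulrC ler_pdivrMr//; apply: (le_trans le1).
rewrite exprS [leRHS](_ : _ = Num.sqrt C1 * (r * normc l) ^+ n); last first.
  by rewrite exprMn; field; rewrite gt_eqF.
rewrite ler_wpM2l ?sqrtr_ge0// lerXn2r ?nnegrE// mulr_ge0 ?(ltW r0)// ltW//.
Qed.

Lemma neumann_tail F z : hol F -> (sqn al F < +oo)%E -> 0 < Re z ->
  exists B : R, forall n, normc (neumann F z - \sum_(k < n) neumann_term F z k) <= B * r ^+ n.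
Proof.
move=> hF fF z0; have [A A0 HA] := neumann_term_le hF fF z0.
by exists (2 * A / (1 - r)) => n; apply: csum_tail => // k; exact: HA.
Qed.

(* The termwise Taylor estimates have geometrically decaying constants, so they can be summed. *)
Lemma hol_neumann F : hol F -> (sqn al F < +oo)%E -> hol (neumann F).
Proof.
move=> hF fF w w0; pose rho := Re w / 2.
have rho0 : 0 < rho by rewrite divr_gt0.
have [A A0 HA] := neumann_term_le hF fF rho0.
have rect_ge z : rect (Re w - rho) (Re w + rho) (Im w - rho) (Im w + rho) z -> rho <= Re z.
  by move=> /andP[/andP[+ _] _]; rewrite /rho; lra.
have H n := @taylor2 _ (fun z => neumann_term F z n) w rho (A * r ^+ n) rho0
  (fun z hz => hol_neumann_term n hF (lt_le_trans rho0 (rect_ge z hz)))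
  (fun z hz => HA z n (rect_ge z hz)).
have [d Hd] := choice H; pose D := csum d.
have rw : rho <= Re w by rewrite /rho; move: w0; lra.
have near_ge z : normc (z - w) <= rho / 2 -> rho <= Re z.
  move=> h; have := le_trans (normc_Re _) h; rewrite ReB ler_distl => /andP[+ _].
  by rewrite /rho; move: w0; lra.
(* The derivatives are bounded by the Taylor estimate itself, read at z = w + rho / 2: |d n| rho / 2
   <= (2 + 4) A r^n. *)
have d_le n : normc (d n) <= 12 * A / rho * r ^+ n.
  pose z := w + (rho / 2)%:C.
  have zw : z - w = (rho / 2)%:C by rewrite /z addrAC subrr add0r.
  have nz : normc (z - w) = rho / 2 by rewrite zw normc_real ger0_norm// divr_ge0// ltW.
  have hz : normc (z - w) <= rho / 2 by rewrite nz.
  have := Hd n z hz; rewrite nz.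
  set u := neumann_term F z n - neumann_term F w n => h.
  have hu : normc u <= 2 * (A * r ^+ n).
    apply: (le_trans (normcBD _ _)); rewrite mulr_natl mulr2n.
    by apply: lerD; apply: HA => //; exact: near_ge.
  have : normc (d n * (z - w)) <= normc u + 16 * (A * r ^+ n) / rho ^+ 2 * (rho / 2) ^+ 2.
    rewrite (_ : d n * (z - w) = u - (u - d n * (z - w))); last by ring.
    by apply: (le_trans (normcBD _ _)); exact: lerD.
  rewrite normcM nz (_ : 16 * _ / _ * _ = 4 * (A * r ^+ n)); last by field; rewrite gt_eqF.
  move=> h2; rewrite (_ : _ * r ^+ n = 6 * (A * r ^+ n) / (rho / 2)); last by field; rewrite gt_eqF.
  by rewrite ler_pdivlMr ?divr_gt0//; lra.
have A12 : 0 <= 12 * A / rho by rewrite divr_ge0 ?mulr_ge0// ltW.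
have tail_d := csum_tail r01 A12 d_le.
exists D; apply: (@cdiff_of_quadratic _ _ _ (16 * A / rho ^+ 2 / (1 - r)) (rho / 2)).
  by rewrite divr_gt0.
move=> z zw; have zr := near_ge z zw.
have tz := csum_tail r01 A0 (fun n => HA z n zr).
have tw := csum_tail r01 A0 (fun n => HA w n rw).
pose B := 2 * A / (1 - r); pose B' := 2 * (12 * A / rho) / (1 - r).
(* The Taylor estimate is summed up to n; the tails at z, at w and of the derivatives vanish as n
   grows. *)
apply: (@le_geometric_limit _ _ _ (B + B + B' * normc (z - w)) r r01) => n.
pose Q := \sum_(k < n) (neumann_term F z k - neumann_term F w k - d k * (z - w)).
have hQ : normc Q <= 16 * A / rho ^+ 2 / (1 - r) * normc (z - w) ^+ 2.
  apply: (le_trans (normc_sum _ _ _)).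
  apply: (@le_trans _ _ (\sum_(k < n) (16 * A / rho ^+ 2 * normc (z - w) ^+ 2) * r ^+ k)).
    apply: ler_sum => k _; apply: (le_trans (Hd k z zw)).
    by rewrite le_eqVlt; apply/orP; left; apply/eqP; field; rewrite gt_eqF.
  rewrite -mulr_sumr [leRHS](_ : _ = 16 * A / rho ^+ 2 * normc (z - w) ^+ 2 * (r ^+ 0 / (1 - r))); last first.
    by rewrite expr0; ring.
  apply: ler_wpM2l.
    by rewrite mulr_ge0 ?sqr_ge0// divr_ge0 ?sqr_ge0// mulr_ge0.
  by have := geometric_sum_le 0 n r01; rewrite big_mkord.
have -> : neumann F z - neumann F w - D * (z - w) =
    Q + (neumann F z - \sum_(k < n) neumann_term F z k)
      - (neumann F w - \sum_(k < n) neumann_term F w k)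
      - (D - \sum_(k < n) d k) * (z - w).
  rewrite /Q !sumrB mulrBl mulr_suml; ring.
apply: (le_trans (normcBD _ _)).
have -> : 16 * A / rho ^+ 2 / (1 - r) * normc (z - w) ^+ 2 + (B + B + B' * normc (z - w)) * r ^+ n =
  16 * A / rho ^+ 2 / (1 - r) * normc (z - w) ^+ 2 + B * r ^+ n + B * r ^+ n + B' * r ^+ n * normc (z - w).
  by ring.
apply: lerD; last by rewrite normcM; apply: ler_wpM2r; [exact: normc_ge0|exact: tail_d].
apply: (le_trans (normcBD _ _)); apply: lerD; last exact: tw.
by apply: (le_trans (normcD _ _)); apply: lerD; [exact: hQ|exact: tz].
Qed.

Lemma neumann_right F z : hol F -> (sqn al F < +oo)%E -> 0 < Re z ->
  l * neumann F z - neumann F (Phi z) = F z.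
Proof.
move=> hF fF z0; have [B HB] := neumann_tail hF fF z0.
have [B' HB'] := neumann_tail hF fF (P0 z0).
apply/eqP; rewrite -subr_eq0; apply/eqP; apply: eq0_normc; apply/eqP.
rewrite eq_le normc_ge0 andbT.
apply: (@le_geometric_limit _ _ _ (normc l * B * r + B') r r01) => n.
(* n + 1 terms at z face n terms at Phi z: multiplication by l isolates F z and shifts the index of
   the rest. *)
have -> : l * neumann F z - neumann F (Phi z) - F z =
   l * (neumann F z - \sum_(k < n.+1) neumann_term F z k)
   - (neumann F (Phi z) - \sum_(k < n) neumann_term F (Phi z) k).
  rewrite big_ord_recl mulrBr mulrDr mulr_sumr.
  have -> : \sum_(k < n) l * neumann_term F z (lift ord0 k) = \sum_(k < n) neumann_term F (Phi z) k.
    apply: eq_bigr => k _; rewrite /neumann_term /= -iterSr /=.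
    by rewrite mulrA; congr (_ * _); rewrite [l ^+ _.+2]exprS invfM mulrA mulfV// mul1r.
  have -> : l * neumann_term F z (@ord0 n) = F z by rewrite /neumann_term expr1 mulrA mulfV// mul1r.
  ring.
rewrite add0r mulrDl; apply: (le_trans (normcBD _ _)); apply: lerD => //.
by rewrite normcM -!mulrA -exprS ler_wpM2l ?normc_ge0.
Qed.

(** The terms telescope to F z - l times the n-th term, and the last part decays geometrically. *)
Lemma neumann_left F z : hol F -> (sqn al F < +oo)%E -> 0 < Re z ->
  neumann (fun v => l * F v - F (Phi v)) z = F z.
Proof.
move=> hF fF z0; have [A A0 HA] := neumann_term_le hF fF z0.
have E k : neumann_term (fun v => l * F v - F (Phi v)) z k =
    l * neumann_term F z k - l * neumann_term F z k.+1.
  rewrite /neumann_term mulrBr iterS [l ^+ k.+2]exprS invfM.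
  by field; rewrite !expf_neq0.
have HA' k := HA z k (lexx _).
have lA k : normc (l * neumann_term F z k) <= normc l * A * r ^+ k.
  by rewrite normcM -mulrA ler_wpM2l ?normc_ge0.
apply/esym/(@csum_unique _ _ (normc l * A * (1 + r)) r (normc l * A)) => //.
- by rewrite !mulr_ge0 ?normc_ge0// addr_ge0// ltW.
- move=> n; rewrite E (le_trans (normcBD _ _))//.
  by have := lA n; have := lA n.+1; rewrite exprS; lra.
move=> n; under eq_bigr do rewrite E.
have -> : \sum_(k < n) (l * neumann_term F z k - l * neumann_term F z k.+1) =
   F z - l * neumann_term F z n.
  elim: n => [|n ih].
    by rewrite big_ord0 /neumann_term expr1 mulrA mulfV// mul1r subrr.
  rewrite big_ord_recr /= ih; ring.
by rewrite opprB addrC subrK.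
Qed.

Lemma neumann_lin a F G z : hol F -> (sqn al F < +oo)%E -> hol G -> (sqn al G < +oo)%E ->
  0 < Re z -> neumann (fun v => a * F v + G v) z = a * neumann F z + neumann G z.
Proof.
move=> hF fF hG fG z0; have [A A0 HA] := neumann_term_le hF fF z0.
have [A' A0' HA'] := neumann_term_le hG fG z0.
have [B HB] := neumann_tail hF fF z0; have [B' HB'] := neumann_tail hG fG z0.
have E k : neumann_term (fun v => a * F v + G v) z k =
  a * neumann_term F z k + neumann_term G z k by rewrite /neumann_term; ring.
apply/esym/(@csum_unique _ _ (normc a * A + A') r (normc a * B + B')) => //.
- by rewrite addr_ge0// mulr_ge0 ?normc_ge0.
- move=> n; rewrite E (le_trans (normcD _ _))// mulrDl lerD ?HA'//.
  by rewrite normcM -mulrA ler_wpM2l ?normc_ge0 ?HA.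
move=> n; under eq_bigr do rewrite E.
rewrite big_split /= -mulr_sumr opprD addrACA -mulrBr (le_trans (normcD _ _))//.
rewrite mulrDl; apply: lerD; last exact: HB'.
by rewrite normcM -mulrA; apply: ler_wpM2l; [exact: normc_ge0|exact: HB].
Qed.

(** Cauchy-Schwarz with weights r^k costs one factor 1 / (1 - r). Since M0^(2 k) / r^k <= |l|^(2 k)
    r^k, summing the squared norms costs a second one. *)
Lemma sqn_neumann F : hol F -> (sqn al F < +oo)%E ->
  (sqn al (neumann F) <= (((normc l * (1 - r)) ^- 2))%:E * sqn al F)%E.
Proof.
move=> hF fF; pose c n := (normc l ^- n.+1) ^+ 2 / r ^+ n / (1 - r).
have c0 n : 0 <= c n.
  by apply: divr_ge0 (ltW r10); apply: divr_ge0; [exact: sqr_ge0|rewrite exprn_ge0// ltW].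
pose a := fine (sqn al F); have aE : sqn al F = a%:E by rewrite fineK ?ge0_fin_numE ?sqn_ge0.
have a0 : 0 <= a by rewrite fine_ge0 ?sqn_ge0.
apply: le_trans.
  apply: (@sqn_series _ _ c (fun n z => F (iter n Phi z)) _ c0 (fun n => hol_iter hP P0 n hF) (hol_neumann hF fF)).
  move=> z z0.
  have T0 n : (0 <= (c n * normc (F (iter n Phi z)) ^+ 2)%:E)%E.
    by rewrite lee_fin mulr_ge0// sqr_ge0.
  have lim_ge n := @nneseries_lim_ge _ _ xpredT 0 n (fun k _ _ => T0 k).
  (* An infinite majorant makes the claim trivial, so its value can be taken to be a real t that
     dominates all partial sums. *)
  move: lim_ge; case: (\sum_(n <oo) _)%E => [t| |] lim_ge; last 2 first.
  - by rewrite leey.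
  - by have := lim_ge 0; rewrite big_geq.
  have part n : \sum_(k < n) c k * normc (F (iter k Phi z)) ^+ 2 <= t.
    by have := lim_ge n; rewrite sumEFin lee_fin big_mkord.
  have t0 : 0 <= t by have := part 0; rewrite big_ord0.
  rewrite lee_fin -[t]sqr_sqrtr// ler_sqr ?nnegrE ?normc_ge0 ?sqrtr_ge0//.
  have [B HB] := neumann_tail hF fF z0.
  apply: (@le_geometric_limit _ _ _ B r r01) => n.
  rewrite -(subrK (\sum_(k < n) neumann_term F z k) (neumann F z)) addrC.
  apply: (le_trans (normcD _ _)); apply: lerD => //.
  apply: (le_trans (normc_sum _ _ _)).
  rewrite -ler_sqr ?nnegrE ?sqrtr_ge0 ?sumr_ge0 ?sqr_sqrtr//; last by move=> i _; exact: normc_ge0.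
  apply: (le_trans (weighted_cauchy_schwarz (fun k => normc (neumann_term F z k)) n r0)).
  apply: le_trans (part n).
  apply: (@le_trans _ _ ((1 - r)^-1 * (\sum_(k < n) normc (neumann_term F z k) ^+ 2 / r ^+ k))).
    rewrite ler_wpM2r//.
      by apply: sumr_ge0 => k _; rewrite divr_ge0 ?sqr_ge0 ?exprn_ge0 ?(ltW r0).
    by have := geometric_sum_le 0 n r01; rewrite big_mkord expr0 mul1r.
  rewrite mulr_sumr; apply: ler_sum => k _.
  rewrite /neumann_term normcM normcV normcX /c exprMn.
  by rewrite le_eqVlt; apply/orP; left; apply/eqP; ring.
have le1 n : ((c n)%:E * sqn al (fun z => F (iter n Phi z)) <=
    ((normc l ^+ 2)^-1 / (1 - r) * a * r ^+ n)%:E)%E.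
  apply: (@le_trans _ _ ((c n)%:E * (((M0 ^+ n) ^+ 2)%:E * a%:E))%E).
    by rewrite lee_wpmul2l ?lee_fin// -aE; exact: sqn_comp_iter.
  rewrite -!EFinM lee_fin.
  apply: (@le_trans _ _ (c n * (((r * normc l) ^+ n) ^+ 2 * a))).
    rewrite ler_wpM2l// ler_wpM2r// lerXn2r ?nnegrE ?exprn_ge0//.
      by rewrite mulr_ge0 ?(ltW r0) ?(ltW nl0).
    by rewrite lerXn2r ?nnegrE// mulr_ge0 ?(ltW r0) ?(ltW nl0).
  rewrite /c exprMn [normc l ^+ n.+1]exprS.
  have ln0 : normc l ^+ n != 0 by rewrite expf_neq0// gt_eqF.
  have rn0 : r ^+ n != 0 by rewrite expf_neq0// gt_eqF.
  rewrite le_eqVlt; apply/orP; left; apply/eqP; field.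
  by rewrite ln0 rn0 !gt_eqF.
apply: lime_le.
  by apply: is_cvg_nneseries => n _ _; rewrite mule_ge0 ?lee_fin ?sqn_ge0.
near=> n; apply: (le_trans (lee_sum _ (fun k _ => le1 k))).
rewrite sumEFin aE -EFinM lee_fin -mulr_sumr.
apply: (@le_trans _ _ ((normc l ^+ 2)^-1 / (1 - r) * a * (r ^+ 0 / (1 - r)))).
  rewrite ler_wpM2l ?geometric_sum_le// mulr_ge0// divr_ge0 ?(ltW r10)// invr_ge0 sqr_ge0//.
by rewrite le_eqVlt; apply/orP; left; apply/eqP; rewrite expr0; field; rewrite !gt_eqF.
Unshelve. all: by end_near.
Qed.

End Neumann.

(** * Spectral radius on the Bergman space *)

Section BergmanSpace.
Variable R : realType.
Local Notation C := R[i].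
Local Notation Re := (@complex.Re R).
Local Notation H := (rhp R).

Lemma rhp_extE (F : H -> C) z (z0 : 0 < Re z) : rhp_ext F z = F (exist _ z z0).
Proof. by rewrite /rhp_ext (insubT (fun v : C => 0 < Re v) z0). Qed.

Lemma rhp_ext_out (F : H -> C) z : ~~ (0 < Re z) -> rhp_ext F z = 0.
Proof. by move=> z0; rewrite /rhp_ext insubF//; exact: negbTE. Qed.

Definition restr (G : C -> C) : H -> R[i]^o := fun z => G (val z).

Lemma rhp_ext_restr G z : 0 < Re z -> rhp_ext (restr G) z = G z.
Proof. by move=> z0; rewrite rhp_extE. Qed.

Lemma holomorphic_rhpP (F : H -> C) : holomorphic_rhp F <-> hol (rhp_ext F).
Proof.
split=> [hF z z0|hF [z z0]]; last by apply/cdiffE; exact: hF.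
by apply/cdiffE; exact: (hF (exist _ z z0)).
Qed.

Lemma eq_hol F G : (forall z, 0 < Re z -> F z = G z) -> hol F -> hol G.
Proof.
move=> FG hF z z0; apply: (cdiff_near z0 _ (hF z z0)) => w wz; apply: FG.
have := le_lt_trans (normc_Re _) wz; rewrite ReB ltr_distl => /andP[+ _]; lra.
Qed.

Lemma rhp_ext_lin (a : C) (F G : H -> R[i]^o) :
  rhp_ext (a *: F + G) = fun z => a * rhp_ext F z + rhp_ext G z.
Proof.
apply/funext => z; have [z0|z0] := boolP (0 < Re z); first by rewrite !rhp_extE.
by rewrite !rhp_ext_out// mulr0 addr0.
Qed.

Section Norm.
Variable al : R.
Local Notation A := (@bergman_space R al).
Local Notation N := (@bergman_norm R al).

Lemma pi_inv_gt0 : 0 < pi^-1 :> R. Proof. by rewrite invr_gt0 pi_gt0. Qed.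

Lemma bergman_spaceP F : A F <-> hol (rhp_ext F) /\ (sqn al (rhp_ext F) < +oo)%E.
Proof.
split=> -[/holomorphic_rhpP hF fF]; split => //; move: fF; rewrite /bergman_sqnorm -/(sqn al (rhp_ext F)).
  case: (sqn al (rhp_ext F)) (sqn_ge0 al (rhp_ext F)) => [r||]// _; first by move=> _; rewrite ltry.
  by rewrite mulry gtr0_sg ?pi_inv_gt0// mul1e.
case: (sqn al (rhp_ext F)) (sqn_ge0 al (rhp_ext F)) => [r||]// _ _.
by rewrite -EFinM ltry.
Qed.

Lemma bergman_norm_sq F : A F ->
  exists r, [/\ 0 <= r, sqn al (rhp_ext F) = r%:E & N F ^+ 2 = pi^-1 * r].
Proof.
move=> /bergman_spaceP[hF fF]; rewrite /bergman_norm /bergman_sqnorm -/(sqn al (rhp_ext F)).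
move: (sqn al (rhp_ext F)) (sqn_ge0 al (rhp_ext F)) fF => [r| |]// r0 _.
by exists r; split => //; rewrite sqr_sqrtr //= mulr_ge0// ltW// pi_inv_gt0.
Qed.

Lemma bergman_norm_ge0 F : 0 <= N F. Proof. exact: sqrtr_ge0. Qed.

Lemma bergman_norm_le F G (M : R) : A F -> A G -> 0 <= M ->
  N F <= M * N G <-> (sqn al (rhp_ext F) <= (M ^+ 2)%:E * sqn al (rhp_ext G))%E.
Proof.
move=> /bergman_norm_sq[r [r0 -> rE]] /bergman_norm_sq[r' [r0' -> rE']] M0.
suff -> : (N F <= M * N G) = (r <= M ^+ 2 * r') by [].
move: (bergman_norm_ge0 F) (bergman_norm_ge0 G) rE rE'.
generalize (N F) (N G) => x y x0 y0 xE yE.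
rewrite -[LHS]ler_sqr ?nnegrE ?mulr_ge0// exprMn xE yE mulrCA.
by rewrite ler_pM2l ?pi_inv_gt0.
Qed.

Lemma bergman_space_lin a F G : A F -> A G -> A (a *: F + G).
Proof.
move=> AF AG; have [/bergman_spaceP[hF _] /bergman_spaceP[hG _]] := (AF, AG).
have [[r [_ rE _]] [r' [_ rE' _]]] := (bergman_norm_sq AF, bergman_norm_sq AG).
apply/bergman_spaceP; rewrite rhp_ext_lin; split; first exact: hol_lin.
by apply: le_lt_trans (sqn_lin al a hF hG) _; rewrite rE rE' ltry.
Qed.

Lemma bergman_space_restr G : hol G -> (sqn al G < +oo)%E -> A (restr G).
Proof.
move=> hG fG; apply/bergman_spaceP; split.
  by apply: eq_hol hG => z z0; rewrite rhp_ext_restr.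
by rewrite (eq_sqn _ (rhp_ext_restr G)).
Qed.

Lemma bergman_space0 : A 0.
Proof.
have h0 : hol (fun=> 0 : C) by move=> z _; exact: cdiff_cst.
apply: (bergman_space_restr h0).
have := sqnZ al 0 h0; rewrite normc0 expr0n mul0e.
by under eq_fun do rewrite mul0r; move=> ->; rewrite ltry.
Qed.

Lemma bergman_normZ a F : A F -> N (a *: F) = normc a * N F.
Proof.
move=> AF; have AaF : A (a *: F) by rewrite -[_ *: _]addr0; exact: bergman_space_lin bergman_space0.
have /bergman_spaceP[hF fF] := AF.
have := sqnZ al a hF; rewrite -(@eq_sqn _ al (rhp_ext (a *: F))); last first.
  by move=> z z0; rewrite !rhp_extE.
have [r [r0 -> rE]] := bergman_norm_sq AF; have [r' [r0' -> rE']] := bergman_norm_sq AaF.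
move=> e; have E : r' = normc a ^+ 2 * r by apply: EFin_inj.
move: (bergman_norm_ge0 F) (bergman_norm_ge0 (a *: F)) rE rE'.
generalize (N F) (N (a *: F)) => x y x0 y0 xE yE.
apply/eqP; rewrite -(@eqrXn2 _ 2) ?mulr_ge0 ?normc_ge0//.
by rewrite exprMn xE yE E mulrCA.
Qed.

End Norm.
End BergmanSpace.

(** * Spectrum and norm of the composition operator *)

Section SpectralRadius.
Variables (R : realType) (phi : rhp R -> rhp R) (al : R).
Local Notation C := R[i].
Local Notation Re := (@complex.Re R).
Local Notation A := (@bergman_space R al).
Local Notation N := (@bergman_norm R al).
Local Notation T := (@composition_operator R phi).
Hypotheses (phi_hol : holomorphic_rhp (fun z => val (phi z))) (al1 : -1 < al).

Let Phi : C -> C := rhp_ext (fun z => val (phi z)).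

Let hP : hol Phi. Proof. exact/holomorphic_rhpP. Qed.

Let P0 z : 0 < Re z -> 0 < Re (Phi z).
Proof. by move=> z0; rewrite /Phi rhp_extE; exact: (valP (phi _)). Qed.

Lemma rhp_ext_comp (F : rhp R -> R[i]^o) : rhp_ext (T F) = fun z => rhp_ext F (Phi z).
Proof.
apply/funext => z; have [z0|z0] := boolP (0 < Re z).
  by rewrite [Phi z]rhp_extE [LHS]rhp_extE /rhp_ext valK.
(* Off the half-plane Phi z is the default 0, which lies outside the half-plane too, so both sides
   vanish. *)
by rewrite [Phi z]rhp_ext_out// !rhp_ext_out//= ltxx.
Qed.

Lemma composition_lin (a : C) (F : rhp R -> R[i]^o) : a *: F - T F = (-1) *: T F + a *: F.
Proof. by rewrite scaleN1r addrC. Qed.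

Lemma rhp_ext_resolvent (a : C) (F : rhp R -> R[i]^o) :
  rhp_ext (a *: F - T F) = fun z => a * rhp_ext F z - rhp_ext F (Phi z).
Proof.
have E : a *: F = a *: F + 0 by rewrite addr0.
rewrite composition_lin rhp_ext_lin rhp_ext_comp E rhp_ext_lin; apply/funext => z.
have -> : rhp_ext (0 : rhp R -> R[i]^o) z = 0.
  by have [z0|z0] := boolP (0 < Re z); [rewrite rhp_extE|rewrite rhp_ext_out].
ring.
Qed.

Hypothesis (AT : forall F, A F -> A (T F)).

Lemma bergman_space_resolvent (a : C) F : A F -> A (a *: F - T F).
Proof.
move=> AF; rewrite composition_lin; apply: bergman_space_lin; first exact: AT.
by rewrite -[_ *: _]addr0; exact: bergman_space_lin (bergman_space0 _).
Qed.

(** Passage between the Bergman norm on [rhp] and squared integrals of functions on [R[i]], where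
    all estimates are made; restriction and extension by 0 preserve [sqn]. *)
Lemma composition_sqn_le (M : R) : 0 <= M ->
  (forall F, A F -> N (T F) <= M * N F) <->
  (forall F, hol F -> (sqn al F < +oo)%E ->
     (sqn al (fun z => F (Phi z)) <= (M ^+ 2)%:E * sqn al F)%E).
Proof.
move=> M0; split=> HM F.
  move=> hF fF; have AF := bergman_space_restr hF fF.
  have := HM _ AF; rewrite (bergman_norm_le (AT AF) AF M0) rhp_ext_comp.
  rewrite (eq_sqn _ (rhp_ext_restr F)) (@eq_sqn _ _ _ (fun z => F (Phi z)))// => z z0.
  by rewrite rhp_ext_restr//; exact: P0.
move=> AF; rewrite (bergman_norm_le (AT AF) AF M0) rhp_ext_comp.
by move/bergman_spaceP: AF => [hF fF]; exact: HM.
Qed.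

Lemma operator_norm_le (M : R) : 0 <= M ->
  (forall F, A F -> N (T F) <= M * N F) -> (operator_norm A N T <= M%:E)%E.
Proof.
move=> M0 HM; apply: ge_ereal_sup => _ [F [AF NF] <-]; rewrite lee_fin.
by apply: le_trans (HM F AF) _; rewrite -[leRHS]mulr1 ler_wpM2l.
Qed.

Lemma operator_norm_ge0 : (0 <= operator_norm A N T)%E.
Proof.
apply: (@le_trans _ _ (N (T 0))%:E); first by rewrite lee_fin bergman_norm_ge0.
apply: ereal_sup_ubound; exists 0; last by []; split; first exact: bergman_space0.
have := bergman_normZ 0 (bergman_space0 al); rewrite scale0r normc0 mul0r => ->.
exact: ler01.
Qed.

Lemma le_operator_norm (M M0 : R) : operator_norm A N T = M0%:E ->
  (forall F, A F -> N (T F) <= M * N F) ->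
  forall F, A F -> N (T F) <= M0 * N F.
Proof.
(* A function of norm 0 cannot be rescaled to the unit sphere; the bound with M shows that its image
   has norm 0 as well. *)
move=> EM HM F AF; have [NF0|NF0] := eqVneq (N F) 0.
  by rewrite NF0 mulr0; have := HM F AF; rewrite NF0 mulr0.
have NF : 0 < N F by rewrite lt_neqAle eq_sym NF0 bergman_norm_ge0.
have nk : normc (N F)^-1%:C = (N F)^-1 by rewrite normc_real gtr0_norm// invr_gt0.
have AkF : A ((N F)^-1%:C *: F).
  by rewrite -[_ *: _]addr0; exact: bergman_space_lin (bergman_space0 _).
have : ((N (T ((N F)^-1%:C *: F)))%:E <= M0%:E)%E.
  rewrite -EM; apply: ereal_sup_ubound; exists ((N F)^-1%:C *: F); last by []; split; first exact: AkF.
  by rewrite bergman_normZ// nk mulVf.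
have -> : T ((N F)^-1%:C *: F) = (N F)^-1%:C *: T F by [].
by rewrite lee_fin bergman_normZ ?nk; [rewrite mulrC ler_pdivrMr|exact: AT].
Qed.

Lemma spectrum_le_norm (M0 : R) l : 0 <= M0 ->
  (forall F, A F -> N (T F) <= M0 * N F) -> operator_spectrum A N T l -> normc l <= M0.
Proof.
move=> M00 HM spl; rewrite leNgt; apply/negP => Ml; apply: spl.
have nl0 : 0 < normc l := le_lt_trans M00 Ml.
have l0 : l != 0 by rewrite -normc_gt0.
(* The midpoint of M0 / |l| and 1; it is positive even when M0 = 0. *)
pose r := (M0 / normc l + 1) / 2.
have Mr : M0 / normc l < 1 by rewrite ltr_pdivrMr// mul1r.
have r0 : 0 < r by rewrite divr_gt0// ltr_wpDl// divr_ge0// ltW.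
have r1 : r < 1 by rewrite /r; lra.
have Mrl : M0 <= r * normc l by rewrite -ler_pdivrMr//; rewrite /r; lra.
have bM := (composition_sqn_le M00).1 HM.
clearbody r.
pose S F := restr (neumann Phi l (rhp_ext F)).
have hS F : A F -> hol (neumann Phi l (rhp_ext F)).
  by move=> /bergman_spaceP[hF fF]; exact: hol_neumann al1 hP P0 M00 r0 r1 l0 Mrl bM _ hF fF.
have K0 : 0 <= (normc l * (1 - r))^-1.
  by rewrite invr_ge0 mulr_ge0 ?subr_ge0 ?ltW.
have sS F : A F -> (sqn al (neumann Phi l (rhp_ext F)) <=
    (((normc l * (1 - r))^-1) ^+ 2)%:E * sqn al (rhp_ext F))%E.
  move=> /bergman_spaceP[hF fF]; rewrite exprVn.
  exact: sqn_neumann al1 hP P0 M00 r0 r1 l0 Mrl bM _ hF fF.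
have AS F : A F -> A (S F).
  move=> AF; apply: bergman_space_restr; first exact: hS.
  apply: le_lt_trans (sS F AF) _.
  by have [r' [_ -> _]] := bergman_norm_sq AF; rewrite ltry.
exists S; split; [split; [exact: AS| |]|].
- move=> a F G AF AG; apply/funext => -[z z0].
  rewrite /S rhp_ext_lin /restr /=.
  have [/bergman_spaceP[hF fF] /bergman_spaceP[hG fG]] := (AF, AG).
  exact: neumann_lin al1 hP P0 M00 r0 r1 l0 Mrl bM a _ _ z hF fF hG fG z0.
- exists (normc l * (1 - r))^-1 => F AF.
  apply/(bergman_norm_le (AS F AF) AF K0); rewrite (eq_sqn _ (rhp_ext_restr _)).
  exact: sS.
move=> F AF; have /bergman_spaceP[hF fF] := AF; split; apply/funext => -[z z0].
  rewrite /S rhp_ext_resolvent /restr /=.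
  rewrite (neumann_left al1 hP P0 M00 r0 r1 l0 Mrl bM hF fF z0).
  by rewrite rhp_extE.
have := neumann_right al1 hP P0 M00 r0 r1 l0 Mrl bM hF fF z0.
rewrite [X in _ = X]rhp_extE => <-.
by congr (_ - _); rewrite /S /restr /= [Phi z]rhp_extE.
Qed.

(** A bounded inverse of L - T would bound it from below. As L - T is L times 1 - V, this is the
    inequality excluded by [no_lower_bound], with K^2 = (|M| L)^2. *)
Lemma norm_in_spectrum (lam : R) : 0 < lam ->
  (forall z, 0 < Re z -> Re z <= lam * Re (Phi z)) ->
  (forall e, 0 < e -> exists2 w, 0 < Re w & Re (Phi w) <= (lam^-1 + e) * Re w) ->
  operator_spectrum A N T (cnorm al lam)%:C.
Proof.
move=> l0 le_lam inf_lam [S [[AS _ [M HM]] SE]].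
pose L := cnorm al lam; have L0 : 0 < L := cnorm_gt0 al l0.
pose K := `|M| * L; have K0 : 0 <= K by exact: mulr_ge0 (normr_ge0 M) (ltW L0).
apply: (@no_lower_bound _ Phi al lam al1 l0 hP P0 le_lam inf_lam (K ^+ 2)); first exact: sqr_ge0.
move=> G hG fG; have AG := bergman_space_restr hG fG.
pose H := L%:C *: restr G - T (restr G).
have AH : A H := bergman_space_resolvent _ AG.
have SH : S H = restr G := (SE _ AG).1.
have : N (restr G) <= `|M| * N H.
  rewrite -{1}SH; apply: le_trans (HM _ AH) _.
  by rewrite ler_wpM2r ?bergman_norm_ge0// ler_norm.
move=> /(bergman_norm_le AG AH (normr_ge0 M)).
rewrite (eq_sqn _ (rhp_ext_restr G)) => h; apply: (le_trans h).
have hV : hol (fun z => G z - Vop Phi al lam G z).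
  by move=> z z0; apply: cdiffB; [exact: hG|exact: (@hol_V _ Phi al lam hP P0 G hG z z0)].
have -> : sqn al (rhp_ext H) = ((L ^+ 2)%:E * sqn al (fun z => G z - Vop Phi al lam G z)%R)%E.
  rewrite -[L in (L ^+ 2)%:E](gtr0_norm L0) -normc_real -(sqnZ _ _ hV).
  apply: eq_sqn => z z0; rewrite /H rhp_ext_resolvent !rhp_ext_restr//; last exact: P0.
  rewrite /Vop mulrBr mulrA -rmorphM mulfV ?mul1r//.
  by rewrite gt_eqF.
by rewrite muleA -EFinM /K exprMn.
Qed.

End SpectralRadius.

Local Close Scope complex_scope.
Local Close Scope classical_set_scope.

Theorem theorem3p5 (R : realType) (phi : rhp R -> rhp R) (alpha : R)
  (phi_holo : holomorphic_rhp (fun z => val (phi z)))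
  (alpha_gt : -1 < alpha)
  (phi_bounded : bounded_operator (bergman_space alpha) (bergman_norm alpha)
                   (composition_operator phi)) :
  spectral_radius (bergman_space alpha) (bergman_norm alpha)
    (composition_operator phi)
  = operator_norm (bergman_space alpha) (bergman_norm alpha)
      (composition_operator phi).
Proof.
have [AT _ [M HM]] := phi_bounded.
pose Phi := rhp_ext (fun z => val (phi z)).
have hP : hol Phi by exact/holomorphic_rhpP.
have P0 (z : R[i]%C) : 0 < complex.Re z -> 0 < complex.Re (Phi z).
  by move=> z0; rewrite /Phi rhp_extE; exact: (valP (phi _)).
have HM' F : bergman_space alpha F ->
    bergman_norm alpha (composition_operator phi F) <= `|M| * bergman_norm alpha F.
  by move=> /HM h; apply: (le_trans h); rewrite ler_wpM2r ?bergman_norm_ge0// ler_norm.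
have [lam [l0 le_lam inf_lam]] :=
  lam_exists alpha_gt hP P0 ((composition_sqn_le AT (normr_ge0 M)).1 HM').
pose L := cnorm alpha lam; have L0 : 0 < L := cnorm_gt0 alpha l0.
have HL : forall F, bergman_space alpha F ->
    bergman_norm alpha (composition_operator phi F) <= L * bergman_norm alpha F.
  apply/(composition_sqn_le AT (ltW L0)) => F hF fF.
  by rewrite cnorm_sq//; exact: sqn_comp.
have le1 := operator_norm_le (ltW L0) HL.
have ge0 := operator_norm_ge0 phi alpha.
pose M0 := fine (operator_norm (bergman_space alpha) (bergman_norm alpha) (composition_operator phi)).
have EM : operator_norm (bergman_space alpha) (bergman_norm alpha) (composition_operator phi) = M0%:E.
  by rewrite fineK// ge0_fin_numE//; exact: le_lt_trans le1 (ltry _).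
have M00 : 0 <= M0 by rewrite fine_ge0.
have ML : M0 <= L by rewrite -lee_fin -EM.
have Lspec := norm_in_spectrum phi_holo alpha_gt AT l0 le_lam inf_lam.
(* Every spectral value is at most the norm; conversely the norm is at most L, which is itself a
   spectral value. *)
apply/le_anti/andP; split.
  apply: ge_ereal_sup => _ [l spl <-]; rewrite EM lee_fin.
  exact: spectrum_le_norm (le_operator_norm AT EM HM) spl.
rewrite EM; apply: (@le_trans _ _ L%:E); first by rewrite lee_fin.
by apply: ereal_sup_ubound; exists (L%:C)%C => //; rewrite normc_real gtr0_norm.
Qed.
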